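(* For every integer $1 \le k \le 7$ there is an algorithm that, given a permutation $\pi \in \mathbb{S}_n$, computes the $k$-profile of $\pi$, i.e. the vector $\left(\#\tau(\pi)\right)_{\tau \in \mathbb{S}_k}$, in $\widetilde{\mathcal{O}}(n^2)$ time and $\widetilde{\mathcal{O}}(n^2)$ space.
   Context: A permutation $\pi\in\mathbb{S}_n$ is a bijection of $[n]=\{1,\dots,n\}$, given to the algorithm as the length-$n$ vector $(\pi(1),\dots,\pi(n))$. For $\tau\in\mathbb{S}_k$, an occurrence of $\tau$ in $\pi$ is a $k$-tuple $1\le i_1<\dots<i_k\le n$ such that $\pi(i_j)<\pi(i_l)$ iff $\tau(j)<\tau(l)$ for all $j,l\in[k]$; $\#\tau(\pi)$ denotes the number of occurrences. The notation $\widetilde{\mathcal{O}}(\cdot)$ hides polylogarithmic factors in $n$ (computational model: word-RAM, $k$ fixed). *)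

(* Defs.v *)
From mathcomp Require Import all_boot all_fingroup.

Set Implicit Arguments.
Unset Strict Implicit.
Unset Printing Implicit Defensive.

(** * Permutation patterns *)

(* Positions and values are shifted by one: 'I_n stands for {1, ..., n}. *)

Section Patterns.
Variables (k n : nat).

Definition occurrence (tau : 'S_k) (pi : 'S_n) (i : {ffun 'I_k -> 'I_n}) :=
  [forall j : 'I_k, forall l : 'I_k, (j < l) ==> (i j < i l)] &&
  [forall j : 'I_k, forall l : 'I_k, (pi (i j) < pi (i l)) == (tau j < tau l)].

Definition pattern_count (tau : 'S_k) (pi : 'S_n) : nat :=
  #|[set i : {ffun 'I_k -> 'I_n} | occurrence tau pi i]|.

End Patterns.

(* The coordinates are listed in the order of the canonical enumeration of
   'S_k. *)
Definition profile (k n : nat) (pi : 'S_n) : seq nat :=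
  [seq pattern_count tau pi | tau : 'S_k].

(* The vector (pi(1), ..., pi(n)) with entries in {1, ..., n}. *)
Definition perm_vector (n : nat) (pi : 'S_n) : seq nat :=
  [seq (pi i).+1 | i : 'I_n].

(** * Word-RAM with [w]-bit words *)

Inductive binop :=
  OpAdd | OpSub | OpMul | OpDiv | OpMod | OpAnd | OpOr | OpXor | OpShl | OpShr |
  OpLt | OpEq.

(* Register operands and jump targets are literals of the program; only memory
   is addressed indirectly. *)
Inductive instr :=
  | Const of nat & nat               (* r := c *)
  | Move of nat & nat                (* r := r1 *)
  | Binop of binop & nat & nat & nat (* r := r1 op r2 *)
  | LoadM of nat & nat               (* r := memory[ra] *)
  | StoreM of nat & nat              (* memory[ra] := r *)
  | Jump of nat
  | JumpZ of nat & nat               (* if r = 0 goto l *)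
  | Halt.

Definition program := seq instr.

Record state := State { pc : nat; reg : nat -> nat; memory : nat -> nat }.

Definition upd (f : nat -> nat) (a v : nat) : nat -> nat :=
  fun x => if x == a then v else f x.

Section Machine.
Variables (w : nat) (p : program).

(* Subtraction wraps around; division by zero yields the total values of
   [divn] and [modn]. *)
Definition eval_binop (o : binop) (x y : nat) : nat :=
  match o with
  | OpAdd => x + y
  | OpSub => x + (2 ^ w - y)
  | OpMul => x * y
  | OpDiv => x %/ y
  | OpMod => x %% y
  | OpAnd => Nat.land x y
  | OpOr => Nat.lor x y
  | OpXor => Nat.lxor x y
  | OpShl => x * 2 ^ y
  | OpShr => x %/ 2 ^ y
  | OpLt => x < y
  | OpEq => x == y
  end %% 2 ^ w.

(* Running past the end of the program halts. *)
Definition fetch (s : state) : instr := nth Halt p (pc s).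

Definition halted (s : state) : bool :=
  if fetch s is Halt then true else false.

Definition step (s : state) : state :=
  let: State i R M := s in
  match fetch s with
  | Const r c => State i.+1 (upd R r (c %% 2 ^ w)) M
  | Move r r1 => State i.+1 (upd R r (R r1)) M
  | Binop o r r1 r2 => State i.+1 (upd R r (eval_binop o (R r1) (R r2))) M
  | LoadM r ra => State i.+1 (upd R r (M (R ra))) M
  | StoreM ra r => State i.+1 R (upd M (R ra) (R r))
  | Jump l => State l R M
  | JumpZ r l => State (if R r == 0 then l else i.+1) R M
  | Halt => s
  end.

(* One plus the address accessed by the next instruction, 0 if there is none. *)
Definition touched (s : state) : nat :=
  match fetch s with
  | LoadM _ ra | StoreM ra _ => (reg s ra).+1
  | _ => 0
  end.

(* The length of the shortest initial segment of memory containing all the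
   cells accessed during the first [t] steps. *)
Definition space_used (s : state) (t : nat) : nat :=
  \max_(i < t) touched (iter i step s).

(* The input occupies the first memory cells, its length is in register 0, and
   everything else is 0. *)
Definition init_state (input : seq nat) : state :=
  State 0 (upd (fun=> 0) 0 (size input)) (nth 0 input).

Definition computes (input output : seq nat) (time space : nat) : Prop :=
  exists t : nat,
    let final := iter t step (init_state input) in
    [/\ t <= time, halted final, space_used (init_state input) t <= space
      & mkseq (memory final) (size output) = output].

End Machine.

(* Words of b * (1 + floor(log2 n)) = Theta(log n) bits; for b > 0 a word can
   hold every number up to n. *)
Definition word_size (b n : nat) : nat := b * (trunc_log 2 n).+1.

Definition soft_O (f g : nat -> nat) : Prop :=
  exists C d n0 : nat,
    forall n, n0 <= n -> f n <= C * g n * trunc_log 2 n ^ d.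

(* Main.v *)
(* For a pattern tau of size k <= 7, split its k points ("labels") into bags of
   at most two points and arrange the bags in a tree.  Keeping only the order
   relations of tau inside a bag and between adjacent bags gives a relaxed
   counting problem.  It is solved in time n^2 polylog(n) by eliminating the
   bags one at a time: a bag is an n x n table indexed by pairs of points, and
   summing it into its parent is a 4-dimensional orthogonal range sum for each
   of the n^2 pairs, which dyadic decompositions turn into log^4(n) table
   look-ups.

   The relaxed count is the sum of #sigma over all pairs of linear extensions of
   the two partial orders that are left.  The decisive combinatorial fact is
   that S_k can be ordered so that each tau has a tree for which every other
   sigma in the sum comes earlier; then #tau is the relaxed count minus numbers
   that are already known.  The trees, up to the symmetries of the square, are
   the certificate data, and the triangularity is checked by computation. *)

(* A direct table for 4-dimensional range sums over pairs of points would be too large. But once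
   four bit positions are fixed, the points fall into dyadic classes by position and value, of which
   at most n are nonempty; numbering these compresses the sums over pairs of classes into a single n
   x n table. It is rebuilt for each of the O(log^4 n) choices of bit positions, so the space stays
   quadratic. Boxes also have lower ends, so each is first written as a signed sum of 16 quadrants.
   Signs, like the final subtractions, are harmless because all arithmetic takes place modulo 2^w,
   and a count is recovered exactly since it is below 2^w. Relaxed constraints might also be met by
   sending two labels to the same point. The certificate check excludes this by asking that any two
   labels be comparable, through a chain of constraints, in one of the two orders. The certificate
   depends on k only and is unrolled into the program text. What remains of the control flow are
   loops bounded by n, n + 1 or the bit length of n, so the running time is a matter of counting
   nested loops. *)
Require Import Defs.
From Stdlib Require Import NArith.
From mathcomp Require Import all_boot all_fingroup all_algebra zify ring.

Set Implicit Arguments.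
Unset Strict Implicit.
Unset Printing Implicit Defensive.

Import GRing.Theory.

(** * Certificates *)

(* A tree is the list of its bags, root first, each with the position of its
   parent; a one-point bag [{a}] is written [(a, a)]. *)
Notation tree := (seq ((nat * nat) * nat)).
Definition edge_rel := seq (nat * nat).

Definition bag_of (t : tree) i : nat * nat := (nth ((0, 0), 0) t i).1.
Definition inner_links (b : nat * nat) : edge_rel :=
  if b.1 == b.2 then [::] else [:: b].
Definition cross_links (b c : nat * nat) : edge_rel :=
  [:: (b.1, c.1); (b.1, c.2); (b.2, c.1); (b.2, c.2)].
Definition links (t : tree) : edge_rel :=
  flatten [seq inner_links b.1 | b <- t] ++
  flatten [seq cross_links b.1 (bag_of t b.2) | b <- behead t].
(** Labels are the positions of [tau], so [v = id] orients a link by position and [v = nth 0 tau] by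
    value. *)
Definition orient (v : nat -> nat) (e : nat * nat) :=
  if v e.1 < v e.2 then e else (e.2, e.1).
Definition bag_labels (b : nat * nat) :=
  if b.1 == b.2 then [:: b.1] else [:: b.1; b.2].
Definition tree_labels (t : tree) := flatten [seq bag_labels b.1 | b <- t].

(** Linear extensions, built by repeatedly choosing a minimal element: one with no [E]-predecessor
    left in [s]. *)
Fixpoint lext_rec m (E : edge_rel) (s : seq nat) : seq (seq nat) :=
  if m is m'.+1 then
    flatten [seq [seq a :: X | X <- lext_rec m' E (rem a s)]
            | a <- [seq a <- s | all (fun e => (e.2 != a) || (e.1 \notin s)) E]]
  else [:: [::]].
Definition lext E s := lext_rec (size s) E s.

(* Nested conditionals instead of [&&] and [||], here and in [separated]: these
   would be evaluated eagerly, making the search exponential. *)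
Fixpoint reach m (E : edge_rel) a b :=
  if m is m'.+1 then
    has (fun e => if e.1 == a then if e.2 == b then true else reach m' E e.2 b
                  else false) E
  else false.

(** [X] lists the labels from left to right and [Y] from bottom to top; the result is the one-line
    notation of the permutation they describe. *)
Definition combine (X Y : seq nat) : seq nat := [seq index x Y | x <- X].
Definition patterns k (tau : seq nat) (t : tree) :=
  let E := links t in
  let LX := lext (map (orient id) E) (iota 0 k) in
  let LY := lext (map (orient (nth 0 tau)) E) (iota 0 k) in
  [seq combine X Y | X <- LX, Y <- LY].

(** Without this check two labels could be sent to the same point without breaking a constraint, and
    the relaxed count would not be a sum of pattern counts. Links in [EX] point from smaller to
    larger labels, so for [b < a] only the chain from [b] to [a] has to be tried there. *)
Definition separated k (tau : seq nat) (t : tree) :=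
  let E := links t in
  let EX := map (orient id) E in
  let EY := map (orient (nth 0 tau)) E in
  all (fun a => all (fun b =>
      if a <= b then true else if reach k EX b a then true
      else if reach k EY a b then true else reach k EY b a)
    (iota 0 k)) (iota 0 k).

(* The nodes store the permutations themselves, so that nothing has to be
   proved about the keys. *)
Inductive trie := Leaf | Node of option (seq nat) & trie & trie.
Fixpoint tget p t : option (seq nat) :=
  match t with
  | Leaf => None
  | Node o l r => match p with xH => o | xO q => tget q l | xI q => tget q r end
  end.
Fixpoint tset p s t :=
  match p, t with
  | xH, Leaf => Node (Some s) Leaf Leaf
  | xH, Node _ l r => Node (Some s) l r
  | xO q, Leaf => Node None (tset q s Leaf) Leaf
  | xO q, Node o l r => Node o (tset q s l) r
  | xI q, Leaf => Node None Leaf (tset q s Leaf)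
  | xI q, Node o l r => Node o l (tset q s r)
  end.
Definition push_digit (d : nat) p :=
  match d with
  | 0 => xO (xO (xO p)) | 1 => xI (xO (xO p))
  | 2 => xO (xI (xO p)) | 3 => xI (xI (xO p))
  | 4 => xO (xO (xI p)) | 5 => xI (xO (xI p))
  | 6 => xO (xI (xI p)) | _ => xI (xI (xI p))
  end.
Definition trie_key (s : seq nat) := foldr push_digit xH s.
Definition solved t s := if tget (trie_key s) t is Some s' then s' == s else false.

(** A parent precedes its children in the list, so eliminating bags from the end always removes a
    leaf. *)
Definition tree_ok k (t : tree) :=
  [&& perm_eq (tree_labels t) (iota 0 k), all (fun b => b.1.1 <= b.1.2) t
    & all (fun i => (i == 0) || ((nth ((0, 0), 0) t i).2 < i)) (iota 0 (size t))].
Definition entry_ok k st (e : seq nat * tree) :=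
  let: (tau, t) := e in
  let L := patterns k tau t in
  [&& perm_eq tau (iota 0 k), tree_ok k t, separated k tau t, tau \in L
    & all (solved st) (rem tau L)].
(** The linear extensions of the empty relation are all permutations, so the last test says that
    every pattern has been solved. *)
Fixpoint triangular k st (es : seq (seq nat * tree)) :=
  match es with
  | [::] => all (solved st) (lext [::] (iota 0 k))
  | e :: es' => entry_ok k st e && triangular k (tset (trie_key e.1) e.1 st) es'
  end.

(* An entry is a hexadecimal numeral: 1 if the bags form a star around the first
   one and 2 if they form a path, then tau in one-line notation, then the two
   labels of each bag. *)
Fixpoint hex_digits p acc : seq nat :=
  match p with
  | xH => 1 :: acc
  | xO xH => 2 :: acc
  | xO (xO (xO (xO q))) => hex_digits q (0 :: acc)
  | xI (xO (xO (xO q))) => hex_digits q (1 :: acc)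
  | xO (xI (xO (xO q))) => hex_digits q (2 :: acc)
  | xI (xI (xO (xO q))) => hex_digits q (3 :: acc)
  | xO (xO (xI (xO q))) => hex_digits q (4 :: acc)
  | xI (xO (xI (xO q))) => hex_digits q (5 :: acc)
  | xO (xI (xI (xO q))) => hex_digits q (6 :: acc)
  | xI (xI (xI (xO q))) => hex_digits q (7 :: acc)
  | _ => acc
  end.
Fixpoint pair_up (s : seq nat) : seq (nat * nat) :=
  if s is a :: b :: s' then (a, b) :: pair_up s' else [::].
Definition decode_entry k (x : N) : seq nat * tree :=
  let s := if x is Npos p then hex_digits p [::] else [::] in
  let bs := pair_up (drop k (behead s)) in
  (take k (behead s),
   zip bs (if head 0 s == 1 then nseq (size bs) 0 else 0 :: iota 0 (size bs))).

(** * Symmetries of the square acting on certificate entries *)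

Definition map_tree (f : nat -> nat) (t : tree) : tree :=
  [seq ((minn (f b.1.1) (f b.1.2), maxn (f b.1.1) (f b.1.2)), b.2) | b <- t].
(** Labels are positions: under inversion the label [a] becomes [nth 0 tau a], under reversal
    [k.-1 - a], and under complementation it stays the same. *)
Definition inverse_entry k (e : seq nat * tree) : seq nat * tree :=
  let: (tau, t) := e in
  ([seq index i tau | i <- iota 0 k], map_tree (nth 0 tau) t).
Definition reverse_entry k (e : seq nat * tree) : seq nat * tree :=
  let: (tau, t) := e in (rev tau, map_tree (fun a => k.-1 - a) t).
Definition complement_entry k (e : seq nat * tree) : seq nat * tree :=
  let: (tau, t) := e in ([seq k.-1 - i | i <- tau], t).
(** The entry of a symmetric pattern occurs repeatedly; a repetition merely recomputes a known
    count. *)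
Definition square_orbit k e :=
  let s := [:: e; inverse_entry k e] in
  let s := s ++ map (reverse_entry k) s in s ++ map (complement_entry k) s.
Definition certificate k (c : seq N) :=
  flatten [seq square_orbit k (decode_entry k x) | x <- c].

(** * Linear extensions and pattern counts *)

(** Only links with both ends in [s] count, because the recursion removes elements: a link into the
    removed head is excluded by minimality, and one out of it holds since the head has index 0. *)
Lemma mem_lext E s X : uniq s -> perm_eq X s ->
  (X \in lext E s) =
  all (fun e => (e.1 \in s) && (e.2 \in s) ==> (index e.1 X < index e.2 X)) E.
Proof.
rewrite /lext; move En : (size s) => m; elim: m s X En => [|m IH] s X /=.
  move/size0nil=> -> _ /perm_nilP->; rewrite inE eqxx; symmetry.
  by apply/allP => e _.
move=> sz us pXs; have := perm_size pXs; rewrite sz.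
case: X pXs => [|a X] //= pXs _.
have as' : a \in s by rewrite -(perm_mem pXs) mem_head.
have pX : perm_eq X (rem a s).
  by rewrite -(perm_cons a) (perm_trans pXs) // perm_to_rem.
have szr : size (rem a s) = m by rewrite size_rem // sz.
have uX : uniq (a :: X) by rewrite (perm_uniq pXs).
have aX : a \notin X by case/andP: uX.
transitivity (all (fun e => (e.2 != a) || (e.1 \notin s)) E && (X \in lext_rec m E (rem a s))).
  apply/flatten_mapP/andP => [[b]|[ha hX]].
    rewrite mem_filter => /andP[hb bs] /mapP[Z hZ [? ?]]; subst b Z; by [].
  by exists a; [rewrite mem_filter ha | apply/mapP; exists X].
rewrite IH ?rem_uniq // -all_predI; apply: eq_in_all => -[u v] _ /=.
rewrite !mem_rem_uniq // !inE [a == u]eq_sym [a == v]eq_sym.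
case: (eqVneq v a) => [->|va] /=.
  by rewrite ltn0 as' andbF andbT implybF; case: (u \in s).
by case: (eqVneq u a) => [->|ua] //=; rewrite as' /= implybT.
Qed.

Lemma lext_perm E s X : uniq s -> X \in lext E s -> perm_eq X s.
Proof.
rewrite /lext; move En : (size s) => m; elim: m s X En => [|m IH] s X /=.
  by move/size0nil=> -> _; rewrite inE => /eqP->.
move=> sz us /flatten_mapP[a]; rewrite mem_filter => /andP[_ as'] /mapP[Z hZ ->].
have := IH _ _ _ (rem_uniq a us) hZ; rewrite size_rem // sz => /(_ erefl) pZ.
by rewrite (perm_trans _ (_ : perm_eq (a :: rem a s) s)) ?perm_cons // perm_sym perm_to_rem.
Qed.

Lemma lext_uniq E s : uniq s -> uniq (lext E s).
Proof.
rewrite /lext; move En : (size s) => m; elim: m s En => [|m IH] s //= sz us.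
set c := filter _ s.
have uc : uniq c by apply: filter_uniq.
have cs : {subset c <= s} by move=> a; rewrite mem_filter => /andP[].
elim: c uc cs => //= a c IHc /andP[ac uc] cs.
rewrite cat_uniq map_inj_uniq => [|u v [] //].
rewrite IH ?rem_uniq ?size_rem ?sz ?cs ?mem_head //=.
rewrite IHc // => [|z hz]; last by apply: cs; rewrite inE hz orbT.
rewrite andbT; apply/hasPn => Z /flatten_mapP[b bc] /mapP[W _ ->].
by apply/mapP => -[V _ [ba _]]; rewrite -ba bc in ac.
Qed.

Definition increasing (g : nat -> nat) (X : seq nat) := sorted ltn (map g X).

Lemma increasingP (g : nat -> nat) X :
  reflect (forall i j, i < j < size X -> g (nth 0 X i) < g (nth 0 X j)) (increasing g X).
Proof.
rewrite /increasing; apply: (iffP idP) => [h i j /andP[ij jX]|h].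
  have := @sorted_ltn_nth _ ltn ltn_trans 0 _ h i j.
  rewrite !inE size_map (ltn_trans ij jX) jX => /(_ isT isT ij).
  by rewrite !(nth_map 0) // (ltn_trans ij).
apply/(sortedP 0) => i; rewrite size_map => hi.
by rewrite !(nth_map 0) ?(ltnW hi) //; apply: h; rewrite ltnSn.
Qed.

Lemma increasing_index (g : nat -> nat) X : increasing g X ->
  {in X &, forall u v, (index u X < index v X) = (g u < g v)}.
Proof.
move/increasingP=> h u v uX vX.
have H a b : a \in X -> b \in X -> index a X < index b X -> g a < g b.
  by move=> aX bX ab; have := h (index a X) (index b X); rewrite ab index_mem bX !nth_index //; apply.
apply/idP/idP => [|guv]; first exact: H.
case: ltngtP => // [|e]; first by move/(H _ _ vX uX) => gvu; rewrite ltnNge ltnW in guv.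
by move: guv; rewrite -(nth_index 0 uX) e nth_index // ltnn.
Qed.

(** Sorting [s] by [g] gives the only arrangement along which [g] increases, so the count is the
    indicator that this arrangement is a linear extension. *)
Lemma count_increasing_lext (g : nat -> nat) E s : uniq s -> {in s &, injective g} ->
  all (fun e => (e.1 \in s) && (e.2 \in s)) E ->
  count (increasing g) (lext E s) = all (fun e => g e.1 < g e.2) E.
Proof.
move=> us ginj Es; set X0 := sort (relpre g leq) s.
have pX0 : perm_eq X0 s by rewrite /X0 perm_sort.
have uX0 : uniq X0 by rewrite (perm_uniq pX0).
have iX0 : increasing g X0.
  rewrite /increasing ltn_sorted_uniq_leq; apply/andP; split.
    by rewrite map_inj_in_uniq // => u v; rewrite !(perm_mem pX0); apply: ginj.
  by rewrite sorted_map; apply: sort_sorted => u v; apply: leq_total.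
have -> : count (increasing g) (lext E s) = count_mem X0 (lext E s).
  apply: eq_in_count => X /(lext_perm us) pX /=; apply/idP/eqP => [iX|-> //].
  apply: (@irr_sorted_eq _ (relpre g ltn)).
  - by move=> u v z; apply: ltn_trans.
  - by move=> u; apply: ltnn.
  - by rewrite -sorted_map.
  - by rewrite -sorted_map.
  - by move=> u; rewrite (perm_mem pX) (perm_mem pX0).
rewrite count_uniq_mem ?lext_uniq // mem_lext //; congr nat_of_bool.
apply: eq_in_all => e /(allP Es)/andP[e1 e2]; rewrite e1 e2 /=.
by rewrite (increasing_index iX0) // (perm_mem pX0).
Qed.

Lemma reach_lt (g : nat -> nat) E m a b : all (fun e => g e.1 < g e.2) E ->
  reach m E a b -> g a < g b.
Proof.
move=> /allP hE; elim: m a => //= m IH a /hasP[e eE].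
case: eqP => // <-; case: eqP => [<- _|_ /IH]; first exact: hE.
by apply: ltn_trans; apply: hE.
Qed.

(* Assignments of points to labels are read as functions on [nat]; outside the
   labels they take the junk value [0]. *)
Definition extend k n (f : {ffun 'I_k -> 'I_n}) (l : nat) : nat :=
  if insub l is Some j then f j else 0.

Lemma extendE k n (f : {ffun 'I_k -> 'I_n}) (j : 'I_k) : extend f j = f j.
Proof. by rewrite /extend valK. Qed.

Definition pattern_count_seq k n (pi : 'S_n) (s : seq nat) : nat :=
  #|[set i : {ffun 'I_k -> 'I_n} |
     [forall j : 'I_k, forall l : 'I_k, (j < l) ==> (i j < i l)] &&
     [forall j : 'I_k, forall l : 'I_k,
        (pi (i j) < pi (i l)) == (nth 0 s j < nth 0 s l)]]|.

Definition one_line k (tau : 'S_k) : seq nat := [seq val (tau i) | i <- enum 'I_k].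

Lemma nth_one_line k (tau : 'S_k) (j : 'I_k) : nth 0 (one_line tau) j = tau j.
Proof. by rewrite (nth_map j) ?size_enum_ord // nth_ord_enum. Qed.

Lemma pattern_count_one_line k n (tau : 'S_k) (pi : 'S_n) :
  pattern_count tau pi = pattern_count_seq k pi (one_line tau).
Proof.
apply: eq_card => i; rewrite !inE /occurrence; congr (_ && _).
by apply: eq_forallb => j; apply: eq_forallb => l; rewrite !nth_one_line.
Qed.

Lemma one_line_perm k (tau : 'S_k) : perm_eq (one_line tau) (iota 0 k).
Proof.
apply: uniq_perm; rewrite ?iota_uniq //.
  by rewrite map_inj_uniq ?enum_uniq // => i j /val_inj/perm_inj.
move=> a; rewrite mem_iota /= add0n; apply/mapP/idP => [[i _ ->]|ak]; first exact: ltn_ord.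
by exists ((tau^-1)%g (Ordinal ak)); rewrite ?mem_enum // permKV.
Qed.

Definition pvalue n (pi : 'S_n) (i : nat) : nat := if insub i is Some j then pi j else 0.

Lemma pvalueE n (pi : 'S_n) (i : 'I_n) : pvalue pi i = pi i.
Proof. by rewrite /pvalue valK. Qed.

(** Reading an assignment along [X] gives a tuple of positions from left to right; the bijection
    [Phi] from tuples to assignments undoes this reading and matches occurrences with
    assignments. *)
Lemma combine_count k n (pi : 'S_n) X Y :
  perm_eq X (iota 0 k) -> perm_eq Y (iota 0 k) ->
  \sum_(f : {ffun 'I_k -> 'I_n})
     (increasing (extend f) X && increasing (pvalue pi \o extend f) Y) =
  pattern_count_seq k pi (combine X Y).
Proof.
move=> pX pY.
have sX : size X = k by rewrite (perm_size pX) size_iota.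
have sY : size Y = k by rewrite (perm_size pY) size_iota.
have uX : uniq X by rewrite (perm_uniq pX) iota_uniq.
have uY : uniq Y by rewrite (perm_uniq pY) iota_uniq.
have mX l : (l \in X) = (l < k) by rewrite (perm_mem pX) mem_iota.
have mY l : (l \in Y) = (l < k) by rewrite (perm_mem pY) mem_iota.
have hX (j : 'I_k) : nth 0 X j < k by rewrite -mX mem_nth ?sX.
have hI (j : 'I_k) : index (val j) X < k by have := index_mem (val j) X; rewrite sX mX ltn_ord => ->.
pose rho (j : 'I_k) : 'I_k := Ordinal (hX j).
pose rhoV (j : 'I_k) : 'I_k := Ordinal (hI j).
have rhoK : cancel rho rhoV by move=> j; apply: val_inj; rewrite /= index_uniq ?sX.
have rhoVK : cancel rhoV rho by move=> j; apply: val_inj; rewrite /= nth_index ?mX.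
pose Phi (f : {ffun 'I_k -> 'I_n}) : {ffun 'I_k -> 'I_n} := [ffun j => f (rhoV j)].
pose Psi (f : {ffun 'I_k -> 'I_n}) : {ffun 'I_k -> 'I_n} := [ffun j => f (rho j)].
have PhiK : cancel Phi Psi by move=> f; apply/ffunP => j; rewrite !ffunE rhoK.
have PsiK : cancel Psi Phi by move=> f; apply/ffunP => j; rewrite !ffunE rhoVK.
rewrite (reindex Phi) /=; last by exists Psi => f _; [apply: PhiK | apply: PsiK].
rewrite /pattern_count_seq -sum1dep_card [RHS]big_mkcond /=; apply: eq_bigr => i _.
have Ei (j : 'I_k) : extend (Phi i) (nth 0 X j) = i j.
  by rewrite -[nth 0 X j]/(val (rho j)) extendE ffunE rhoK.
have Gi (j : 'I_k) : (pvalue pi \o extend (Phi i)) (nth 0 X j) = pi (i j).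
  by rewrite /= Ei pvalueE.
set P := _ && _; set Q := _ && _; suff -> : P = Q by case: Q.
rewrite {}/P {}/Q; congr (_ && _).
  apply/increasingP/forallP => [h j|h a b /andP[ab]].
    apply/forallP => l; apply/implyP => jl; rewrite -!Ei; apply: h.
    by rewrite jl sX ltn_ord.
  rewrite sX => bk; have ak := ltn_trans ab bk.
  rewrite -[a]/(val (Ordinal ak)) -[b]/(val (Ordinal bk)) !Ei.
  by have /forallP/(_ (Ordinal bk))/implyP := h (Ordinal ak); apply.
apply/idP/idP => [iY|/forallP h].
  apply/forallP => j; apply/forallP => l; rewrite -!Gi /combine.
  rewrite !(nth_map 0) ?sX ?ltn_ord // (increasing_index iY) //.
  - by rewrite mY -mX mem_nth // sX.
  - by rewrite mY -mX mem_nth // sX.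
apply/increasingP => a b; rewrite sY => /andP[ab bk]; have ak := ltn_trans ab bk.
have ha : nth 0 Y a < k by rewrite -mY mem_nth ?sY.
have hb : nth 0 Y b < k by rewrite -mY mem_nth ?sY.
have := h (rhoV (Ordinal ha)) => /forallP/(_ (rhoV (Ordinal hb)))/eqP.
rewrite -!Gi /combine !(nth_map 0) ?sX ?ltn_ord //= !nth_index ?mX //.
by rewrite !index_uniq ?sY // => ->.
Qed.

Definition x_edges (t : tree) := map (orient id) (links t).
Definition y_edges (tau : seq nat) (t : tree) := map (orient (nth 0 tau)) (links t).

Definition respects (t : tree) (tau : seq nat) (y f : nat -> nat) :=
  all (fun e => f e.1 < f e.2) (x_edges t) &&
  all (fun e => y (f e.1) < y (f e.2)) (y_edges tau t).

Lemma orient_in (v : nat -> nat) (s : seq nat) (E : edge_rel) :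
  all (fun e => (e.1 \in s) && (e.2 \in s)) E ->
  all (fun e => (e.1 \in s) && (e.2 \in s)) (map (orient v) E).
Proof.
move=> /allP h; apply/allP => e /mapP[e' e'E ->]; rewrite /orient.
by have /andP[e1 e2] := h _ e'E; case: ifP; rewrite /= e1 e2.
Qed.

Lemma bag_of_labels (t : tree) i : i < size t ->
  ((bag_of t i).1 \in tree_labels t) && ((bag_of t i).2 \in tree_labels t).
Proof.
move=> it; rewrite /bag_of; have := mem_nth ((0, 0), 0) it; set b := nth _ _ _ => bt.
apply/andP; split; apply/flatten_mapP; exists b => //; rewrite /bag_labels;
  by case: eqP => [->|_]; rewrite !inE eqxx ?orbT.
Qed.

Lemma links_labels k (t : tree) : tree_ok k t ->
  all (fun e => (e.1 \in iota 0 k) && (e.2 \in iota 0 k)) (links t).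
Proof.
case/and3P=> pl _ /allP hp; have lab i : i < size t ->
    ((bag_of t i).1 \in iota 0 k) && ((bag_of t i).2 \in iota 0 k).
  by rewrite -!(perm_mem pl); apply: bag_of_labels.
rewrite /links all_cat; apply/andP; split; apply/allP => e /flatten_mapP[b bt].
  have bi : b.1 = bag_of t (index b t) by rewrite /bag_of nth_index.
  rewrite /inner_links; case: ifP => //; rewrite inE => _ /eqP->.
  by rewrite bi lab // index_mem.
case: t hp lab bt {pl} => // r t hp lab; rewrite [behead _]/= => bt.
have szi : (index b t).+1 < size (r :: t) by rewrite /= ltnS index_mem.
have := hp (index b t).+1; rewrite mem_iota add0n szi => /(_ isT) /=.
rewrite nth_index // => hpar; have h2 := lab _ (leq_trans hpar (ltnW szi)).
have h1 := lab _ szi; rewrite {1 2}/bag_of /= nth_index // in h1.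
case/andP: h1 => b1 b2; case/andP: h2 => c1 c2.
by rewrite !inE => /or4P[] /eqP->; rewrite /= ?b1 ?b2 ?c1 ?c2.
Qed.

(** An injective assignment increases along exactly one arrangement of the labels by position and
    one by value, so it is counted for at most one pair of extensions, and for exactly one iff it
    respects all links. A non-injective assignment contributes nothing on either side. *)
Lemma respects_count k n (pi : 'S_n) tau t :
  tree_ok k t -> separated k tau t ->
  \sum_(f : {ffun 'I_k -> 'I_n}) respects t tau (pvalue pi) (extend f) =
  \sum_(s <- patterns k tau t) pattern_count_seq k pi s.
Proof.
move=> tok sep; have lin := links_labels tok.
have hx := orient_in id lin; have hy := orient_in (nth 0 tau) lin.
set LX := lext (x_edges t) (iota 0 k); set LY := lext (y_edges tau t) (iota 0 k).
transitivity (\sum_(f : {ffun 'I_k -> 'I_n}) \sum_(X <- LX) \sum_(Y <- LY)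
   (increasing (extend f) X && increasing (pvalue pi \o extend f) Y)).
  apply: eq_bigr => f _; rewrite /respects.
  transitivity (count (increasing (extend f)) LX * count (increasing (pvalue pi \o extend f)) LY).
    have [inj|ninj] := boolP (injectiveb f).
      have xinj : {in iota 0 k &, injective (extend f)}.
        move=> a b; rewrite !mem_iota !add0n /= => ak bk.
        rewrite -[a]/(val (Ordinal ak)) -[b]/(val (Ordinal bk)) !extendE.
        by move/val_inj/(injectiveP _ inj)->.
      have yinj : {in iota 0 k &, injective (pvalue pi \o extend f)}.
        move=> a b ha hb /= e; apply: xinj => //; move: ha hb e.
        rewrite !mem_iota !add0n /= => ak bk.
        rewrite -[a]/(val (Ordinal ak)) -[b]/(val (Ordinal bk)) !extendE !pvalueE.
        by move/val_inj/perm_inj->.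
      by rewrite !count_increasing_lext ?iota_uniq // mulnb.
    (* Two labels at the same point would violate the chain of links that makes them comparable. *)
    have /negPf -> : ~~ (all (fun e => extend f e.1 < extend f e.2) (x_edges t) &&
        all (fun e => pvalue pi (extend f e.1) < pvalue pi (extend f e.2)) (y_edges tau t)).
      apply: contra ninj => /andP[ax ay]; apply/injectiveP => a b fab.
      wlog ab : a b fab / a <= b => [H|].
        by case: (leqP a b) => [|/ltnW] h; [apply: H | symmetry; apply: H].
      apply/eqP; apply: contraT => nab; move: sep => /allP/(_ (val b)).
      rewrite mem_iota ltn_ord => /(_ isT)/allP/(_ (val a)).
      rewrite mem_iota ltn_ord => /(_ isT).
      have {nab}ab : a < b by rewrite ltn_neqAle nab.
      have E : extend f a = extend f b by rewrite !extendE fab.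
      rewrite leqNgt ab /=; case: ifP => [/(reach_lt ax)|_]; first by rewrite E ltnn.
      case: ifP => [/(reach_lt (g := pvalue pi \o extend f) ay)|_]; first by rewrite /= E ltnn.
      by move/(reach_lt (g := pvalue pi \o extend f) ay); rewrite /= E ltnn.
    suff -> : count (increasing (extend f)) LX = 0 by [].
    apply/eqP; rewrite -leqn0 leqNgt -has_count; apply: contra ninj => /hasP[X XL iX].
    have pX := lext_perm (iota_uniq 0 k) XL.
    apply/injectiveP => a b fab; apply: val_inj => /=.
    have am (c : 'I_k) : val c \in X by rewrite (perm_mem pX) mem_iota /=.
    have E : extend f a = extend f b by rewrite !extendE fab.
    have := increasing_index iX (am a) (am b); have := increasing_index iX (am b) (am a).
    rewrite E ltnn; case: ltngtP => // e _ _.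
    by rewrite -(nth_index 0 (am a)) -(nth_index 0 (am b)) e.
  rewrite -!sum1_count big_mkcond [X in _ * X]big_mkcond big_distrlr /=.
  apply: eq_bigr => X _; apply: eq_bigr => Y _.
  by case: increasing; case: increasing.
rewrite exchange_big /= /patterns big_allpairs_dep /=; apply: eq_big_seq => X XL.
rewrite exchange_big /=; apply: eq_big_seq => Y YL.
by rewrite combine_count // ?(lext_perm _ XL) ?(lext_perm _ YL) ?iota_uniq.
Qed.

(** * Eliminating the bags of a tree *)

Lemma all_flatten_map (S T : Type) (P : pred T) (g : S -> seq T) (s : seq S) :
  all P (flatten [seq g b | b <- s]) = all (fun b => all P (g b)) s.
Proof. by elim: s => //= b s IH; rewrite all_cat IH. Qed.

Definition agree (u v a b : nat) := if u < v then a < b else b < a.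

Definition link_ok (tau : seq nat) (y : nat -> nat) (e : nat * nat) (p q : nat) :=
  agree e.1 e.2 p q && agree (nth 0 tau e.1) (nth 0 tau e.2) (y p) (y q).

Lemma respectsE t tau y f :
  respects t tau y f = all (fun e => link_ok tau y e (f e.1) (f e.2)) (links t).
Proof.
rewrite /respects !all_map -all_predI; apply: eq_all => e /=.
by rewrite /link_ok /agree /orient /=; congr (_ && _); case: ifP.
Qed.

(** A one-point bag also gets a table with two indices, supported on the diagonal, so that all bags
    are treated alike. *)
Definition bag_ok tau y (b : nat * nat) p q :=
  if b.1 == b.2 then p == q else link_ok tau y b p q.

Definition cross_ok tau y (b c : nat * nat) r s p q :=
  [&& link_ok tau y (b.1, c.1) r p, link_ok tau y (b.1, c.2) r q,
      link_ok tau y (b.2, c.1) s p & link_ok tau y (b.2, c.2) s q].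

Definition parent (t : tree) i := (nth ((0, 0), 0) t i).2.

Section Elimination.
Local Open Scope ring_scope.
Variables (R : comNzRingType) (n : nat).

Lemma prod_bool (T : Type) (P : pred T) (s : seq T) :
  \prod_(b <- s) (P b)%:R = (all P s)%:R :> R.
Proof.
elim: s => [|b s IH]; first by rewrite big_nil.
by rewrite big_cons IH /= -mulnb natrM.
Qed.

(** Summing over one label at a time, with the environment [e] recording the choices, makes the
    labels of the last bag an inner sum that can be isolated. *)
Fixpoint sum_over (ls : seq nat) (e : nat -> nat) (F : (nat -> nat) -> R) : R :=
  if ls is l :: ls' then \sum_(x < n) sum_over ls' (upd e l x) F else F e.

Lemma sum_over_cat s1 s2 e F :
  sum_over (s1 ++ s2) e F = sum_over s1 e (fun e' => sum_over s2 e' F).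
Proof. by elim: s1 e => //= l s1 IH e; apply: eq_bigr => x _; apply: IH. Qed.

Lemma eq_sum_over s e F G : F =1 G -> sum_over s e F = sum_over s e G.
Proof. by move=> FG; elim: s e => //= l s IH e; apply: eq_bigr => x _; apply: IH. Qed.

Lemma sum_over_ffun k ls e (F : (nat -> nat) -> R) :
  uniq ls -> all (fun l => l < k)%N ls ->
  (forall l, (l < k)%N -> l \notin ls -> (e l < n)%N) ->
  (forall f g, (forall l, (l < k)%N -> f l = g l) -> F f = F g) ->
  sum_over ls e F =
  \sum_(f : {ffun 'I_k -> 'I_n} | [forall j : 'I_k, (val j \in ls) || (val (f j) == e j)])
     F (extend f).
Proof.
move=> + + + extF; elim: ls e => [|l ls IH] e /=.
  move=> _ _ he; have he' (j : 'I_k) : (e j < n)%N by apply: he.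
  pose f0 : {ffun 'I_k -> 'I_n} := [ffun j => Ordinal (he' j)].
  rewrite (big_pred1 f0); last first.
    move=> f /=; apply/forallP/eqP => [h|-> j]; last by rewrite ffunE eqxx.
    by apply/ffunP => j; rewrite ffunE; apply: val_inj; apply/eqP; apply: h.
  by apply: extF => j jk; rewrite -[j]/(val (Ordinal jk)) extendE ffunE.
move=> /andP[lls uls] /andP[lk ksl] he.
rewrite (partition_big (fun f : {ffun 'I_k -> 'I_n} => f (Ordinal lk)) predT) //=.
apply: eq_bigr => x _; rewrite IH //; last first.
  move=> j jk jls; rewrite /upd; case: eqP => // jl; apply: he => //.
  by rewrite inE negb_or jls andbT; apply/eqP.
apply: eq_bigl => f; apply/forallP/andP => [h|[/forallP h /eqP fx] j].
  split; last first.
    by have := h (Ordinal lk); rewrite /= (negPf lls) /upd eqxx.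
  apply/forallP => j; have := h j; rewrite inE /upd.
  by case: (val j == l).
have := h j; rewrite inE /upd; case: eqP => [jl _|//].
by apply/orP; right; rewrite -fx; apply/eqP; congr (val (f _)); apply: val_inj.
Qed.

Lemma sum_over_all k ls e (F : (nat -> nat) -> R) :
  perm_eq ls (iota 0 k) ->
  (forall f g, (forall l, (l < k)%N -> f l = g l) -> F f = F g) ->
  sum_over ls e F = \sum_(f : {ffun 'I_k -> 'I_n}) F (extend f).
Proof.
move=> pls extF; rewrite (@sum_over_ffun k) ?(perm_uniq pls) ?iota_uniq //.
- by apply: eq_bigl => f; apply/forallP => j; rewrite (perm_mem pls) mem_iota /= add0n ltn_ord.
- by apply/allP => l; rewrite (perm_mem pls) mem_iota.
- by move=> l lk; rewrite (perm_mem pls) mem_iota /= lk.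
Qed.

Variables (tau : seq nat) (y : nat -> nat) (t : tree).
Implicit Type A : nat -> nat -> nat -> R.

Definition edge_factor i (f : nat -> nat) : R :=
  let b := bag_of t i in let c := bag_of t (parent t i) in
  (cross_ok tau y b c (f b.1) (f b.2) (f c.1) (f c.2))%:R.

(** What is left once the bags from [m] on are eliminated: a table for each remaining bag and the
    constraints on the edges between them. *)
Definition weight A m (f : nat -> nat) : R :=
  (\prod_(i < m) A i (f (bag_of t i).1) (f (bag_of t i).2)) *
  \prod_(1 <= i < m) edge_factor i f.

Definition label_prefix m := flatten [seq bag_labels (bag_of t i) | i <- iota 0 m].

Definition total A m := sum_over (label_prefix m) (fun=> 0%N) (weight A m).

Definition aggregate i (B : nat -> nat -> R) p q : R :=
  \sum_(r < n) \sum_(s < n)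
    (cross_ok tau y (bag_of t i) (bag_of t (parent t i)) r s p q)%:R * B r s.

Definition absorb A m i p q : R :=
  if i == parent t m then A i p q * aggregate m (A m) p q else A i p q.

(** Used twice: it collapses the double sum of a one-point bag to the diagonal, and it lets the
    range sums for a parent assume that its two points are ordered like their labels. *)
Definition supported A := forall i p q, (i < size t)%N ->
  ~~ bag_ok tau y (bag_of t i) p q -> A i p q = 0.

Lemma sum_bag i (B : nat -> nat -> R) (c : nat -> nat -> R) e :
  (forall p q, ~~ bag_ok tau y (bag_of t i) p q -> B p q = 0) ->
  sum_over (bag_labels (bag_of t i)) e
    (fun f => c (f (bag_of t i).1) (f (bag_of t i).2) * B (f (bag_of t i).1) (f (bag_of t i).2)) =
  \sum_(r < n) \sum_(s < n) c r s * B r s.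
Proof.
rewrite /bag_labels /bag_ok; case: eqP => [<-|/eqP ab] supp /=; last first.
  apply: eq_bigr => r _; apply: eq_bigr => s _.
  by rewrite /upd !eqxx (negPf ab).
apply: eq_bigr => r _; rewrite /upd eqxx (bigD1 r) //= big1 ?addr0 // => s sr.
by rewrite supp ?mulr0 // eq_sym.
Qed.

Hypothesis tok : exists k, tree_ok k t.

Lemma tree_labelsE : tree_labels t = label_prefix (size t).
Proof.
rewrite /tree_labels /label_prefix /bag_of; congr flatten.
by rewrite -{1}[t](mkseq_nth ((0, 0), 0)%N) /mkseq -map_comp.
Qed.

Lemma label_prefixS m : label_prefix m.+1 = label_prefix m ++ bag_labels (bag_of t m).
Proof. by rewrite /label_prefix -addn1 iotaD map_cat flatten_cat /= cats0. Qed.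

Lemma mem_bag_labels (b : nat * nat) : (b.1 \in bag_labels b) && (b.2 \in bag_labels b).
Proof. by rewrite /bag_labels; case: eqP => [->|_]; rewrite !inE !eqxx ?orbT. Qed.

Lemma label_disjoint i m l : (i < m)%N -> (m < size t)%N ->
  l \in bag_labels (bag_of t i) -> l \notin bag_labels (bag_of t m).
Proof.
move=> im mt li; case: tok => k /and3P[pl _ _].
have : uniq (tree_labels t) by rewrite (perm_uniq pl) iota_uniq.
rewrite tree_labelsE.
have -> : label_prefix (size t) =
    label_prefix m.+1 ++ flatten [seq bag_labels (bag_of t i) | i <- iota m.+1 (size t - m.+1)].
  by rewrite /label_prefix -flatten_cat -map_cat -iotaD subnKC.
rewrite cat_uniq => /andP[+ _]; rewrite label_prefixS cat_uniq => /and3P[_ /hasPn h _].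
apply/negP => /h /negP; apply; apply/flatten_mapP; exists i => //.
by rewrite mem_iota.
Qed.

Lemma sum_over_const s e (F : (nat -> nat) -> R) (G : (nat -> nat) -> R) :
  (forall f, (forall l, l \notin s -> f l = e l) -> F f = G f) ->
  sum_over s e F = sum_over s e G.
Proof.
elim: s e => [|l s IH] e h /=; first exact: h.
apply: eq_bigr => x _; apply: IH => f hf; apply: h => j.
by rewrite inE negb_or => /andP[jl js]; rewrite hf // /upd (negPf jl).
Qed.

Lemma sum_overZ s e c (F : (nat -> nat) -> R) :
  sum_over s e (fun f => c * F f) = c * sum_over s e F.
Proof. by elim: s e => //= l s IH e; rewrite mulr_sumr; apply: eq_bigr => x _; apply: IH. Qed.

(** Distributivity: parents precede children and bags are disjoint, so the labels of bag [m] occur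
    only in its own table and in the edge to its parent. All other factors leave the inner sum,
    which becomes the aggregate. *)
Lemma total_step A m : (0 < m < size t)%N -> supported A ->
  total A m.+1 = total (absorb A m) m.
Proof.
case/andP=> m0 mt supp; rewrite /total label_prefixS sum_over_cat; apply: eq_sum_over => e.
set b := bag_of t m; set c := bag_of t (parent t m).
have parm : (parent t m < m)%N.
  case: tok => k /and3P[_ _ /allP/(_ m)]; rewrite mem_iota mt => /(_ isT).
  by rewrite (gtn_eqF m0).
have old f : (forall l, l \notin bag_labels b -> f l = e l) -> forall i, (i < m)%N ->
    f (bag_of t i).1 = e (bag_of t i).1 /\ f (bag_of t i).2 = e (bag_of t i).2.
  move=> hf i im; have /andP[l1 l2] := mem_bag_labels (bag_of t i).
  by split; apply: hf; apply: (label_disjoint im mt).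
transitivity (sum_over (bag_labels b) e (fun f =>
   weight A m e * ((cross_ok tau y b c (f b.1) (f b.2) (e c.1) (e c.2))%:R * A m (f b.1) (f b.2)))).
  apply: sum_over_const => f hf; have {old}old := old f hf.
  rewrite /weight big_ord_recr big_nat_recr //= -!mulrA.
  have -> : \prod_(i < m) A i (f (bag_of t i).1) (f (bag_of t i).2) =
            \prod_(i < m) A i (e (bag_of t i).1) (e (bag_of t i).2).
    by apply: eq_bigr => i _; have [-> ->] := old i (ltn_ord i).
  congr (_ * _); rewrite mulrCA; congr (_ * _).
    apply: eq_big_nat => i /andP[i1 im]; rewrite /edge_factor.
    have pari : (parent t i < m)%N.
      apply: (ltn_trans _ im); case: tok => k /and3P[_ _ /allP/(_ i)].
      rewrite mem_iota (ltn_trans im mt) => /(_ isT).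
      by rewrite (gtn_eqF i1).
    by have [-> ->] := old i im; have [-> ->] := old _ pari.
  by rewrite mulrC /edge_factor; have [-> ->] := old _ parm.
rewrite sum_overZ (@sum_bag m (A m) (fun r s => (cross_ok tau y b c r s (e c.1) (e c.2))%:R)); last first.
  by move=> p q; apply: supp.
rewrite -/(aggregate m (A m) (e c.1) (e c.2)) /weight mulrAC; congr (_ * _).
(* The table of the parent is singled out on both sides, as it is the factor that takes up the
   aggregate. *)
rewrite (bigD1 (Ordinal parm)) //= [RHS](bigD1 (Ordinal parm)) //= mulrAC.
rewrite /absorb eqxx -/c; congr (_ * _); apply: eq_bigr => i ni.
by rewrite ifN.
Qed.

Lemma absorb_supported A m : supported A -> supported (absorb A m).
Proof. by move=> h i p q it nb; rewrite /absorb; case: ifP => _; rewrite h // mul0r. Qed.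

Lemma total_root A : (0 < size t)%N -> supported A ->
  total A 1 = \sum_(r < n) \sum_(s < n) A 0 r s.
Proof.
move=> t0 supp; rewrite /total label_prefixS /=.
transitivity (sum_over (bag_labels (bag_of t 0)) (fun=> 0%N)
   (fun f => 1 * A 0 (f (bag_of t 0).1) (f (bag_of t 0).2))).
  by apply: eq_sum_over => f; rewrite /weight big_ord_recr big_ord0 /= big_geq // mulr1.
rewrite (@sum_bag 0 (A 0) (fun _ _ => 1)) => [|p q]; last by apply: supp.
by apply: eq_bigr => r _; apply: eq_bigr => s _; rewrite mul1r.
Qed.

Definition base_table i p q : R := (bag_ok tau y (bag_of t i) p q)%:R.

Lemma base_supported : supported base_table.
Proof. by move=> i p q _ /negPf; rewrite /base_table => ->. Qed.

Lemma total_base k : tree_ok k t ->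
  total base_table (size t) =
  (\sum_(f : {ffun 'I_k -> 'I_n}) respects t tau y (extend f))%:R.
Proof.
move=> tk; have /and3P[pl _ hp] := tk; rewrite tree_labelsE in pl.
rewrite /total; rewrite (sum_over_all _ pl); last first.
  move=> f g fg.
  have lab i : (i < size t)%N -> f (bag_of t i).1 = g (bag_of t i).1 /\ f (bag_of t i).2 = g (bag_of t i).2.
    move=> it; have := bag_of_labels it; rewrite tree_labelsE !(perm_mem pl) !mem_iota /= !add0n.
    by case/andP=> l1 l2; rewrite !fg.
  rewrite /weight; congr (_ * _).
    by apply: eq_bigr => i _; have [-> ->] := lab i (ltn_ord i).
  apply: eq_big_nat => i /andP[i1 im]; rewrite /edge_factor.
  have pari : (parent t i < size t)%N.
    apply: (ltn_trans _ im); move/allP/(_ i): hp.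
    by rewrite mem_iota im => /(_ isT); rewrite (gtn_eqF i1).
  by have [-> ->] := lab i im; have [-> ->] := lab _ pari.
rewrite natr_sum; apply: eq_bigr => f _; rewrite respectsE /links all_cat.
rewrite -mulnb natrM /weight; congr (_ * _).
  rewrite all_flatten_map -prod_bool (big_nth ((0, 0), 0)%N) big_mkord.
  apply: eq_bigr => i _; rewrite /base_table /bag_of /=; congr (nat_of_bool _)%:R.
  by rewrite /bag_ok /inner_links; case: eqP => [->|_] /=; rewrite ?eqxx ?andbT.
rewrite all_flatten_map -prod_bool (big_nth ((0, 0), 0)%N) size_behead big_add1.
apply: eq_big_nat => i _; rewrite nth_behead /edge_factor /cross_ok /=.
by rewrite /parent /bag_of ?andbT.
Qed.
End Elimination.

(** * Boxes as signed sums of quadrants *)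

(** A one-bit of [a] at position [i] contributes to [[0, a)] the dyadic interval of length [2 ^ i]
    obtained by clearing that bit and freeing the lower ones; this is its indicator at [r]. *)
Definition hit i a r : nat :=
  ((a %/ 2 ^ i) %% 2) * (r %/ 2 ^ i == (a %/ 2 ^ i) %/ 2 * 2).

(* [r < a] iff, at the highest bit where they differ, [a] has a one. *)
Lemma sum_hit L a r : a < 2 ^ L -> \sum_(i < L) hit i a r = (r < a).
Proof.
(* If the parts from bit [m] upwards differ, they decide the comparison; otherwise the lower bits
   do, and exactly one [hit] among them is 1 when [r < a]. *)
move=> aL; suff H m : \sum_(i < m) hit i a r + (r %/ 2 ^ m < a %/ 2 ^ m) = (r < a).
  by rewrite -(H L) [a %/ _]divn_small // ltn0 addn0.
elim: m => [|m IH]; first by rewrite big_ord0 expn0 !divn1.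
rewrite -IH big_ord_recr /= -addnA; congr addn.
rewrite /hit expnSr !divnMA; set u := r %/ _; set v := a %/ _.
have := divn_eq u 2; have := divn_eq v 2.
have := @ltn_pmod u 2 isT; have := @ltn_pmod v 2 isT.
move: (u %/ 2) (v %/ 2) (u %% 2) (v %% 2) => u2 v2 bu bv.
case: bv => [|[|//]] _; case: bu => [|[|//]] _ -> ->; lia.
Qed.

Inductive threshold := AtZero | AtEnd | AtP | AfterP | AtQ | AfterQ.

Definition thr_val n p q t :=
  match t with
  | AtZero => 0 | AtEnd => n | AtP => p | AfterP => p.+1 | AtQ => q | AfterQ => q.+1
  end.

(* [u] and [v] are the ranks of the parent's labels placed at [p] and [q], [l]
   that of the point to be placed in [[lower, upper)]. *)
Definition lower u v l :=
  if u < l then if (l < v) || (v < u) then AfterP else AfterQ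
  else if v < l then AfterQ else AtZero.
Definition upper u v l :=
  if l < u then if (v < l) || (u < v) then AtP else AtQ
  else if l < v then AtQ else AtEnd.

(** Two constraints bounding [z] on the same side reduce to the tighter one, which is known from the
    order of [u] and [v]. That order also yields [lo <= hi], without which the indicator of the
    interval would not be a difference of indicators of initial segments. *)
Lemma interval_agree n u v l p q z : p < n -> q < n -> z < n -> l != u -> l != v ->
  (if u == v then p == q else agree u v p q) ->
  let lo := thr_val n p q (lower u v l) in let hi := thr_val n p q (upper u v l) in
  (lo <= hi) /\ (lo <= z < hi) = agree l u z p && agree l v z q.
Proof.
move=> pn qn zn /eqP lu /eqP lv.
rewrite /agree /lower /upper.
case: eqP => [uv /eqP pq|uv].
  by subst v q; rewrite ltnn !orbF andbb; case: (ltngtP u l) lu => // ul _ /=; split; lia.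
by case: (ltngtP u l) lu => // ul lu; case: (ltngtP v l) lv => // vl lv;
  case: (ltngtP u v) uv => // uv _ pq /=; split; lia.
Qed.

Section Corners.
Local Open Scope ring_scope.

Lemma bool_interval (R : nzRingType) (lo hi z : nat) : (lo <= hi)%N ->
  ((lo <= z < hi)%N)%:R = (z < hi)%:R - (z < lo)%:R :> R.
Proof.
move=> lohi; case: (ltnP z lo) => zl /=; last by rewrite subr0.
by rewrite (leq_trans zl lohi) subrr.
Qed.

Lemma prod_sums4 (R : comNzRingType) (T : Type) (d1 d2 d3 d4 : seq T) (f1 f2 f3 f4 : T -> R) :
  (\sum_(s <- d1) f1 s) * (\sum_(s <- d2) f2 s) *
  ((\sum_(s <- d3) f3 s) * (\sum_(s <- d4) f4 s)) =
  \sum_(k <- [seq (s, s') | s <- [seq (s1, s2) | s1 <- d1, s2 <- d2],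
                            s' <- [seq (s1, s2) | s1 <- d3, s2 <- d4]])
    f1 k.1.1 * f2 k.1.2 * (f3 k.2.1 * f4 k.2.2).
Proof. by rewrite big_allpairs_dep /= -big_distrlr /= !big_allpairs_dep /= -!big_distrlr. Qed.

Variables (R : comNzRingType) (n : nat) (tau : seq nat) (y : nat -> nat).

Definition side u v l := [:: (false, upper u v l); (true, lower u v l)].
Definition corners (b c : nat * nat) :=
  let h i := nth 0%N tau i in
  [seq (s, s') | s <- [seq (s1, s2) | s1 <- side c.1 c.2 b.1, s2 <- side (h c.1) (h c.2) (h b.1)],
                 s' <- [seq (s1, s2) | s1 <- side c.1 c.2 b.2, s2 <- side (h c.1) (h c.2) (h b.2)]].
Definition corner : Type := (bool * threshold) * (bool * threshold) * ((bool * threshold) * (bool * threshold)).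

Definition corner_sign (s : corner) : bool :=
  s.1.1.1 (+) s.1.2.1 (+) (s.2.1.1 (+) s.2.2.1).

Definition quadrant (a c b d : nat) (B : nat -> nat -> R) : R :=
  \sum_(r < n) \sum_(s < n) [&& r < a, y r < c, s < b & y s < d]%N%:R * B r s.

Definition corner_quadrant (s : corner) (B : nat -> nat -> R) p q : R :=
  let x t := thr_val n p q t in let h t := thr_val n (y p) (y q) t in
  quadrant (x s.1.1.2) (h s.1.2.2) (x s.2.1.2) (h s.2.2.2) B.

Lemma side_sum u v l p q z : (p < n)%N -> (q < n)%N -> (z < n)%N -> l != u -> l != v ->
  (if u == v then p == q else agree u v p q) ->
  \sum_(s <- side u v l) (-1) ^+ s.1 * (z < thr_val n p q s.2)%N%:R =
  (agree l u z p && agree l v z q)%:R :> R.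
Proof.
move=> pn qn zn lu lv uv; have [lohi <-] := interval_agree pn qn zn lu lv uv.
by rewrite bool_interval // !big_cons big_nil addr0 expr0 mul1r expr1 mulN1r.
Qed.

(** For fixed [p] and [q] the cross constraints confine each of [r], [y r], [s] and [y s] to an
    interval; the product of four differences of initial segments expands into 16 signed
    quadrants. *)
Lemma corners_sum (b c : nat * nat) (B : nat -> nat -> R) p q :
  (p < n)%N -> (q < n)%N -> (forall i, i < n -> y i < n)%N ->
  (forall l l', l \in [:: b.1; b.2] -> l' \in [:: c.1; c.2] ->
     (l != l') && (nth 0%N tau l != nth 0%N tau l')) ->
  (c.1 != c.2 -> nth 0%N tau c.1 != nth 0%N tau c.2) ->
  bag_ok tau y c p q ->
  \sum_(r < n) \sum_(s < n) (cross_ok tau y b c r s p q)%:R * B r s =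
  \sum_(s <- corners b c) (-1) ^+ corner_sign s * corner_quadrant s B p q.
Proof.
move=> pn qn yn disj tinj cok.
have hx : if c.1 == c.2 then p == q else agree c.1 c.2 p q.
  by move: cok; rewrite /bag_ok; case: eqP => // _ /andP[].
have hy : if nth 0%N tau c.1 == nth 0%N tau c.2 then y p == y q
          else agree (nth 0%N tau c.1) (nth 0%N tau c.2) (y p) (y q).
  move: cok; rewrite /bag_ok; case: (eqVneq c.1 c.2) => [->|/tinj ne]; first by rewrite eqxx => /eqP->.
  by rewrite (negPf ne) => /andP[].
have c1 : c.1 \in [:: c.1; c.2] by rewrite mem_head.
have c2 : c.2 \in [:: c.1; c.2] by rewrite !inE eqxx orbT.
have X l z : l \in [:: b.1; b.2] -> (z < n)%N ->
  \sum_(s <- side c.1 c.2 l) (-1) ^+ s.1 * (z < thr_val n p q s.2)%N%:R =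
  (agree l c.1 z p && agree l c.2 z q)%:R :> R.
  move=> lb zn; have /andP[d1 _] := disj l c.1 lb c1; have /andP[d2 _] := disj l c.2 lb c2.
  exact: side_sum.
have Y l z : l \in [:: b.1; b.2] -> (z < n)%N ->
  \sum_(s <- side (nth 0%N tau c.1) (nth 0%N tau c.2) (nth 0%N tau l))
     (-1) ^+ s.1 * (y z < thr_val n (y p) (y q) s.2)%N%:R =
  (agree (nth 0%N tau l) (nth 0%N tau c.1) (y z) (y p) &&
   agree (nth 0%N tau l) (nth 0%N tau c.2) (y z) (y q))%:R :> R.
  move=> lb zn; have /andP[_ d1] := disj l c.1 lb c1; have /andP[_ d2] := disj l c.2 lb c2.
  by apply: side_sum; rewrite ?yn.
pose ind (k : corner) r s : R :=
  [&& r < thr_val n p q k.1.1.2, y r < thr_val n (y p) (y q) k.1.2.2,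
      s < thr_val n p q k.2.1.2 & y s < thr_val n (y p) (y q) k.2.2.2]%N%:R.
transitivity (\sum_(r < n) \sum_(s < n) \sum_(k <- corners b c)
                (-1) ^+ corner_sign k * ind k r s * B r s); last first.
  under eq_bigr => r _ do rewrite exchange_big /=.
  rewrite exchange_big /=; apply: eq_bigr => k _; rewrite mulr_sumr.
  apply: eq_bigr => r _; rewrite mulr_sumr; apply: eq_bigr => s _.
  by rewrite mulrA.
apply: eq_bigr => r _; apply: eq_bigr => s _; rewrite -mulr_suml; congr (_ * _).
have b1 : b.1 \in [:: b.1; b.2] by rewrite mem_head.
have b2 : b.2 \in [:: b.1; b.2] by rewrite !inE eqxx orbT.
(* The eight comparisons are regrouped by the coordinate that they restrict. *)
transitivity (((agree b.1 c.1 r p && agree b.1 c.2 r q)%:R *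
   (agree (nth 0%N tau b.1) (nth 0%N tau c.1) (y r) (y p) &&
   agree (nth 0%N tau b.1) (nth 0%N tau c.2) (y r) (y q))%:R) *
   ((agree b.2 c.1 s p && agree b.2 c.2 s q)%:R *
   (agree (nth 0%N tau b.2) (nth 0%N tau c.1) (y s) (y p) &&
   agree (nth 0%N tau b.2) (nth 0%N tau c.2) (y s) (y q))%:R) : R).
  rewrite -!natrM !mulnb /cross_ok /link_ok /=; congr (nat_of_bool _)%:R.
  by rewrite -!andbA; do !bool_congr.
rewrite -!X // -!Y // prod_sums4; apply: eq_bigr => k _.
rewrite /ind /corner_sign /= -!mulnb !natrM !signr_addb.
move: (_ ^+ _) (_ ^+ _) (_ ^+ _) (_ ^+ _) => u1 u2 u3 u4.
move: (_ < _)%N%:R (_ < _)%N%:R (_ < _)%N%:R (_ < _)%N%:R => v1 v2 v3 v4.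
ring.
Qed.
End Corners.

(** * Quadrants as sums over pairs of bits *)

Section Levels.
Local Open Scope ring_scope.
Variables (R : comNzRingType) (n : nat) (y : nat -> nat).

Definition level i j i' j' a c b d (B : nat -> nat -> R) : R :=
  \sum_(r < n) \sum_(s < n)
     (hit i a r * hit j c (y r) * (hit i' b s * hit j' d (y s)))%N%:R * B r s.

Lemma quadrant_levels L a c b d (B : nat -> nat -> R) :
  (a < 2 ^ L)%N -> (c < 2 ^ L)%N -> (b < 2 ^ L)%N -> (d < 2 ^ L)%N ->
  quadrant n y a c b d B =
  \sum_(i < L) \sum_(j < L) \sum_(i' < L) \sum_(j' < L) level i j i' j' a c b d B.
Proof.
move=> aL cL bL dL; symmetry; rewrite /quadrant /level.
transitivity (\sum_(r < n) \sum_(s < n) \sum_(i < L) \sum_(j < L) \sum_(i' < L) \sum_(j' < L)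
   (hit i a r * hit j c (y r) * (hit i' b s * hit j' d (y s)))%N%:R * B r s).
  under eq_bigr => i _ do under eq_bigr => j _ do under eq_bigr => i' _ do
    (rewrite exchange_big /=; under eq_bigr => r _ do rewrite exchange_big /=).
  under eq_bigr => i _ do under eq_bigr => j _ do
    (rewrite exchange_big /=; under eq_bigr => r _ do rewrite exchange_big /=).
  under eq_bigr => i _ do
    (rewrite exchange_big /=; under eq_bigr => r _ do rewrite exchange_big /=).
  by rewrite exchange_big /=; under eq_bigr => r _ do rewrite exchange_big /=.
apply: eq_bigr => r _; apply: eq_bigr => s _.
have -> : [&& (r < a)%N, (y r < c)%N, (s < b)%N & (y s < d)%N]%:R =
  (((r < a) * (y r < c)) * ((s < b) * (y s < d)))%N%:R :> R.
  by rewrite !mulnb; case: (r < a)%N; case: (y r < c)%N.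
rewrite -(sum_hit r aL) -(sum_hit (y r) cL) -(sum_hit s bL) -(sum_hit (y s) dL).
rewrite -mulnA big_distrl natr_sum mulr_suml /=; apply: eq_bigr => i _.
rewrite mulnCA big_distrl natr_sum mulr_suml /=; apply: eq_bigr => j _.
rewrite mulnCA mulnA mulnCA big_distrl natr_sum mulr_suml /=; apply: eq_bigr => i' _.
rewrite mulnA big_distrr natr_sum mulr_suml /=; apply: eq_bigr => j' _.
congr (_%:R * _); ring.
Qed.

Definition in_class i j r X Y := ((r %/ 2 ^ i == X) && (y r %/ 2 ^ j == Y))%N.

(* [I X Y] is one plus some point of the class [(X, Y)], or 0 if it is empty; this
   numbers the at most [n] nonempty classes by [1, ..., n]. *)
Definition class_table i j (I : nat -> nat -> nat) m := forall X Y, (X <= n)%N -> (Y <= n)%N ->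
  if I X Y is r.+1 then (r < m)%N && in_class i j r X Y
  else forall r, (r < m)%N -> ~~ in_class i j r X Y.

(** The representative stored for a nonempty class determines the class. As the class of [r] is
    nonempty, an equality of numbers cannot come from the value 0 shared by the empty classes. *)
Lemma class_tableP i j I r X Y : class_table i j I n -> (forall r, r < n -> y r < n)%N ->
  (r < n)%N -> (X <= n)%N -> (Y <= n)%N ->
  (I (r %/ 2 ^ i)%N (y r %/ 2 ^ j)%N == I X Y) = in_class i j r X Y.
Proof.
move=> tI yn rn Xn Yn.
have h1 : (r %/ 2 ^ i <= n)%N by rewrite (leq_trans (leq_div _ _)) // ltnW.
have h2 : (y r %/ 2 ^ j <= n)%N by rewrite (leq_trans (leq_div _ _)) // ltnW // yn.
apply/eqP/idP => [e|/andP[/eqP-> /eqP->] //].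
have := tI _ _ h1 h2; have := tI _ _ Xn Yn; rewrite e.
case: (I X Y) => [_ /(_ r rn)|u /andP[_ /andP[/eqP uX /eqP uY]] /andP[_ /andP[/eqP ur /eqP uyr]]].
  by rewrite /in_class !eqxx.
by rewrite /in_class -ur -uyr uX uY !eqxx.
Qed.

(** Indexing by class numbers rather than by the four class coordinates keeps this table quadratic
    at every level, as there are at most [n] nonempty classes on either side. *)
Definition bucket i j i' j' (I I' : nat -> nat -> nat) (B : nat -> nat -> R) N M : R :=
  \sum_(r < n) \sum_(s < n)
    ((I (r %/ 2 ^ i)%N (y r %/ 2 ^ j)%N == N) && (I' (s %/ 2 ^ i')%N (y s %/ 2 ^ j')%N == M))%:R * B r s.

Definition digit i a := ((a %/ 2 ^ i) %% 2)%N.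
(** The number of the block that occurs in [hit]: for a set bit, the sibling of the block of length
    [2 ^ i] containing [a]. *)
Definition twin i a := ((a %/ 2 ^ i) %/ 2 * 2)%N.

Lemma twin_le i a : (twin i a <= a)%N.
Proof. by rewrite /twin (leq_trans (leq_trunc_div _ _)) // leq_div. Qed.

(** A quadrant selects one dyadic class on each side, hence a single bucket entry, and the digits
    annihilate bits equal to 0. The number 0 of an empty class is attained by no point, so its
    entries are empty sums. *)
Lemma level_bucket i j i' j' I I' a c b d (B : nat -> nat -> R) :
  class_table i j I n -> class_table i' j' I' n -> (forall r, r < n -> y r < n)%N ->
  (a <= n)%N -> (c <= n)%N -> (b <= n)%N -> (d <= n)%N ->
  level i j i' j' a c b d B =
  (digit i a)%:R * (digit j c)%:R * ((digit i' b)%:R * (digit j' d)%:R) *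
  bucket i j i' j' I I' B (I (twin i a) (twin j c)) (I' (twin i' b) (twin j' d)).
Proof.
move=> tI tI' yn an cn bn dn; rewrite /level /bucket mulr_sumr; apply: eq_bigr => r _.
rewrite mulr_sumr; apply: eq_bigr => s _.
have le i0 a0 : (a0 <= n -> twin i0 a0 <= n)%N by apply: leq_trans; apply: twin_le.
rewrite !class_tableP ?le // /hit /in_class -/(digit i a) -/(digit j c) -/(digit i' b) -/(digit j' d).
rewrite -/(twin i a) -/(twin j c) -/(twin i' b) -/(twin j' d) -!mulnb !natrM; ring.
Qed.

End Levels.

(** * A structured language and its compilation *)

(** Loops whose bound is fixed on entry are the only control structure, so termination and running
    time can be read off the syntax. *)
Inductive cmd :=
  | CConst of nat & nat
  | CMove of nat & nat
  | CBin of binop & nat & nat & nat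
  | CLoad of nat & nat & nat & nat
  | CStore of nat & nat & nat & nat
  | CSkip
  | CSeq of cmd & cmd
  | CFor of nat & nat & cmd.

(** [ok] records that all table accesses so far were in range; execution itself is total. *)
Record astate := AState { areg : nat -> nat; tab : nat -> nat -> nat -> nat; ok : bool }.

Definition set_reg s r v := AState (upd (areg s) r v) (tab s) (ok s).

Definition upd3 (T : nat -> nat -> nat -> nat) t x y v :=
  fun t' x' y' => if [&& t' == t, x' == x & y' == y] then v else T t' x' y'.

(* Cell [(x, y)] of table [t] lives at address [(t * D + x) * D + y].  Register 1
   is the scratch register of the compiled code, and register 2 holds [D]. *)
Definition ntables := 16.

Section Semantics.
Variables (w D : nat).

Fixpoint exec (c : cmd) (s : astate) : astate :=
  match c with
  | CConst r v => set_reg s r (v %% 2 ^ w)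
  | CMove r r1 => set_reg s r (areg s r1)
  | CBin o r r1 r2 => set_reg s r (eval_binop w o (areg s r1) (areg s r2))
  | CLoad r t x y =>
      AState (upd (areg s) r (tab s t (areg s x) (areg s y))) (tab s)
             [&& ok s, areg s x < D & areg s y < D]
  | CStore t x y r =>
      AState (areg s) (upd3 (tab s) t (areg s x) (areg s y) (areg s r))
             [&& ok s, areg s x < D & areg s y < D]
  | CSkip => s
  | CSeq c1 c2 => exec c2 (exec c1 s)
  | CFor i b c1 =>
      set_reg (iteri (areg s b) (fun k s' => exec c1 (set_reg s' i k)) s) i (areg s b)
  end.

Fixpoint writes (c : cmd) (r : nat) : bool :=
  match c with
  | CConst r1 _ | CMove r1 _ | CBin _ r1 _ _ | CLoad r1 _ _ _ => r1 == r
  | CStore _ _ _ _ | CSkip => false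
  | CSeq c1 c2 => writes c1 r || writes c2 r
  | CFor i _ c1 => (i == r) || writes c1 r
  end.

Definition usable r := (r != 1).
Definition writable r := (r != 1) && (r != 2).

(** Register 1 is left to the compiled code, and register 2 must keep [D]. A loop body changes
    neither its counter nor its bound, so the number of iterations is the value of the bound on
    entry. *)
Fixpoint wf (c : cmd) : bool :=
  match c with
  | CConst r _ => writable r
  | CMove r r1 => writable r && usable r1
  | CBin _ r r1 r2 => [&& writable r, usable r1 & usable r2]
  | CLoad r t x y => [&& writable r, t < ntables, usable x & usable y]
  | CStore t x y r => [&& usable r, t < ntables, usable x & usable y]
  | CSkip => true
  | CSeq c1 c2 => wf c1 && wf c2
  | CFor i b c1 =>
      [&& writable i, usable b, i != b, ~~ writes c1 i, ~~ writes c1 b & wf c1]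
  end.

Fixpoint len (c : cmd) : nat :=
  match c with
  | CConst _ _ | CMove _ _ | CBin _ _ _ _ => 1
  | CLoad _ _ _ _ | CStore _ _ _ _ => 6
  | CSkip => 0
  | CSeq c1 c2 => len c1 + len c2
  | CFor _ _ c1 => len c1 + 6
  end.

Definition address t x y : program :=
  [:: Const 1 t; Binop OpMul 1 1 2; Binop OpAdd 1 1 x; Binop OpMul 1 1 2; Binop OpAdd 1 1 y].

(** A loop ends at [base + len c1 + 6]: three instructions precede the body and three follow it. *)
Fixpoint compile (base : nat) (c : cmd) : program :=
  match c with
  | CConst r v => [:: Const r v]
  | CMove r r1 => [:: Move r r1]
  | CBin o r r1 r2 => [:: Binop o r r1 r2]
  | CLoad r t x y => rcons (address t x y) (LoadM r 1)
  | CStore t x y r => rcons (address t x y) (StoreM 1 r)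
  | CSkip => [::]
  | CSeq c1 c2 => compile base c1 ++ compile (base + len c1) c2
  | CFor i b c1 =>
      [:: Const i 0; Binop OpLt 1 i b; JumpZ 1 (base + len c1 + 6)] ++
      compile base.+3 c1 ++ [:: Const 1 1; Binop OpAdd i i 1; Jump base.+1]
  end.

Lemma size_compile base c : size (compile base c) = len c.
Proof.
elim: c base => //= [c1 IH1 c2 IH2|i b c IH] base; first by rewrite size_cat IH1 IH2.
by rewrite size_cat IH /= addnS addnS addnS -!addnS.
Qed.

(** [v] bounds the values of the loop bounds. An iteration costs two steps for the test and three
    for the increment and the jump; the final 3 stands for the initialisation of the counter and the
    last test. *)
Fixpoint cost (v : nat -> nat) (c : cmd) : nat :=
  match c with
  | CConst _ _ | CMove _ _ | CBin _ _ _ _ => 1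
  | CLoad _ _ _ _ | CStore _ _ _ _ => 6
  | CSkip => 0
  | CSeq c1 c2 => cost v c1 + cost v c2
  | CFor _ b c1 => v b * (cost v c1 + 5) + 3
  end.

Fixpoint bounds (c : cmd) : seq nat :=
  match c with
  | CSeq c1 c2 => bounds c1 ++ bounds c2
  | CFor _ b c1 => b :: bounds c1
  | _ => [::]
  end.

Lemma exec_frame c s r : ~~ writes c r -> areg (exec c s) r = areg s r.
Proof.
elim: c s => //= [r1 v|r1 r2|o r1 r2 r3|r1 t x y|c1 IH1 c2 IH2|i b c IH] s;
  try by rewrite /upd eq_sym => /negPf->.
  by rewrite negb_or => /andP[h1 h2]; rewrite IH2 // IH1.
rewrite negb_or => /andP[ir h]; rewrite /= /upd eq_sym (negPf ir).
by elim: (areg s b) => //= k IHk; rewrite IH //= /upd eq_sym (negPf ir).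
Qed.

Lemma exec_ok c s : ok (exec c s) -> ok s.
Proof.
elim: c s => //= [r t x y|t x y r|c1 IH1 c2 IH2|i b c IH] s; try by case/andP.
  by move/IH2/IH1.
by elim: (areg s b) => //= k IHk /IH.
Qed.

(** * Simulation of the structured language by machine code *)

Variable p : program.

Definition runs sp (S : state) n (S' : state) :=
  iter n (step w p) S = S' /\ forall i, i < n -> touched p (iter i (step w p) S) <= sp.

Lemma runs0 sp S : runs sp S 0 S. Proof. by []. Qed.

Lemma runs_trans sp S1 n S2 m S3 : runs sp S1 n S2 -> runs sp S2 m S3 -> runs sp S1 (n + m) S3.
Proof.
move=> [e1 t1] [e2 t2]; split=> [|i inm]; first by rewrite addnC iterD e1.
case: (ltnP i n) => [/t1 //|ni].
by rewrite -(subnK ni) iterD e1; apply: t2; rewrite ltn_subLR.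
Qed.

Lemma runs_step sp S n S' : touched p S <= sp -> runs sp (step w p S) n S' -> runs sp S n.+1 S'.
Proof.
by move=> ht hr; rewrite -add1n; apply: (runs_trans _ hr); split=> // -[].
Qed.

Definition code_at base (cs : program) :=
  forall j, j < size cs -> nth Halt p (base + j) = nth Halt cs j.

Lemma code_at_cat base c1 c2 :
  code_at base (c1 ++ c2) -> code_at base c1 /\ code_at (base + size c1) c2.
Proof.
move=> h; split=> j hj.
  by rewrite h ?size_cat ?nth_cat ?hj // ltn_addr.
by rewrite -addnA h ?size_cat ?ltn_add2l // nth_cat ltnNge leq_addr /= addKn.
Qed.

Lemma code_at_cons base i c : code_at base (i :: c) -> nth Halt p base = i /\ code_at base.+1 c.
Proof.
move=> h; split; first by have := h 0 isT; rewrite addn0.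
by move=> j hj; rewrite addSnnS h.
Qed.

Definition addr t x y := (t * D + x) * D + y.

Lemma addr_lt t x y : t < ntables -> x < D -> y < D -> addr t x y < ntables * D * D.
Proof. by rewrite /addr => tn xD yD; nia. Qed.

Lemma addr_inj t x y t' x' y' : x < D -> y < D -> x' < D -> y' < D ->
  addr t x y = addr t' x' y' -> [/\ t = t', x = x' & y = y'].
Proof.
rewrite /addr => xD yD x'D y'D e.
have D0 : 0 < D by apply: leq_ltn_trans xD.
have ey : y = y' by have := congr1 (modn^~ D) e; rewrite !modnMDl !modn_small.
subst y'; move/addIn: e => /eqP; rewrite eqn_pmul2r // => /eqP e.
have ex : x = x' by have := congr1 (modn^~ D) e; rewrite !modnMDl !modn_small.
subst x'; move/addIn: e => /eqP; rewrite eqn_pmul2r // => /eqP e; by split.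
Qed.

(** The scratch register and the memory outside the tables are unconstrained. The word bounds ensure
    that loop counters are never truncated. *)
Definition sim (s : astate) (R M : nat -> nat) :=
  [/\ forall r, usable r -> R r = areg s r,
      areg s 2 = D,
      forall r, areg s r < 2 ^ w,
      forall t x y, tab s t x y < 2 ^ w &
      forall t x y, t < ntables -> x < D -> y < D -> M (addr t x y) = tab s t x y].

Hypothesis room : ntables * D * D <= 2 ^ w.

Lemma eval_binop_lt o x y : eval_binop w o x y < 2 ^ w.
Proof. by rewrite /eval_binop ltn_pmod // expn_gt0. Qed.

Lemma sim_set_reg s R M r v : writable r -> v < 2 ^ w -> sim s R M -> sim (set_reg s r v) (upd R r v) M.
Proof.
case/andP=> r1 r2 vw [hR hD hw ht hM]; split=> //=.
- by move=> r' ur; rewrite /upd; case: eqP => // _; apply: hR.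
- by rewrite /upd eq_sym (negPf r2).
- by move=> r'; rewrite /upd; case: eqP.
Qed.

Lemma sim_scratch s R M v : sim s R M -> sim s (upd R 1 v) M.
Proof. by case=> hR hD hw ht hM; split=> // r ur; rewrite /upd (negPf ur); apply: hR. Qed.

Lemma address_runs sp base rest s R M t x y : sim s R M -> usable x -> usable y ->
  t < ntables -> areg s x < D -> areg s y < D ->
  code_at base (address t x y ++ rest) ->
  exists R', [/\ runs sp (State base R M) 5 (State base.+4.+1 R' M),
    R' 1 = addr t (areg s x) (areg s y) & forall r, usable r -> R' r = R r].
Proof.
case=> hR hD hw ht hM ux uy tn xD yD /code_at_cat[cd _].
have R2 : R 2 = D by rewrite hR.
have Rx : R x = areg s x by apply: hR.
have Ry : R y = areg s y by apply: hR.
set X := areg s x in xD Rx *; set Y := areg s y in yD Ry *.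
have al := addr_lt tn xD yD; rewrite /addr in al.
have D0 : 0 < D by apply: leq_ltn_trans xD.
(* Every intermediate value of the Horner scheme is at most the final address, so no reduction
   modulo [2 ^ w] takes effect. *)
have b1 : (t * D + X) * D < 2 ^ w by apply: leq_trans room; apply: leq_ltn_trans al; rewrite leq_addr.
have b2 : t * D + X < 2 ^ w by apply: leq_ltn_trans b1; rewrite leq_pmulr.
have b3 : t * D < 2 ^ w by apply: leq_ltn_trans b2; rewrite leq_addr.
have b4 : t < 2 ^ w by apply: leq_ltn_trans b3; rewrite leq_pmulr.
have b5 : (t * D + X) * D + Y < 2 ^ w by apply: leq_trans al room.
have /code_at_cons[e0 /code_at_cons[e1 /code_at_cons[e2 /code_at_cons[e3 /code_at_cons[e4 _]]]]] := cd.
have x1 : (x == 1) = false by exact: negPf ux.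
have y1 : (y == 1) = false by exact: negPf uy.
eexists; split.
- apply: runs_step; first by rewrite /touched /fetch /= e0.
  rewrite /step /fetch /= e0.
  apply: runs_step; first by rewrite /touched /fetch /= e1.
  rewrite /step /fetch /= e1.
  apply: runs_step; first by rewrite /touched /fetch /= e2.
  rewrite /step /fetch /= e2.
  apply: runs_step; first by rewrite /touched /fetch /= e3.
  rewrite /step /fetch /= e3.
  apply: runs_step; first by rewrite /touched /fetch /= e4.
  rewrite /step /fetch /= e4.
  exact: runs0.
- by rewrite /eval_binop /upd /= x1 y1 R2 Rx Ry /addr !modn_small.
- by move=> r /negPf r1; rewrite /upd r1.
Qed.

(** A loop-bound register is never written, so its initial value, at most [v b], is the one seen on
    every entry to the loop. Since [ok] is never restored, its truth at the end certifies all
    intermediate accesses. *)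
Lemma compile_ok v sp c s base R M : ntables * D * D <= sp ->
  wf c -> (forall b, b \in bounds c -> ~~ writes c b /\ areg s b <= v b) ->
  code_at base (compile base c) -> sim s R M -> ok (exec c s) ->
  exists n R' M', [/\ n <= cost v c, runs sp (State base R M) n (State (base + len c) R' M')
    & sim (exec c s) R' M'].
Proof.
move=> hsp; elim: c s base R M => [r a|r r1|o r r1 r2|r t x y|t x y r||c1 IH1 c2 IH2|i b c IH]
  s base R M /=.
- move=> wr _ /code_at_cons[e _] hs _; exists 1, (upd R r (a %% 2 ^ w)), M; split=> //.
    apply: runs_step; first by rewrite /touched /fetch /= e.
    by rewrite /step /fetch /= e addn1; apply: runs0.
  by apply: sim_set_reg => //; rewrite ltn_pmod // expn_gt0.
- case/andP=> wr u1 _ /code_at_cons[e _] hs _; exists 1, (upd R r (areg s r1)), M; split=> //.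
    apply: runs_step; first by rewrite /touched /fetch /= e.
    by rewrite /step /fetch /= e addn1; case: hs => -> // *; apply: runs0.
  by apply: sim_set_reg => //; case: hs.
- case/and3P=> wr u1 u2 _ /code_at_cons[e _] hs _.
  exists 1, (upd R r (eval_binop w o (areg s r1) (areg s r2))), M; split=> //.
    apply: runs_step; first by rewrite /touched /fetch /= e.
    by rewrite /step /fetch /= e addn1; case: hs => hR *; rewrite !hR //; apply: runs0.
  by apply: sim_set_reg => //; apply: eval_binop_lt.
- case/and4P=> wr tn ux uy _ cd hs /and3P[_ xD yD].
  have [R' [hr R1 hR']] := address_runs sp hs ux uy tn xD yD (rest := [:: LoadM r 1]) cd.
  have e : nth Halt p base.+4.+1 = LoadM r 1 by have := cd 5 isT; rewrite !addnS addn0.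
  exists 6, (upd R' r (tab s t (areg s x) (areg s y))), M; split=> //.
    rewrite -[6]/(5 + 1); apply: (runs_trans hr); apply: runs_step.
      by rewrite /touched /fetch /= e R1 (leq_trans _ hsp) // addr_lt.
    rewrite /step /fetch /= e !addnS addn0 R1; case: hs => _ _ _ _ -> //; exact: runs0.
  have : sim s R' M by case: hs => hR *; split=> // r' ur'; rewrite hR' // hR.
  move/(sim_set_reg wr (v := tab s t (areg s x) (areg s y))) => H.
  by case: H => [|*]; [case: hs | split].
- case/and4P=> ur tn ux uy _ cd hs /and3P[_ xD yD].
  have [R' [hr R1 hR']] := address_runs sp hs ux uy tn xD yD (rest := [:: StoreM 1 r]) cd.
  have e : nth Halt p base.+4.+1 = StoreM 1 r by have := cd 5 isT; rewrite !addnS addn0.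
  case: (hs) => hR hD hw ht hM.
  exists 6, R', (upd M (addr t (areg s x) (areg s y)) (areg s r)); split=> //.
    rewrite -[6]/(5 + 1); apply: (runs_trans hr); apply: runs_step.
      by rewrite /touched /fetch /= e R1 (leq_trans _ hsp) // addr_lt.
    by rewrite /step /fetch /= e !addnS addn0 R1 hR' // hR //; apply: runs0.
  split=> //=.
  + by move=> r' ur'; rewrite hR' // hR.
  + by move=> t' x' y'; rewrite /upd3; case: ifP.
  + move=> t' x' y' tn' xD' yD'; rewrite /upd /upd3; case: eqP => [/addr_inj|ne].
      by case=> // -> -> ->; rewrite !eqxx.
    by case: and3P => [[/eqP e1 /eqP e2 /eqP e3]|_]; [case: ne; rewrite e1 e2 e3 | apply: hM].
- by move=> _ _ _ hs _; exists 0, R, M; split=> //; rewrite addn0.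
- case/andP=> wf1 wf2 hb /code_at_cat[cd1]; rewrite size_compile => cd2 hs oks.
  have [|n1 [R1 [M1 [t1 r1 s1]]]] := IH1 s base R M wf1 _ cd1 hs (exec_ok oks).
    move=> b b1; have [] := hb b; first by rewrite mem_cat b1.
    by rewrite negb_or => /andP[].
  have [|n2 [R2 [M2 [t2 r2 s2]]]] := IH2 _ _ R1 M1 wf2 _ cd2 s1 oks.
    move=> b b2; have [] := hb b; first by rewrite mem_cat b2 orbT.
    by rewrite negb_or => /andP[w1 w2] hv; rewrite exec_frame.
  exists (n1 + n2), R2, M2; split=> //; first exact: leq_add.
  by rewrite addnA; apply: runs_trans r2.
case/and5P=> wi ub ib wci /andP[wcb wfc] hb /code_at_cons[e0 /code_at_cons[e1 /code_at_cons[e2 cd]]].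
have [cdc] := code_at_cat cd; rewrite size_compile => /code_at_cons[e3 /code_at_cons[e4 /code_at_cons[e5 _]]].
move=> hs.
set f := fun k s' => _; set m := areg s b; rewrite /=.
have mw : m < 2 ^ w by case: hs => _ _ hw _ _; apply: hw.
have [wb mv] := hb b (mem_head _ _); rewrite -/m in mv.
have ui : usable i by case/andP: wi.
have sb k : areg (iteri k f s) b = m.
  by elim: k => //= k IHk; rewrite exec_frame //= /upd eq_sym (negPf ib).
have sbd k r : r \in bounds c -> areg (iteri k f s) r = areg s r.
  move=> rc; have [] := hb r; rewrite ?inE ?rc ?orbT // negb_or => /andP[ir wr] _.
  by elim: k => //= k IHk; rewrite exec_frame //= /upd eq_sym (negPf ir).
have okm k : k <= m -> ok (iteri m f s) -> ok (iteri k f s).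
  move=> km; rewrite -(subnK km); elim: (m - k) => //= j IHj h; apply: IHj.
  by have := exec_ok h.
move=> okf.
have loop k : k <= m -> exists n R' M', [/\ n <= k * (cost v c + 5),
    runs sp (State base.+1 (upd R i 0) M) n (State base.+1 R' M') & sim (set_reg (iteri k f s) i k) R' M'].
  elim: k => [_|k IHk km].
    exists 0, (upd R i 0), M; split=> //.
    by apply: sim_set_reg; rewrite // expn_gt0.
  have [n [R1 [M1 [hn hr hs1]]]] := IHk (ltnW km).
  have R1i : R1 i = k by case: hs1 => -> //= *; rewrite /upd eqxx.
  have R1b : R1 b = m by case: hs1 => -> //= *; rewrite /upd eq_sym (negPf ib) sb.
  have [|n2 [R2 [M2 [hn2 hr2 hs2]]]] := IH _ _ _ _ wfc _ cdc (sim_scratch 1 hs1) (okm _ km okf).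
    move=> r rc; have [] := hb r; rewrite ?inE ?rc ?orbT // negb_or => /andP[ir wr] hv.
    by split=> //=; rewrite /upd eq_sym (negPf ir) sbd.
  have R2i : R2 i = k.
    by case: hs2 => -> //= *; rewrite exec_frame //= /upd eqxx.
  exists (n + (2 + (n2 + 3))), (upd (upd R2 1 1) i k.+1), M2; split.
  - rewrite mulSn addnC; lia.
  - apply: (runs_trans hr); rewrite -[2]/(1 + 1).
    apply: (runs_trans (S2 := State base.+3 (upd R1 1 1) M1)).
      apply: runs_step; first by rewrite /touched /fetch /= e1.
      rewrite /step /fetch /= e1 /eval_binop R1i R1b km modn_small; last first.
        by rewrite (leq_ltn_trans _ mw) // (leq_ltn_trans _ km).
      apply: runs_step; first by rewrite /touched /fetch /= e2.
      by rewrite /step /fetch /= e2 /upd /=; apply: runs0.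
    apply: (runs_trans hr2).
    (* An iteration takes place, so [1 <= m < 2 ^ w] and the increment 1 is representable. *)
    have w1 : 1 < 2 ^ w by rewrite (leq_ltn_trans _ mw) // (leq_ltn_trans _ km).
    apply: runs_step; first by rewrite /touched /fetch /= e3.
    rewrite /step /fetch /= e3 modn_small //.
    apply: runs_step; first by rewrite /touched /fetch /= e4.
    rewrite /step /fetch /= e4 /eval_binop {2 3}/upd /= (negPf ui) R2i addn1 modn_small; last first.
      exact: leq_ltn_trans mw.
    apply: runs_step; first by rewrite /touched /fetch /= e5.
    by rewrite /step /fetch /= e5; apply: runs0.
  - apply: sim_set_reg => //; first exact: leq_ltn_trans mw.
    exact: sim_scratch.
have [n [R1 [M1 [hn hr hs1]]]] := loop m (leqnn m).
have R1i : R1 i = m by case: hs1 => -> //= *; rewrite /upd eqxx.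
have R1b : R1 b = m by case: hs1 => -> //= *; rewrite /upd eq_sym (negPf ib) sb.
exists (1 + (n + 2)), (upd R1 1 0), M1; split.
- have := leq_mul mv (leqnn (cost v c + 5)); lia.
- apply: (runs_trans (S2 := State base.+1 (upd R i 0) M)).
    apply: runs_step; first by rewrite /touched /fetch /= e0.
    by rewrite /step /fetch /= e0 mod0n; apply: runs0.
  apply: (runs_trans hr).
  apply: runs_step; first by rewrite /touched /fetch /= e1.
  rewrite /step /fetch /= e1 /eval_binop R1i R1b ltnn mod0n.
  apply: runs_step; first by rewrite /touched /fetch /= e2.
  by rewrite /step /fetch /= e2 /upd /= addnA; apply: runs0.
- exact: sim_scratch.
Qed.
End Semantics.

(** * Table-filling passes *)

Fixpoint stores (c : cmd) (t : nat) : bool :=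
  match c with
  | CStore t' _ _ _ => t' == t
  | CSeq c1 c2 => stores c1 t || stores c2 t
  | CFor _ _ c1 => stores c1 t
  | _ => false
  end.

Definition same (c : cmd) (s s' : astate) :=
  (forall r, ~~ writes c r -> areg s' r = areg s r) /\
  (forall t x y, ~~ stores c t -> tab s' t x y = tab s t x y).

Definition cseq : seq cmd -> cmd := foldr CSeq CSkip.

Section Loops.
Variables (w D : nat).
Local Notation exec := (exec w D).

Lemma exec_stores c s t x y : ~~ stores c t -> tab (exec c s) t x y = tab s t x y.
Proof.
elim: c s => //= [t' x' y' r|c1 IH1 c2 IH2|i b c IH] s.
- by rewrite eq_sym /upd3 => /negPf->.
- by rewrite negb_or => /andP[h1 h2]; rewrite IH2 // IH1.
- by move=> h; elim: (areg s b) => //= k IHk; rewrite IH.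
Qed.

Lemma exec_same c s : same c s (exec c s).
Proof. by split=> [r|t x y]; [apply: exec_frame | apply: exec_stores]. Qed.

Lemma same_refl c s : same c s s. Proof. by []. Qed.

Lemma same_trans c s1 s2 s3 : same c s1 s2 -> same c s2 s3 -> same c s1 s3.
Proof.
by move=> [r1 t1] [r2 t2]; split=> [r|t x y] h; [rewrite r2 ?r1 | rewrite t2 ?t1].
Qed.

Lemma same_weaken c c' s s' : same c s s' ->
  (forall r, ~~ writes c' r -> ~~ writes c r) -> (forall t, ~~ stores c' t -> ~~ stores c t) ->
  same c' s s'.
Proof. by move=> [hr ht] h1 h2; split=> [r /h1/hr|t x y /h2/ht]. Qed.

Lemma for_ind (P : nat -> astate -> Prop) i b c s :
  i != b -> ~~ writes c b -> ~~ writes c i ->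
  P 0 s ->
  (forall k s', P k s' -> P k (set_reg s' i k)) ->
  (forall k s', k < areg s b -> areg s' i = k -> same (CFor i b c) s s' -> P k s' -> P k.+1 (exec c s')) ->
  P (areg s b) (exec (CFor i b c) s).
Proof.
move=> ib cb ci P0 Pset Pstep /=; apply: (Pset).
suff H k : k <= areg s b ->
    P k (iteri k (fun k s' => exec c (set_reg s' i k)) s) /\
    same (CFor i b c) s (iteri k (fun k s' => exec c (set_reg s' i k)) s).
  by case: (H _ (leqnn _)).
elim: k => [|k IH] km; first by split=> //; apply: same_refl.
have [Pk sk] := IH (ltnW km).
have sk' : same (CFor i b c) s (set_reg (iteri k (fun k s' => exec c (set_reg s' i k)) s) i k).
  apply: same_trans sk _; split=> //= r; rewrite negb_or => /andP[ir _].
  by rewrite /upd eq_sym (negPf ir).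
split; first by apply: Pstep => //=; [rewrite /upd eqxx | apply: Pset].
apply: (same_trans sk'); apply: (same_weaken (exec_same _ _)) => //= r.
by rewrite negb_or => /andP[].
Qed.

Lemma for2_ind (P : nat -> nat -> astate -> Prop) i j b c s :
  [&& i != b, j != b, i != j, ~~ writes c b, ~~ writes c i & ~~ writes c j] ->
  P 0 0 s ->
  (forall k l s' v, P k l s' -> P k l (set_reg s' i v)) ->
  (forall k l s' v, P k l s' -> P k l (set_reg s' j v)) ->
  (forall k l s', k < areg s b -> l < areg s b -> areg s' i = k -> areg s' j = l ->
     same (CFor i b (CFor j b c)) s s' -> P k l s' -> P k l.+1 (exec c s')) ->
  (forall k s', k < areg s b -> P k (areg s b) s' -> P k.+1 0 s') ->
  P (areg s b) 0 (exec (CFor i b (CFor j b c)) s).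
Proof.
case/and5P=> ib jb ij cb /andP[ci cj] P0 Pi Pj Pstep Pnext.
apply: (@for_ind (fun k s' => P k 0 s')) => //=.
- by rewrite negb_or jb.
- by rewrite negb_or eq_sym ij.
- by move=> k s'; apply: Pi.
move=> k s' ks s'k ss' Pk.
have s'b : areg s' b = areg s b by case: ss' => -> //=; rewrite !negb_or ib jb.
apply: Pnext => //; rewrite -s'b.
apply: (@for_ind (fun l s' => P k l s')) => //.
- by move=> l s2; apply: Pj.
move=> l s2 ls s2l ss2 Pl; apply: Pstep => //.
- by rewrite -s'b.
- by case: ss2 => -> //=; rewrite negb_or eq_sym ij.
apply: (same_trans ss'); apply: (same_weaken ss2) => //= r.
by rewrite !negb_or => /and3P[_ -> ->].
Qed.

Lemma exec_seq c1 c2 s : exec (CSeq c1 c2) s = exec c2 (exec c1 s). Proof. by []. Qed.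

Lemma exec_cseq c l s : exec (cseq (c :: l)) s = exec (cseq l) (exec c s). Proof. by []. Qed.

Lemma exec_nil s : exec (cseq [::]) s = s. Proof. by []. Qed.

Lemma exec_bin o r r1 r2 s a b v : areg s r1 = a -> areg s r2 = b -> eval_binop w o a b = v ->
  exec (CBin o r r1 r2) s = set_reg s r v.
Proof. by move=> /= -> -> ->. Qed.

Lemma exec_load r t x z s a b v : areg s x = a -> areg s z = b -> a < D -> b < D ->
  tab s t a b = v -> exec (CLoad r t x z) s = set_reg s r v.
Proof. by move=> /= -> -> -> -> ->; rewrite !andbT. Qed.

Lemma exec_store t x z r s a b v : areg s x = a -> areg s z = b -> a < D -> b < D ->
  areg s r = v -> exec (CStore t x z r) s = AState (areg s) (upd3 (tab s) t a b v) (ok s).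
Proof. by move=> /= -> -> -> -> ->; rewrite !andbT. Qed.

End Loops.

Arguments exec : simpl never.
Arguments cseq : simpl never.

Section Passes.
Variables (w n L : nat) (y : nat -> nat).
Local Notation D := n.+1.
Local Notation exec := (exec w D).
Hypothesis room : ntables * D * D <= 2 ^ w.
Hypothesis y_lt : forall r, r < n -> y r < n.

(* Register use: 5-8 are the four bit positions of a dyadic level, 9 and 10 the
   two points of a pair, 11-16, 20 and 22-24 temporaries, 19 the running total;
   the counts of patterns are kept in registers from 100 on.  Table use: 0 is the
   input (shifted to start at 0), 1 and 2 hold the class representatives of a
   level, 3 the bucket sums, 4 the aggregate, and 5 onwards the bags. *)
Record env (s : astate) : Prop := Env {
  env_ok : ok s;
  env_n : areg s 0 = n;
  env_D : areg s 2 = D;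
  env_one : areg s 3 = 1;
  env_L : areg s 4 = L;
  env_zero : areg s 18 = 0;
  env_two : areg s 21 = 2;
  env_y : forall r, r < n -> tab s 0 0 r = y r }.

Definition preserving (c : cmd) :=
  [&& ~~ writes c 0, ~~ writes c 2, ~~ writes c 3, ~~ writes c 4, ~~ writes c 18,
      ~~ writes c 21 & ~~ stores c 0].

Lemma env_same c s s' : preserving c -> same c s s' -> ok s' -> env s -> env s'.
Proof.
case/and5P=> h0 h2 h3 h4 /and3P[h18 h21 hs] [hr ht] oks [? ? ? ? ? ? ? hy].
by split; rewrite ?hr // => r rn; rewrite ht // hy.
Qed.

Lemma D_lt : D < 2 ^ w.
Proof. by apply: leq_trans room; rewrite /ntables; nia. Qed.
Lemma small x : x <= D -> x %% 2 ^ w = x.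
Proof. by move=> xD; rewrite modn_small // (leq_ltn_trans xD) // D_lt. Qed.

Lemma smalln x : x <= n -> x %% 2 ^ w = x.
Proof. by move=> xn; apply: small; apply: leqW. Qed.

(** Runs up to [D] and not [n]: class coordinates and class numbers may equal [n]. *)
Definition clear t := CFor 9 2 (CFor 10 2 (CStore t 9 10 18)).

Lemma clearP t s : env s -> t != 0 -> let s' := exec (clear t) s in
  env s' /\ forall x z, x <= n -> z <= n -> tab s' t x z = 0.
Proof.
move=> es t0; rewrite /clear.
have D2 := env_D es.
pose P k l s' := ok s' /\ forall x z, x <= n -> z <= n -> (x < k) || (x == k) && (z < l) -> tab s' t x z = 0.
have : P (areg s 2) 0 (exec (CFor 9 2 (CFor 10 2 (CStore t 9 10 18))) s).
  apply: for2_ind => //.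
  - by split; [case: es | move=> x z; rewrite ltn0 andbF].
  - move=> k l s'; rewrite D2 => kD lD k9 l10 ss [oks ht].
    have es' : env s' by apply: (env_same _ ss) => //; rewrite /preserving /= ?orbF ?t0.
    rewrite (@exec_store _ _ t 9 10 18 _ k l 0) //; last exact: env_zero es'.
    split=> // x z xn zn; rewrite /= /upd3 eqxx /= => h; case: ifP => // ne; apply: ht => //.
    by move: h ne; rewrite ltnS; lia.
  - move=> k s'; rewrite D2 => kD [oks ht]; split=> // x z xn zn h; apply: ht => //.
    by move: h; rewrite ltn0 andbF orbF !ltnS leq_eqVlt zn andbT orbC.
rewrite D2 => -[oks ht]; split.
  by apply: (env_same _ (exec_same _ _ _ _)) => //; rewrite /preserving /= ?orbF ?t0.
by move=> x z xn zn; apply: ht => //; rewrite ltnS xn.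
Qed.

(** The last point of a class becomes its representative, stored plus one so that 0 keeps marking
    the empty classes. *)
Definition build t ri rj := CFor 9 0 (cseq [:: CLoad 11 0 18 9; CBin OpShr 13 9 ri;
  CBin OpShr 14 11 rj; CBin OpAdd 15 9 3; CStore t 13 14 15]).

Lemma shr_le x i : x <= n -> x %/ 2 ^ i <= n.
Proof. by apply: leq_trans; apply: leq_div. Qed.

Lemma buildP t ri rj i j s : env s -> t != 0 -> 4 < ri < 9 -> 4 < rj < 9 ->
  areg s ri = i -> areg s rj = j ->
  (forall x z, x <= n -> z <= n -> tab s t x z = 0) ->
  let s' := exec (build t ri rj) s in env s' /\ class_table n y i j (tab s' t) n.
Proof.
move=> es t0 hri hrj ei ej z0; rewrite /build.
have rne r r' : 4 < r < 9 -> (r' < 5) || (8 < r') -> (r == r') = false by lia.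
pose P k s' := ok s' /\ class_table n y i j (tab s' t) k.
have : P (areg s 0) (exec (build t ri rj) s).
  apply: for_ind => //.
  - split; first by case: es.
    by move=> X Y Xn Yn; rewrite z0.
  - move=> k s'; rewrite (env_n es) => kn k9 ss [oks ht].
    have es' : env s' by apply: (env_same _ ss) => //; rewrite /preserving /= ?orbF ?t0.
    have ri' : areg s' ri = i.
      by case: ss => -> //=; rewrite ![_ == ri]eq_sym !(rne ri).
    have rj' : areg s' rj = j.
      by case: ss => -> //=; rewrite ![_ == rj]eq_sym !(rne rj).
    have hk : k %/ 2 ^ i <= n by apply: shr_le; apply: ltnW.
    have hy : y k %/ 2 ^ j <= n by apply: shr_le; apply: ltnW; apply: y_lt.
    have e18 := env_zero es'; have e3 := env_one es'.
    rewrite !exec_cseq exec_nil (@exec_load _ _ 11 0 18 9 _ 0 k (y k)) ?(env_y es') // 1?ltnS 1?ltnW //.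
    rewrite (@exec_bin _ _ _ 13 9 ri _ k i (k %/ 2 ^ i)) //=; last exact: smalln; last first.
      by rewrite /upd (rne ri).
    rewrite (@exec_bin _ _ _ 14 11 rj _ (y k) j (y k %/ 2 ^ j)) //=; last exact: smalln; last first.
      by rewrite /upd !(rne rj).
    rewrite (@exec_bin _ _ _ 15 9 3 _ k 1 k.+1) //=; last by rewrite /eval_binop addn1 smalln.
    rewrite (@exec_store _ _ t 13 14 15 _ (k %/ 2 ^ i) (y k %/ 2 ^ j) k.+1) //.
    split=> //.
    move=> X Y Xn Yn /=; rewrite /upd3 eqxx /=; case: andP => [[/eqP-> /eqP->]|ne].
      by rewrite ltnSn /in_class !eqxx.
    have := ht X Y Xn Yn; case: (tab s' t X Y) => [h r|r /andP[rk ->]]; last by rewrite ltnS ltnW.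
    rewrite ltnS leq_eqVlt => /orP[/eqP->|/h //].
    by apply/negP => /andP[/eqP kX /eqP yY]; case: ne; rewrite kX yY !eqxx.
rewrite (env_n es) => -[oks ht]; split=> //.
by apply: (env_same _ (exec_same _ _ _ _)) => //; rewrite /preserving /= ?orbF ?t0.
Qed.

Lemma class_table_le i j (I : nat -> nat -> nat) X Y : class_table n y i j I n ->
  X <= n -> Y <= n -> I X Y <= n.
Proof. by move=> tI Xn Yn; have := tI X Y Xn Yn; case: (I X Y) => // r /andP[]. Qed.

Lemma digit_calc a i : a <= n -> ((a %/ 2 ^ i) %% 2 ^ w %% 2) %% 2 ^ w = digit i a.
Proof.
move=> an; rewrite (smalln (shr_le i an)) modn_small //.
by apply: (leq_trans (ltn_pmod _ _)) => //; apply: leq_ltn_trans D_lt.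
Qed.

(** Every threshold is a sum of two registers, with 0, 1 and [n] available in registers 18, 3 and
    0. *)
Definition thr_base rp rq t := match t with
  | AtZero => 18 | AtEnd => 0 | AtP | AfterP => rp | AtQ | AfterQ => rq end.
Definition thr_off t := match t with AfterP | AfterQ => 3 | _ => 18 end.
Definition thr_cmd dst rp rq t := CBin OpAdd dst (thr_base rp rq t) (thr_off t).
Definition split_cmd r ri rd := cseq [:: CBin OpShr r r ri; CBin OpMod rd r 21;
  CBin OpDiv r r 21; CBin OpMul r r 21].

Definition set_corner (k : corner) := cseq [:: CLoad 11 0 18 9; CLoad 12 0 18 10;
  thr_cmd 13 9 10 k.1.1.2; thr_cmd 14 11 12 k.1.2.2;
  thr_cmd 15 9 10 k.2.1.2; thr_cmd 16 11 12 k.2.2.2].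
Definition split_all := cseq [::
  split_cmd 13 5 20; split_cmd 14 6 22; split_cmd 15 7 23; split_cmd 16 8 24].
(** Branch-free: a bit equal to 0 cancels the contribution through the product of the four
    digits. *)
Definition look_up (sgn : bool) := cseq [::
  CBin OpMul 20 20 22; CBin OpMul 23 23 24; CBin OpMul 20 20 23;
  CLoad 13 1 13 14; CLoad 15 2 15 16; CLoad 14 3 13 15; CBin OpMul 14 14 20;
  CLoad 16 4 9 10; CBin (if sgn then OpSub else OpAdd) 16 16 14; CStore 4 9 10 16].
Definition probe (k : corner) := CFor 9 0 (CFor 10 0 (CSeq (set_corner k) (CSeq split_all (look_up (corner_sign k))))).

Lemma thr_val_le p q t : (p < n) -> (q < n) -> (thr_val n p q t <= n).
Proof. by case: t => //= /ltnW // + /ltnW. Qed.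

Lemma thr_sum (f : nat -> nat) rp rq p q t : f 18 = 0 -> f 0 = n -> f 3 = 1 -> f rp = p -> f rq = q ->
  (p < n) -> (q < n) ->
  ((f (thr_base rp rq t) + f (thr_off t)) %% 2 ^ w) = thr_val n p q t.
Proof.
move=> f18 f0 f3 fp fq pn qn; rewrite -[RHS](smalln (thr_val_le t pn qn)).
by case: t; rewrite /= ?f18 ?f0 ?f3 ?fp ?fq ?addn0 ?addn1.
Qed.

Lemma thr_exec dst rp rq p q t s : areg s 18 = 0 -> areg s 0 = n -> areg s 3 = 1 ->
  areg s rp = p -> areg s rq = q -> (p < n) -> (q < n) ->
  exec (thr_cmd dst rp rq t) s = set_reg s dst (thr_val n p q t).
Proof. by move=> s18 s0 s3 sp sq pn qn; apply: exec_bin => //; apply: thr_sum. Qed.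

Lemma set_cornerP (k : corner) s p q : env s -> areg s 9 = p -> areg s 10 = q ->
  (p < n) -> (q < n) ->
  let s' := exec (set_corner k) s in
  [/\ ok s', tab s' = tab s, areg s' 13 = thr_val n p q k.1.1.2 /\
      areg s' 14 = thr_val n (y p) (y q) k.1.2.2, areg s' 15 = thr_val n p q k.2.1.2 &
      areg s' 16 = thr_val n (y p) (y q) k.2.2.2].
Proof.
move=> es e9 e10 pn qn; rewrite /set_corner !exec_cseq exec_nil.
have n0 := env_n es; have one := env_one es; have zero := env_zero es.
have yp := y_lt pn; have yq := y_lt qn.
rewrite (@exec_load _ _ 11 0 18 9 _ 0 p (y p)) ?(env_y es) //; last by rewrite ltnS ltnW.
rewrite (@exec_load _ _ 12 0 18 10 _ 0 q (y q)) ?(env_y es) //; last by rewrite ltnS ltnW.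
rewrite (@thr_exec 13 9 10 p q) // (@thr_exec 14 11 12 (y p) (y q)) //.
rewrite (@thr_exec 15 9 10 p q) // (@thr_exec 16 11 12 (y p) (y q)) //.
by split=> //; case: es.
Qed.

Lemma splitP r ri rd a i s : [&& r != ri, r != rd, r != 21, rd != 21 & (a <= n)] ->
  areg s r = a -> areg s ri = i -> areg s 21 = 2 ->
  let s' := exec (split_cmd r ri rd) s in
  [/\ ok s' = ok s, tab s' = tab s, areg s' r = twin i a, areg s' rd = digit i a &
      forall x, x != r -> x != rd -> areg s' x = areg s x].
Proof.
case/and5P=> rri rrd r21 rd21 an er ei e21; rewrite /split_cmd !exec_cseq exec_nil.
have h := shr_le i an; have h2 : ((a %/ 2 ^ i) %/ 2 <= n) by apply: leq_trans h; apply: leq_div.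
rewrite (@exec_bin _ _ _ r r ri _ a i (a %/ 2 ^ i)) //; last exact: smalln.
set s1 := set_reg _ _ _.
have -> : exec (CBin OpMod rd r 21) s1 = set_reg s1 rd (digit i a).
  apply: (@exec_bin _ _ _ _ _ _ _ (a %/ 2 ^ i) 2); rewrite /= /upd ?eqxx //.
    by rewrite eq_sym (negPf r21).
  by rewrite /eval_binop -(digit_calc i an) (smalln h).
set s2 := set_reg _ _ _.
have -> : exec (CBin OpDiv r r 21) s2 = set_reg s2 r (a %/ 2 ^ i %/ 2).
  apply: (@exec_bin _ _ _ _ _ _ _ (a %/ 2 ^ i) 2); last exact: smalln.
    by rewrite /= /upd (negPf rrd) eqxx.
  by rewrite /= /upd ![21 == _]eq_sym (negPf r21) (negPf rd21).
set s3 := set_reg _ _ _.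
have -> : exec (CBin OpMul r r 21) s3 = set_reg s3 r (twin i a).
  apply: (@exec_bin _ _ _ _ _ _ _ (a %/ 2 ^ i %/ 2) 2).
  - by rewrite /= /upd eqxx.
  - by rewrite /= /upd ![21 == _]eq_sym (negPf r21) (negPf rd21).
  - by apply: smalln; apply: leq_trans (twin_le i a) an.
rewrite /= /upd !eqxx [rd == r]eq_sym (negPf rrd); split=> //.
by move=> x xr xrd; rewrite (negPf xr) (negPf xrd).
Qed.

Lemma split_allP s a b c d i j i' j' :
  [&& a <= n, b <= n, c <= n & d <= n] ->
  areg s 13 = a -> areg s 14 = b -> areg s 15 = c -> areg s 16 = d ->
  areg s 5 = i -> areg s 6 = j -> areg s 7 = i' -> areg s 8 = j' -> areg s 21 = 2 ->
  let s' := exec split_all s in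
  [/\ ok s' = ok s, tab s' = tab s,
      [/\ areg s' 13 = twin i a, areg s' 14 = twin j b, areg s' 15 = twin i' c & areg s' 16 = twin j' d],
      [/\ areg s' 20 = digit i a, areg s' 22 = digit j b, areg s' 23 = digit i' c & areg s' 24 = digit j' d] &
      areg s' 9 = areg s 9 /\ areg s' 10 = areg s 10].
Proof.
case/and4P=> an bn cn dn e13 e14 e15 e16 e5 e6 e7 e8 e21 s'.
rewrite {}/s' /split_all 4!exec_cseq exec_nil.
have [|o1 t1 r1 d1 f1] := @splitP 13 5 20 a i s _ e13 e5 e21; first by rewrite an.
move: (exec (split_cmd 13 5 20) s) o1 t1 r1 d1 f1 => s1 o1 t1 r1 d1 f1.
have [|||| o2 t2 r2 d2 f2] := @splitP 14 6 22 b j s1; rewrite ?bn ?f1 //.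
move: (exec (split_cmd 14 6 22) s1) o2 t2 r2 d2 f2 => s2 o2 t2 r2 d2 f2.
have [|||| o3 t3 r3 d3 f3] := @splitP 15 7 23 c i' s2; rewrite ?cn ?f2 ?f1 //.
move: (exec (split_cmd 15 7 23) s2) o3 t3 r3 d3 f3 => s3 o3 t3 r3 d3 f3.
have [|||| o4 t4 r4 d4 f4] := @splitP 16 8 24 d j' s3; rewrite ?dn ?f3 ?f2 ?f1 //.
move: (exec (split_cmd 16 8 24) s3) o4 t4 r4 d4 f4 => s4 o4 t4 r4 d4 f4.
rewrite o4 o3 o2 o1 t4 t3 t2 t1 r4 d4.
by rewrite !f4 // r3 d3 !f3 // r2 d2 !f2 // r1 d1 !f1.
Qed.

Section RingPasses.
Local Open Scope ring_scope.
Variable R : comNzRingType.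
Hypothesis word_zero : (2 ^ w)%N%:R = 0 :> R.

(** In a ring where [2 ^ w] is 0 the machine's reductions disappear, so table entries satisfy
    ordinary ring identities, negative signs included. *)
Lemma natr_word (x : nat) : (x %% 2 ^ w)%N%:R = x%:R :> R.
Proof. by rewrite {2}(divn_eq x (2 ^ w)) natrD natrM word_zero mulr0 add0r. Qed.

Lemma natr_sub (x z : nat) : (z <= 2 ^ w)%N -> ((x + (2 ^ w - z)) %% 2 ^ w)%N%:R = x%:R - z%:R :> R.
Proof. by move=> zw; rewrite natr_word natrD natrB // word_zero sub0r. Qed.

Definition fill src := CFor 9 0 (CFor 10 0 (cseq [:: CLoad 11 0 18 9; CLoad 12 0 18 10;
  CBin OpShr 13 9 5; CBin OpShr 14 11 6; CBin OpShr 15 10 7; CBin OpShr 16 12 8;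
  CLoad 13 1 13 14; CLoad 15 2 15 16; CLoad 14 src 9 10; CLoad 16 3 13 15;
  CBin OpAdd 16 16 14; CStore 3 13 15 16])).

Lemma fillP src (B : nat -> nat -> R) (I I' : nat -> nat -> nat) i j i' j' s :
  env s -> (4 < src)%N ->
  (forall r q, (r < n)%N -> (q < n)%N -> (tab s src r q)%:R = B r q) ->
  (forall X Y, tab s 1 X Y = I X Y) -> (forall X Y, tab s 2 X Y = I' X Y) ->
  areg s 5 = i -> areg s 6 = j -> areg s 7 = i' -> areg s 8 = j' ->
  class_table n y i j I n -> class_table n y i' j' I' n ->
  (forall x z, (x <= n)%N -> (z <= n)%N -> tab s 3 x z = 0%N) ->
  let s' := exec (fill src) s in
  env s' /\ forall N M, (N <= n)%N -> (M <= n)%N -> (tab s' 3 N M)%:R =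
    bucket n y i j i' j' I I' B N M :> R.
Proof.
move=> es hsrc hB hI hI' e5 e6 e7 e8 t1 t2 z3; rewrite /fill.
have src3 : (src == 3) = false by lia.
pose g r q N M : R := ((I (r %/ 2 ^ i)%N (y r %/ 2 ^ j)%N == N) && (I' (q %/ 2 ^ i')%N (y q %/ 2 ^ j')%N == M))%:R * B r q.
pose P k l s' := ok s' /\ forall N M, (N <= n)%N -> (M <= n)%N -> (tab s' 3 N M)%:R =
  \sum_(r < k) \sum_(q < n) g r q N M + \sum_(q < l) g k q N M.
have : P (areg s 0) 0%N (exec (fill src) s).
  apply: for2_ind => //.
  - split; first by case: es.
    by move=> N M Nn Mn; rewrite z3 // !big_ord0 addr0.
  - move=> k l s'; rewrite (env_n es) => kn ln k9 l10 ss [oks ht].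
    have es' : env s' by apply: (env_same _ ss).
    have [sr st] := ss.
    have e5' : areg s' 5 = i by rewrite sr.
    have e6' : areg s' 6 = j by rewrite sr.
    have e7' : areg s' 7 = i' by rewrite sr.
    have e8' : areg s' 8 = j' by rewrite sr.
    have hk := shr_le i (ltnW kn); have hl := shr_le i' (ltnW ln).
    have hyk := shr_le j (ltnW (y_lt kn)); have hyl := shr_le j' (ltnW (y_lt ln)).
    have e18 := env_zero es'.
    set N0 := I (k %/ 2 ^ i)%N (y k %/ 2 ^ j)%N; set M0 := I' (l %/ 2 ^ i')%N (y l %/ 2 ^ j')%N.
    have N0n : (N0 <= n)%N by apply: (class_table_le t1).
    have M0n : (M0 <= n)%N by apply: (class_table_le t2).
    have kD : (k < D)%N by rewrite ltnS ltnW.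
    have lD : (l < D)%N by rewrite ltnS ltnW.
    rewrite !exec_cseq exec_nil (@exec_load _ _ 11 0 18 9 _ 0 k (y k)) ?(env_y es') //.
    rewrite (@exec_load _ _ 12 0 18 10 _ 0 l (y l)) ?(env_y es') //.
    rewrite (@exec_bin _ _ _ 13 9 5 _ k i (k %/ 2 ^ i)) //; last exact: smalln.
    rewrite (@exec_bin _ _ _ 14 11 6 _ (y k) j (y k %/ 2 ^ j)) //; last exact: smalln.
    rewrite (@exec_bin _ _ _ 15 10 7 _ l i' (l %/ 2 ^ i')) //; last exact: smalln.
    rewrite (@exec_bin _ _ _ 16 12 8 _ (y l) j' (y l %/ 2 ^ j')) //; last exact: smalln.
    rewrite (@exec_load _ _ 13 1 13 14 _ (k %/ 2 ^ i) (y k %/ 2 ^ j) N0) //; last by rewrite /= st // hI.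
    rewrite (@exec_load _ _ 15 2 15 16 _ (l %/ 2 ^ i') (y l %/ 2 ^ j') M0) //; last by rewrite /= st // hI'.
    rewrite (@exec_load _ _ 14 src 9 10 _ k l (tab s src k l)) //; last by rewrite /= st //= eq_sym src3.
    rewrite (@exec_load _ _ 16 3 13 15 _ N0 M0 (tab s' 3 N0 M0)) //.
    rewrite (@exec_bin _ _ _ 16 16 14 _ (tab s' 3 N0 M0) (tab s src k l)
              ((tab s' 3 N0 M0 + tab s src k l) %% 2 ^ w)) //.
    rewrite (@exec_store _ _ 3 13 15 16 _ N0 M0 ((tab s' 3 N0 M0 + tab s src k l) %% 2 ^ w)) //.
    split=> // N M Nn Mn /=.
    rewrite big_ord_recr /= addrA -(ht N M Nn Mn) /g -/N0 -/M0 /upd3 /=.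
    rewrite [N0 == N]eq_sym [M0 == M]eq_sym; case: (eqVneq N N0) => [->|_]; last by rewrite mul0r addr0.
    case: (eqVneq M M0) => [->|_] /=; last by rewrite mul0r addr0.
    by rewrite natr_word natrD mul1r hB.
  - move=> k s'; rewrite (env_n es) => kn [oks ht]; split=> // N M Nn Mn.
    by rewrite big_ord0 addr0 big_ord_recr ht.
rewrite (env_n es) => -[oks ht]; split=> [|N M Nn Mn].
  by apply: (env_same _ (exec_same _ _ _ _)).
by rewrite ht // big_ord0 addr0.
Qed.

Lemma probeP (k : corner) (B : nat -> nat -> R) (I I' : nat -> nat -> nat) i j i' j' s :
  env s ->
  (forall X Y, tab s 1 X Y = I X Y) -> (forall X Y, tab s 2 X Y = I' X Y) ->
  areg s 5 = i -> areg s 6 = j -> areg s 7 = i' -> areg s 8 = j' ->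
  class_table n y i j I n -> class_table n y i' j' I' n ->
  (forall N M, (N <= n)%N -> (M <= n)%N -> (tab s 3 N M)%:R =
    bucket n y i j i' j' I I' B N M :> R) ->
  let s' := exec (probe k) s in
  env s' /\ forall p q, (p < n)%N -> (q < n)%N -> (tab s' 4 p q)%:R =
     (tab s 4 p q)%:R + (-1) ^+ corner_sign k *
     level n y i j i' j' (thr_val n p q k.1.1.2) (thr_val n (y p) (y q) k.1.2.2)
       (thr_val n p q k.2.1.2) (thr_val n (y p) (y q) k.2.2.2) B :> R.
Proof.
move=> es hI hI' e5 e6 e7 e8 t1 t2 h3; rewrite /probe.
set term := fun p q => (-1) ^+ corner_sign k * level n y i j i' j' (thr_val n p q k.1.1.2) (thr_val n (y p) (y q) k.1.2.2)
       (thr_val n p q k.2.1.2) (thr_val n (y p) (y q) k.2.2.2) B.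
pose P a b s' := ok s' /\ forall p q, (p < n)%N -> (q < n)%N -> (tab s' 4 p q)%:R =
   (tab s 4 p q)%:R + if ((p < a) || (p == a) && (q < b))%N then term p q else 0.
have : P (areg s 0) 0%N (exec (probe k) s).
  apply: for2_ind => //.
  - split; first by case: es.
    by move=> p q pn qn; rewrite !ltn0 andbF addr0.
  - move=> p q s'; rewrite (env_n es) => pn qn p9 q10 ss [oks ht].
    have es' : env s' by apply: (env_same _ ss).
    have [sr st] := ss.
    have e5' : areg s' 5 = i by rewrite sr.
    have e6' : areg s' 6 = j by rewrite sr.
    have e7' : areg s' 7 = i' by rewrite sr.
    have e8' : areg s' 8 = j' by rewrite sr.
    have [ok2 tab2 [r13 r14] r15 r16] := set_cornerP k es' p9 q10 pn qn.
    have fr r : ~~ writes (set_corner k) r -> areg (exec (set_corner k) s') r = areg s' r by apply: exec_frame.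
    have g9 := fr 9 isT; have g10 := fr 10 isT; have g21 := fr 21 isT.
    have g5 := fr 5 isT; have g6 := fr 6 isT; have g7 := fr 7 isT; have g8 := fr 8 isT.
    rewrite 2!exec_seq.
    move: (exec (set_corner k) s') ok2 tab2 r13 r14 r15 r16 g9 g10 g21 g5 g6 g7 g8 {fr} => s2.
    rewrite p9 q10 e5' e6' e7' e8' (env_two es') => ok2 tab2 r13 r14 r15 r16 g9 g10 g21 g5 g6 g7 g8.
    have yp := y_lt pn; have yq := y_lt qn.
    have [] := split_allP _ r13 r14 r15 r16 g5 g6 g7 g8 g21; first by rewrite !thr_val_le.
    move: (exec split_all s2) => s3; rewrite ok2 tab2 g9 g10.
    move=> ok3 tab3 [q13 q14 q15 q16] [q20 q22 q23 q24] [q9 q10'].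
    have an := thr_val_le k.1.1.2 pn qn; have cn := thr_val_le k.1.2.2 yp yq.
    have bn := thr_val_le k.2.1.2 pn qn; have dn := thr_val_le k.2.2.2 yp yq.
    (* The class numbers and digits in this formula are exactly the values that [look_up] fetches
       and multiplies. *)
    have Eterm := level_bucket B t1 t2 y_lt an cn bn dn.
    have tA := leq_trans (twin_le i _) an; have tC := leq_trans (twin_le j _) cn.
    have tB := leq_trans (twin_le i' _) bn; have tD := leq_trans (twin_le j' _) dn.
    have Et : term p q = (-1) ^+ corner_sign k * level n y i j i' j' (thr_val n p q k.1.1.2)
      (thr_val n (y p) (y q) k.1.2.2) (thr_val n p q k.2.1.2) (thr_val n (y p) (y q) k.2.2.2) B by [].
    move: Eterm Et an cn bn dn tA tC tB tD q13 q14 q15 q16 q20 q22 q23 q24 {r13 r14 r15 r16}.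
    move: (thr_val n p q k.1.1.2) (thr_val n (y p) (y q) k.1.2.2)
          (thr_val n p q k.2.1.2) (thr_val n (y p) (y q) k.2.2.2) => a c b d.
    move=> Eterm Et an cn bn dn tA tC tB tD q13 q14 q15 q16 q20 q22 q23 q24.
    set N0 := I (twin i a) (twin j c) in Eterm *.
    set M0 := I' (twin i' b) (twin j' d) in Eterm *.
    have N0n : (N0 <= n)%N by apply: (class_table_le t1).
    have M0n : (M0 <= n)%N by apply: (class_table_le t2).
    have pD : (p < D)%N by rewrite ltnS ltnW.
    have qD : (q < D)%N by rewrite ltnS ltnW.
    pose v1 := ((digit i a * digit j c) %% 2 ^ w)%N; pose v2 := ((digit i' b * digit j' d) %% 2 ^ w)%N.
    pose v := ((v1 * v2) %% 2 ^ w)%N; pose h := ((tab s 3 N0 M0 * v) %% 2 ^ w)%N.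
    pose z := eval_binop w (if corner_sign k then OpSub else OpAdd) (tab s' 4 p q) h.
    rewrite /look_up 10!exec_cseq exec_nil.
    rewrite (@exec_bin _ _ _ 20 20 22 _ (digit i a) (digit j c) v1) //.
    rewrite (@exec_bin _ _ _ 23 23 24 _ (digit i' b) (digit j' d) v2) //.
    rewrite (@exec_bin _ _ _ 20 20 23 _ v1 v2 v) //.
    rewrite (@exec_load _ _ 13 1 13 14 _ (twin i a) (twin j c) N0) //; last by rewrite /= tab3 st // hI.
    rewrite (@exec_load _ _ 15 2 15 16 _ (twin i' b) (twin j' d) M0) //; last by rewrite /= tab3 st // hI'.
    rewrite (@exec_load _ _ 14 3 13 15 _ N0 M0 (tab s 3 N0 M0)) //; last by rewrite /= tab3 st.
    rewrite (@exec_bin _ _ _ 14 14 20 _ (tab s 3 N0 M0) v h) //.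
    rewrite (@exec_load _ _ 16 4 9 10 _ p q (tab s' 4 p q)) //; last by rewrite /= tab3.
    rewrite (@exec_bin _ _ _ 16 16 14 _ (tab s' 4 p q) h z) //.
    rewrite (@exec_store _ _ 4 9 10 16 _ p q z) //.
    split=> [|p' q' pn' qn'] /=; first by rewrite ok3.
    rewrite tab3 /upd3 /=; case: andP => [[/eqP-> /eqP->]|ne]; last first.
      rewrite ht //; congr (_ + _); congr (if _ then _ else _); move: ne; lia.
    rewrite ltnn eqxx ltnSn /= Et Eterm -h3 //.
    have hw : (h <= 2 ^ w)%N by rewrite ltnW // ltn_pmod // expn_gt0.
    have Eh : h%:R = (digit i a)%:R * (digit j c)%:R * ((digit i' b)%:R * (digit j' d)%:R) * (tab s 3 N0 M0)%:R :> R.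
      by rewrite natr_word natrM natr_word natrM !natr_word !natrM mulrC.
    have Ef : (tab s' 4 p q)%:R = (tab s 4 p q)%:R :> R by rewrite ht // ltnn eqxx ltnn addr0.
    rewrite -Eh -Ef /z; rewrite /eval_binop; case: corner_sign.
      by rewrite natr_sub // expr1 mulN1r.
    by rewrite natr_word natrD expr0 mul1r.
  - move=> p s'; rewrite (env_n es) => pn [oks ht]; split=> // p' q' pn' qn'.
    rewrite ht //; congr (_ + _); congr (if _ then _ else _); move: qn'; lia.
rewrite (env_n es) => -[oks ht]; split=> [|p q pn qn].
  by apply: (env_same _ (exec_same _ _ _ _)).
by rewrite ht // pn.
Qed.

(** An in-place update: each iteration changes only its own cell, so [(p, q)] still has its original
    value when it is reached. *)
Lemma map_pass t c s (g : nat -> nat -> R) : env s -> t != 0%N ->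
  preserving (CFor 9 0 (CFor 10 0 c)) -> ~~ writes c 9 -> ~~ writes c 10 ->
  (forall t', t' != t -> ~~ stores c t') ->
  (forall p q s', (p < n)%N -> (q < n)%N -> env s' -> areg s' 9 = p -> areg s' 10 = q ->
     (forall t' x z, t' != t -> tab s' t' x z = tab s t' x z) -> tab s' t p q = tab s t p q ->
     ok (exec c s') /\ exists2 v, tab (exec c s') = upd3 (tab s') t p q v & v%:R = g p q) ->
  let s' := exec (CFor 9 0 (CFor 10 0 c)) s in
  env s' /\ forall p q, (p < n)%N -> (q < n)%N -> (tab s' t p q)%:R = g p q.
Proof.
move=> es t0 pres w9 w10 hst step.
have w0 : ~~ writes c 0 by case/andP: pres.
pose P k l s' := ok s' /\ forall p q, (p < n)%N -> (q < n)%N ->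
  if ((p < k) || (p == k) && (q < l))%N then (tab s' t p q)%:R = g p q else tab s' t p q = tab s t p q.
have : P (areg s 0) 0%N (exec (CFor 9 0 (CFor 10 0 c)) s).
  apply: for2_ind => //.
  - by rewrite /= w0 w9 w10.
  - split; first by case: es.
    by move=> p q pn qn; rewrite !ltn0 andbF.
  - move=> k l s'; rewrite (env_n es) => kn ln k9 l10 ss [oks ht].
    have es' : env s' by apply: (env_same pres ss).
    have [||ok' [v tv gv]] := step k l s' kn ln es' k9 l10.
    + by move=> t' x z tt; case: ss => _ -> //=; apply: hst.
    + by have := ht k l kn ln; rewrite !ltnn eqxx.
    split=> // p q pn qn; rewrite tv /upd3 eqxx /=.
    have := ht p q pn qn; rewrite ltnS [(q <= l)%N]leq_eqVlt.
    case: (eqVneq p k) => [->|_] //=.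
    by rewrite ltnn /=; case: (eqVneq q l) => [->|_].
  - move=> k s'; rewrite (env_n es) => kn [oks ht]; split=> // p q pn qn.
    have -> : ((p < k.+1) || (p == k.+1) && (q < 0) = ((p < k) || (p == k) && (q < n)))%N by move: qn; lia.
    exact: ht.
rewrite (env_n es) => -[oks ht]; split=> [|p q pn qn].
  exact: (env_same pres (exec_same _ _ _ _)).
by have := ht p q pn qn; rewrite pn.
Qed.

(** Applied to four nested loops, this yields the fourfold sum over bit positions. *)
Lemma acc_loop i c s (G : nat -> nat -> nat -> R) : env s ->
  preserving (CFor i 4 c) -> i != 4 -> ~~ writes c i ->
  (forall k s', (k < L)%N -> areg s' i = k -> same (CFor i 4 c) s s' -> env s' ->
     env (exec c s') /\ forall p q, (p < n)%N -> (q < n)%N ->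
       (tab (exec c s') 4 p q)%:R = (tab s' 4 p q)%:R + G k p q) ->
  let s' := exec (CFor i 4 c) s in
  env s' /\ forall p q, (p < n)%N -> (q < n)%N ->
       (tab s' 4 p q)%:R = (tab s 4 p q)%:R + \sum_(k < L) G k p q.
Proof.
move=> es pres i4 wi step.
have w4 : ~~ writes c 4 by case/and5P: pres => _ _ _ /= + _; rewrite negb_or => /andP[].
pose P k s' := ok s' /\ forall p q, (p < n)%N -> (q < n)%N ->
   (tab s' 4 p q)%:R = (tab s 4 p q)%:R + \sum_(k < k) G k p q.
have : P (areg s 4) (exec (CFor i 4 c) s).
  apply: for_ind => //.
  - split; first by case: es.
    by move=> p q pn qn; rewrite big_ord0 addr0.
  - move=> k s'; rewrite (env_L es) => kL ki ss [oks ht].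
    have es' := env_same pres ss oks es.
    have [es2 h2] := step k s' kL ki ss es'; split; first by case: es2.
    by move=> p q pn qn; rewrite h2 // ht // big_ord_recr addrA.
rewrite (env_L es) => -[oks ht]; split=> //.
exact: (env_same pres (exec_same _ _ _ _)).
Qed.

End RingPasses.
End Passes.

(** * Aggregation over one tree edge *)

Definition level_cmd src k := cseq [:: clear 1; clear 2; clear 3; build 1 5 6; build 2 7 8; fill src; probe k].
Definition quad_cmd src k := CFor 5 4 (CFor 6 4 (CFor 7 4 (CFor 8 4 (level_cmd src k)))).
Definition mult_cmd dst := CFor 9 0 (CFor 10 0 (cseq [:: CLoad 11 dst 9 10; CLoad 12 4 9 10;
  CBin OpMul 11 11 12; CStore dst 9 10 11])).
Definition bag_table i := i + 5.
Definition agg_cmd tau (t : tree) i := cseq (clear 4 ::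
  [seq quad_cmd (bag_table i) k | k <- corners tau (bag_of t i) (bag_of t (parent t i))] ++
  [:: mult_cmd (bag_table (parent t i))]).
Definition less_cmd r (up : bool) r1 r2 := if up then CBin OpLt r r1 r2 else CBin OpLt r r2 r1.
Definition init_cmd (tau : seq nat) (t : tree) i := let b := bag_of t i in
  CFor 9 0 (CFor 10 0 (if b.1 == b.2 then cseq [:: CBin OpEq 13 9 10; CStore (bag_table i) 9 10 13]
   else cseq [:: CLoad 11 0 18 9; CLoad 12 0 18 10;
     less_cmd 13 (b.1 < b.2) 9 10; less_cmd 14 (nth 0 tau b.1 < nth 0 tau b.2) 11 12;
     CBin OpMul 13 13 14; CStore (bag_table i) 9 10 13])).
Definition total_cmd := CSeq (CMove 19 18) (CFor 9 0 (CFor 10 0 (cseq [:: CLoad 11 5 9 10; CBin OpAdd 19 19 11]))).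
(** Register numbers are literals of the program, so the size of [pickle s] costs nothing; what
    matters is that it is injective. *)
Definition count_reg (s : seq nat) := 100 + pickle s.
(** Reverse list order eliminates children before parents, so that in the end the table of bag 0
    holds everything to be summed. *)
Definition entry_cmd k (e : seq nat * tree) := let: (tau, t) := e in
  cseq ([seq init_cmd tau t i | i <- iota 0 (size t)] ++
        [seq agg_cmd tau t i | i <- rev (iota 1 (size t).-1)] ++ total_cmd ::
        [seq CBin OpSub 19 19 (count_reg s) | s <- rem tau (patterns k tau t)] ++
        [:: CMove (count_reg tau) 19]).

Section Entry.
Variables (w n L : nat) (y : nat -> nat).
Local Notation D := n.+1.
Local Notation exec := (exec w D).
Local Notation env := (env n L y).
Hypothesis room : ntables * D * D <= 2 ^ w.
Hypothesis y_lt : forall r, r < n -> y r < n.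

Lemma exec_cat l1 l2 s : exec (cseq (l1 ++ l2)) s = exec (cseq l2) (exec (cseq l1) s).
Proof. by elim: l1 s => //= c l1 IH s; rewrite !exec_cseq IH. Qed.

Local Open Scope ring_scope.
Variable R : comNzRingType.
Hypothesis word_zero : (2 ^ w)%N%:R = 0 :> R.

Section Aggregate.
Variables (src : nat) (k : corner) (B : nat -> nat -> R).
Hypothesis hsrc : (4 < src)%N.

Definition holds s := forall r q, (r < n)%N -> (q < n)%N -> (tab s src r q)%:R = B r q.

Lemma holds_same c s s' : same c s s' -> ~~ stores c src -> holds s -> holds s'.
Proof. by move=> [_ ht] h hs r q rn qn; rewrite ht // hs. Qed.

Definition level_term i j i' j' p q : R := (-1) ^+ corner_sign k *
  level n y i j i' j' (thr_val n p q k.1.1.2) (thr_val n (y p) (y q) k.1.2.2)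
       (thr_val n p q k.2.1.2) (thr_val n (y p) (y q) k.2.2.2) B.

Lemma levelP i j i' j' s : env s -> holds s ->
  areg s 5 = i -> areg s 6 = j -> areg s 7 = i' -> areg s 8 = j' ->
  let s' := exec (level_cmd src k) s in
  env s' /\ forall p q, (p < n)%N -> (q < n)%N ->
    (tab s' 4 p q)%:R = (tab s 4 p q)%:R + level_term i j i' j' p q.
Proof.
move=> es hs e5 e6 e7 e8; rewrite /level_cmd 7!exec_cseq exec_nil.
have nsrc t : (t < 5)%N -> (t == src) = false by lia.
have fr c s0 r : ~~ writes c r -> areg (exec c s0) r = areg s0 r by apply: exec_frame.
have ft c s0 t x z : ~~ stores c t -> tab (exec c s0) t x z = tab s0 t x z by apply: exec_stores.
have [es1 z1] := clearP room es (t := 1) isT.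
pose s1 := exec (clear 1) s; rewrite -/s1 in es1 z1 *.
have [es2 z2] := clearP room es1 (t := 2) isT.
set s2 := exec (clear 2) s1 in es2 z2 *.
have [es3 z3] := clearP room es2 (t := 3) isT.
set s3 := exec (clear 3) s2 in es3 z3 *.
have [|||es4 c4] := @buildP w n L y room y_lt 1 5 6 i j s3 es3 isT isT isT.
- by rewrite !fr.
- by rewrite !fr.
- by move=> x z xn zn; rewrite (ft (clear 3) s2) // (ft (clear 2) s1) // z1.
set s4 := exec (build 1 5 6) s3 in es4 c4 *.
have [|||es5 c5] := @buildP w n L y room y_lt 2 7 8 i' j' s4 es4 isT isT isT.
- by rewrite !fr.
- by rewrite !fr.
- by move=> x z xn zn; rewrite (ft (build 1 5 6) s3) // (ft (clear 3) s2) // z2.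
set s5 := exec (build 2 7 8) s4 in es5 c5 *.
have [||||||||es6 h6] := @fillP w n L y room y_lt R word_zero src B (tab s4 1) (tab s5 2) i j i' j' s5 es5 hsrc _ _ _ _ _ _ _ c4 c5.
- by move=> r q rn qn; rewrite !ft ?hs //= ?nsrc.
- by move=> X Y; rewrite ft.
- by [].
- by rewrite !fr.
- by rewrite !fr.
- by rewrite !fr.
- by rewrite !fr.
- by move=> x z xn zn; rewrite (ft (build 2 7 8) s4) // (ft (build 1 5 6) s3) // z3.
set s6 := exec (fill src) s5 in es6 h6 *.
have [|||||||es7 h7] := @probeP w n L y room y_lt R word_zero k B (tab s4 1) (tab s5 2) i j i' j' s6 es6 _ _ _ _ _ _ c4 c5.
- by move=> X Y; rewrite (ft (fill src) s5) // (ft (build 2 7 8) s4).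
- by move=> X Y; rewrite (ft (fill src) s5).
- by rewrite !fr.
- by rewrite !fr.
- by rewrite !fr.
- by rewrite !fr.
- by [].
split=> // p q pn qn; rewrite h7 //; congr (_%:R + _).
by rewrite !ft.
Qed.

Lemma quadP s : (n < 2 ^ L)%N -> env s -> holds s -> let s' := exec (quad_cmd src k) s in
  env s' /\ forall p q, (p < n)%N -> (q < n)%N ->
    (tab s' 4 p q)%:R = (tab s 4 p q)%:R + (-1) ^+ corner_sign k * corner_quadrant n y k B p q.
Proof.
move=> n_lt es hs.
have nst : ~~ stores (level_cmd src k) src by rewrite /=; lia.
have [//|//|//| |es' h'] := @acc_loop w n L y R 5 (CFor 6 4 (CFor 7 4 (CFor 8 4 (level_cmd src k)))) s
  (fun i p q => \sum_(j < L) \sum_(i' < L) \sum_(j' < L) level_term i j i' j' p q) es.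
  move=> i s1 _ e5 ss1 es1; have hs1 := holds_same ss1 nst hs.
  apply: (@acc_loop w n L y R 6 _ s1 (fun j p q => \sum_(i' < L) \sum_(j' < L) level_term i j i' j' p q)) => //.
  move=> j s2 _ e6 ss2 es2; have hs2 := holds_same ss2 nst hs1.
  have f2 : areg s2 5 = i by case: ss2 => ->.
  apply: (@acc_loop w n L y R 7 _ s2 (fun i' p q => \sum_(j' < L) level_term i j i' j' p q)) => //.
  move=> i' s3 _ e7 ss3 es3; have hs3 := holds_same ss3 nst hs2.
  have f3 : areg s3 5 = i by case: ss3 => ->.
  have g3 : areg s3 6 = j by case: ss3 => ->.
  apply: (@acc_loop w n L y R 8 _ s3 (fun j' p q => level_term i j i' j' p q)) => //.
  move=> j' s4 _ e8 ss4 es4; have hs4 := holds_same ss4 nst hs3.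
  have f4 : areg s4 5 = i by case: ss4 => ->.
  have g4 : areg s4 6 = j by case: ss4 => ->.
  have h4 : areg s4 7 = i' by case: ss4 => ->.
  exact: levelP.
split=> // p q pn qn; rewrite h' //; congr (_ + _).
have yp := y_lt pn; have yq := y_lt qn.
have lt p' q' t : (p' < n)%N -> (q' < n)%N -> (thr_val n p' q' t < 2 ^ L)%N.
  by move=> pn' qn'; apply: leq_ltn_trans n_lt; apply: thr_val_le.
rewrite /corner_quadrant (@quadrant_levels _ _ _ L) ?lt // /level_term mulr_sumr; apply: eq_bigr => i _.
rewrite mulr_sumr; apply: eq_bigr => j _; rewrite mulr_sumr; apply: eq_bigr => i' _.
by rewrite mulr_sumr.
Qed.
End Aggregate.

Lemma quadsP src (B : nat -> nat -> R) (ks : seq corner) s : (n < 2 ^ L)%N -> (4 < src)%N -> env s -> holds src B s ->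
  let s' := exec (cseq [seq quad_cmd src k | k <- ks]) s in
  env s' /\ forall p q, (p < n)%N -> (q < n)%N ->
    (tab s' 4 p q)%:R = (tab s 4 p q)%:R +
      \sum_(k <- ks) (-1) ^+ corner_sign k * corner_quadrant n y k B p q.
Proof.
move=> n_lt hsrc; elim: ks s => [|k ks IH] s es hs.
  by rewrite /= exec_nil; split=> // p q _ _; rewrite big_nil addr0.
rewrite /= exec_cseq; have [es1 h1] := quadP k hsrc n_lt es hs.
have nst : ~~ stores (quad_cmd src k) src by rewrite /=; lia.
have hs1 := holds_same (exec_same w D (quad_cmd src k) s) nst hs.
have [es2 h2] := IH _ es1 hs1; split=> // p q pn qn.
by rewrite h2 // h1 // big_cons addrA.
Qed.

Lemma multP dst s : env s -> (4 < dst)%N -> let s' := exec (mult_cmd dst) s in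
  env s' /\ forall p q, (p < n)%N -> (q < n)%N ->
    (tab s' dst p q)%:R = (tab s dst p q)%:R * (tab s 4 p q)%:R :> R.
Proof.
move=> es hd; apply: map_pass => //; try by rewrite /preserving /cseq /=; lia.
move=> p q s' pn qn es' e9 e10 ht hdst.
have pD : (p < D)%N by rewrite ltnS ltnW.
have qD : (q < D)%N by rewrite ltnS ltnW.
pose v := ((tab s dst p q * tab s 4 p q) %% 2 ^ w)%N.
rewrite 4!exec_cseq exec_nil (@exec_load _ _ 11 dst 9 10 _ p q (tab s dst p q)) //.
rewrite (@exec_load _ _ 12 4 9 10 _ p q (tab s 4 p q)) //; last by rewrite /= ht //; lia.
rewrite (@exec_bin _ _ _ 11 11 12 _ (tab s dst p q) (tab s 4 p q) v) //.
rewrite (@exec_store _ _ dst 9 10 11 _ p q v) //; split; first by case: es'.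
by exists v => //; rewrite natr_word // natrM.
Qed.

Lemma lessP r (up : bool) r1 r2 s a b : areg s r1 = a -> areg s r2 = b ->
  exec (less_cmd r up r1 r2) s = set_reg s r (if up then a < b else b < a)%N.
Proof.
have w1 : (1 < 2 ^ w)%N by apply: leq_ltn_trans (D_lt room).
have le1 (x z : nat) : ((x < z) %% 2 ^ w = (x < z))%N by rewrite modn_small //; case: (x < z)%N => //; apply: ltnW.
by rewrite /less_cmd => ea eb; case: up; [apply: exec_bin ea eb _ | apply: exec_bin eb ea _]; apply: le1.
Qed.

Lemma initP tau t i s : env s -> let s' := exec (init_cmd tau t i) s in
  env s' /\ forall p q, (p < n)%N -> (q < n)%N ->
    (tab s' (bag_table i) p q)%:R = (bag_ok tau y (bag_of t i) p q)%:R :> R.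
Proof.
move=> es; rewrite /init_cmd; set b := bag_of t i; set c := if _ then _ else _.
have w1 : (1 < 2 ^ w)%N by apply: leq_ltn_trans (D_lt room).
have t0 : bag_table i != 0%N by rewrite /bag_table addnS.
have wr r : (r < 11)%N || (16 < r)%N -> ~~ writes c r.
  rewrite /c /less_cmd /cseq; case: ifP => _ /=; first by lia.
  by case: ifP => _; case: ifP => _ /=; lia.
have st t' : t' != bag_table i -> ~~ stores c t'.
  rewrite /c /less_cmd /cseq eq_sym; case: ifP => _ /=; first by rewrite orbF.
  by case: ifP => _; case: ifP => _ /=; rewrite orbF.
apply: map_pass => //; rewrite ?wr //.
  by rewrite /preserving /= !wr // st // eq_sym.
move=> p q s' pn qn es' e9 e10 ht hdst.
have pD : (p < D)%N by rewrite ltnS ltnW.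
have qD : (q < D)%N by rewrite ltnS ltnW.
rewrite /c /bag_ok; case: ifP => bb.
  rewrite 2!exec_cseq exec_nil (@exec_bin _ _ _ 13 9 10 _ p q (p == q)) //; last first.
    by rewrite /eval_binop modn_small //; case: (p == q) => //; apply: ltnW.
  rewrite (@exec_store _ _ _ 9 10 13 _ p q (p == q)) //; split; first by case: es'.
  by exists (p == q).
have zero := env_zero es'.
rewrite 6!exec_cseq exec_nil (@exec_load _ _ 11 0 18 9 _ 0 p (y p)) ?(env_y es') //.
rewrite (@exec_load _ _ 12 0 18 10 _ 0 q (y q)) ?(env_y es') //.
rewrite (@lessP 13 _ 9 10 _ p q) // (@lessP 14 _ 11 12 _ (y p) (y q)) //.
rewrite -/(agree b.1 b.2 p q) -/(agree (nth 0%N tau b.1) (nth 0%N tau b.2) (y p) (y q)).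
pose v : nat := link_ok tau y b p q.
rewrite (@exec_bin _ _ _ 13 13 14 _ (agree b.1 b.2 p q) (agree (nth 0%N tau b.1) (nth 0%N tau b.2) (y p) (y q)) v) //; last first.
  by rewrite /eval_binop mulnb modn_small //; case: (_ && _) => //; apply: ltnW.
rewrite (@exec_store _ _ _ 9 10 13 _ p q v) //; split; first by case: es'.
by exists v.
Qed.

Lemma totalP s : env s -> let s' := exec total_cmd s in
  env s' /\ (areg s' 19)%:R = \sum_(p < n) \sum_(q < n) (tab s 5 p q)%:R :> R.
Proof.
move=> es; rewrite /total_cmd exec_seq.
set s0 := exec (CMove 19 18) s; set c := cseq _.
have es0 : env s0 by apply: (env_same (c := CMove 19 18) _ (exec_same _ _ _ _) _ es) => //; case: es.
pose P k l s' := ok s' /\ (areg s' 19)%:R =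
  \sum_(p < k) \sum_(q < n) (tab s 5 p q)%:R + \sum_(q < l) (tab s 5 k q)%:R :> R.
have : P (areg s0 0) 0%N (exec (CFor 9 0 (CFor 10 0 c)) s0).
  apply: for2_ind => //.
  - split; first by case: es0.
    by rewrite /s0 /exec /= /upd /= (env_zero es) !big_ord0 addr0.
  - move=> k l s'; rewrite (env_n es0) => kn ln e9 e10 ss [oks h].
    have es' : env s' by apply: (env_same _ ss).
    have kD : (k < D)%N by rewrite ltnS ltnW.
    have lD : (l < D)%N by rewrite ltnS ltnW.
    rewrite /c 2!exec_cseq exec_nil (@exec_load _ _ 11 5 9 10 _ k l (tab s 5 k l)) //; last first.
      by case: ss => _ ->.
    rewrite (@exec_bin _ _ _ 19 19 11 _ (areg s' 19) (tab s 5 k l) ((areg s' 19 + tab s 5 k l) %% 2 ^ w)) //.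
    split=> //=; rewrite /upd /= natr_word // natrD h big_ord_recr /=; ring.
  - move=> k s'; rewrite (env_n es0) => kn [oks h]; split=> //.
    by rewrite big_ord0 addr0 big_ord_recr.
rewrite (env_n es0) => -[oks]; rewrite big_ord0 addr0 => h; split=> //.
by apply: (env_same (c := CFor 9 0 (CFor 10 0 c))) es0 => //; apply: exec_same.
Qed.
End Entry.

(** * Evaluating one certificate entry *)

Lemma hasN (T : Type) (P : pred T) (s : seq T) : (forall x, ~~ P x) -> ~~ has P s.
Proof. by move=> h; elim: s => //= x s IH; rewrite negb_or h. Qed.

Lemma writes_cseq l r : writes (cseq l) r = has (writes^~ r) l.
Proof. by elim: l => //= c l <-. Qed.

Lemma stores_cseq l t : stores (cseq l) t = has (stores^~ t) l.
Proof. by elim: l => //= c l <-. Qed.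

(** Includes the input length, the constants and the counts already computed, all of which must
    survive the processing of a tree. *)
Definition reserved r := (r < 5) || (r == 18) || (r == 21) || (99 < r).

Lemma agg_writes tau t i r : reserved r -> ~~ writes (agg_cmd tau t i) r.
Proof.
move=> hr; rewrite /agg_cmd; move: (corners _ _ _) => ks; rewrite writes_cseq -cat1s !has_cat has_map !has_seq1; apply/norP; split.
  by move: hr; rewrite /reserved /=; lia.
rewrite negb_or; apply/andP; split; last by move: hr; rewrite /reserved /=; lia.
by apply: hasN => k; move: hr; rewrite /reserved /=; lia.
Qed.

Lemma init_writes tau t i r : reserved r -> ~~ writes (init_cmd tau t i) r.
Proof.
rewrite /init_cmd /less_cmd /cseq /reserved; case: ifP => _ /=; first by lia.
by case: ifP => _; case: ifP => _ /=; lia.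
Qed.

Lemma init_stores tau t i t' : t' != bag_table i -> ~~ stores (init_cmd tau t i) t'.
Proof.
rewrite /init_cmd /less_cmd /cseq eq_sym; case: ifP => _ /=; first by rewrite orbF.
by case: ifP => _; case: ifP => _ /=; rewrite orbF.
Qed.

Lemma total_writes r : reserved r -> ~~ writes total_cmd r.
Proof. by rewrite /reserved /=; lia. Qed.

Section Bounded.
Variables (w D : nat).
(** The difference [2 ^ w - z] in the machine's subtraction is itself truncated, so it is correct
    only for [z <= 2 ^ w]; this invariant provides that bound. *)
Definition bounded s := (forall r, areg s r < 2 ^ w) /\ (forall t x z, tab s t x z < 2 ^ w).

Lemma set_reg_bounded s r v : v < 2 ^ w -> bounded s -> bounded (set_reg s r v).
Proof. by move=> hv [hr ht]; split=> //= r'; rewrite /upd; case: eqP. Qed.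

Lemma exec_bounded c s : bounded s -> bounded (exec w D c s).
Proof.
elim: c s => [r a|r r1|o r r1 r2|r t x z|t x z r||c1 IH1 c2 IH2|i b c IH] s bs.
- by apply: set_reg_bounded => //; rewrite ltn_pmod ?expn_gt0.
- by apply: set_reg_bounded => //; case: bs.
- by apply: set_reg_bounded => //; apply: eval_binop_lt.
- by case: bs => hr ht; split=> // r'; rewrite /exec /= /upd; case: eqP.
- by case: bs => hr ht; split=> // t' x' z'; rewrite /exec /= /upd3; case: ifP.
- by [].
- by apply: IH2; apply: IH1.
- have bm : areg s b < 2 ^ w by case: bs.
  apply: set_reg_bounded => //.
  have : areg s b <= areg s b by [].
  elim: {-2}(areg s b) => //= k IHk kb; apply: IH; apply: set_reg_bounded; last by apply: IHk; apply: ltnW.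
  exact: ltn_trans bm.
Qed.
End Bounded.

Section Entry.
Variables (w n L k : nat) (pi : 'S_n).
Local Notation y := (pvalue pi).
Local Notation D := n.+1.
Local Notation exec := (exec w D).
Local Notation env := (env n L y).
Hypothesis room : ntables * D * D <= 2 ^ w.
Hypothesis n_lt : n < 2 ^ L.

Lemma y_lt r : r < n -> y r < n.
Proof. by move=> rn; rewrite -[r]/(val (Ordinal rn)) pvalueE. Qed.

Local Open Scope ring_scope.
Variable R : comNzRingType.
Hypothesis word_zero : (2 ^ w)%N%:R = 0 :> R.

Variables (tau : seq nat) (t : tree).
Hypothesis tau_perm : perm_eq tau (iota 0 k).
Hypothesis tok : tree_ok k t.
Local Notation absorb := (absorb n tau y t).
Local Notation supported := (supported tau y t).
Local Notation total := (total n tau y t).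
Implicit Type A : nat -> nat -> nat -> R.

Lemma bag_label_lt i : (i < size t)%N -> ((bag_of t i).1 < k)%N && ((bag_of t i).2 < k)%N.
Proof.
move=> it; have := bag_of_labels it; case/and3P: tok => pl _ _.
by rewrite !(perm_mem pl) !mem_iota.
Qed.

Lemma tau_inj : {in (fun l => l < k)%N &, forall l l', (nth 0%N tau l == nth 0%N tau l') = (l == l')}.
Proof.
move=> l l' lk lk'; have sz : size tau = k by rewrite (perm_size tau_perm) size_iota.
by rewrite nth_uniq ?sz // (perm_uniq tau_perm) iota_uniq.
Qed.

Lemma parent_lt i : (0 < i < size t)%N -> (parent t i < i)%N.
Proof.
case/andP=> i0 it; case/and3P: tok => _ _ /allP/(_ i).
by rewrite mem_iota it => /(_ isT); rewrite (gtn_eqF i0).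
Qed.

Definition tables m A s := forall j, (j < m)%N -> holds n (bag_table j) (A j) s.

Lemma aggP A i s : (0 < i < size t)%N -> env s -> supported A -> tables i.+1 A s ->
  let s' := exec (agg_cmd tau t i) s in env s' /\ tables i (absorb A i) s'.
Proof.
move=> hi es supp hA; have /andP[i0 it] := hi; have pi_lt := parent_lt hi.
set b := bag_of t i; set c := bag_of t (parent t i).
rewrite /agg_cmd -/b -/c exec_cseq exec_cat.
have [es1 z1] := clearP room es (t := 4%N) isT.
have F1 t' x z : (4 < t')%N -> tab (exec (clear 4) s) t' x z = tab s t' x z.
  by move=> ht; rewrite exec_stores //=; lia.
move: (exec (clear 4) s) es1 z1 F1 => s1 es1 z1 F1.
have hs1 : holds n (bag_table i) (A i) s1.
  by move=> p r pn rn; rewrite F1 ?hA // /bag_table; lia.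
have hsrc : (4 < bag_table i)%N by rewrite /bag_table; lia.
have := quadsP room y_lt word_zero (corners tau b c) n_lt hsrc es1 hs1.
have F2 t' x z : (4 < t')%N ->
    tab (exec (cseq [seq quad_cmd (bag_table i) kk | kk <- corners tau b c]) s1) t' x z = tab s1 t' x z.
  move=> ht; rewrite exec_stores // stores_cseq has_map; apply: hasN => kk /=; lia.
move: (exec _ s1) F2 => s2 F2 [es2 h2].
have hdst : (4 < bag_table (parent t i))%N by rewrite /bag_table; lia.
have [es3 h3] := multP room word_zero es2 hdst.
rewrite exec_cseq exec_nil; split=> // j ji p r pn rn.
have E : (tab s2 (bag_table j) p r)%:R = A j p r.
  by rewrite F2 ?F1 ?hA ?(ltnW ji) // /bag_table; lia.
rewrite /absorb; case: (eqVneq j (parent t i)) => [ej|nj]; last first.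
  by rewrite exec_stores // /= orbF /bag_table; move: nj; lia.
have Z : (tab s1 4 p r)%:R = 0 :> R by rewrite z1 // ltnW.
have := h3 p r pn rn; rewrite -ej => ->; rewrite E (h2 p r pn rn) Z add0r.
(* Off the support of the parent's table the accumulated value need not be the aggregate, but there
   it is multiplied by 0. *)
have [cok|ncok] := boolP (bag_ok tau y c p r); last first.
  by rewrite supp ?mul0r ?mul0r // ej //; apply: ltn_trans it.
congr (_ * _); rewrite /aggregate -/b -/c; symmetry; apply: corners_sum => //; first exact: y_lt.
  move=> l l' lb lc.
  have lb' : l \in bag_labels b.
    have /andP[b1 b2] := mem_bag_labels b.
    by move: lb; rewrite !inE => /orP[] /eqP->.
  have lc' : l' \in bag_labels c.
    have /andP[b1 b2] := mem_bag_labels c.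
    by move: lc; rewrite !inE => /orP[] /eqP->.
  have ne : l != l'.
    apply: contraTneq lb' => ->; apply: (@label_disjoint t _ (parent t i)) => //.
    by exists k.
  have /andP[b1 b2] := bag_label_lt it; have /andP[c1 c2] := bag_label_lt (ltn_trans pi_lt it).
  have lk : (l < k)%N by move: lb; rewrite !inE => /orP[] /eqP->.
  have lk' : (l' < k)%N by move: lc; rewrite !inE => /orP[] /eqP->.
  by rewrite ne tau_inj.
have /andP[c1 c2] := bag_label_lt (ltn_trans pi_lt it).
by rewrite tau_inj.
Qed.

Lemma elimP m A s : (m < size t)%N -> env s -> supported A -> tables m.+1 A s ->
  let s' := exec (cseq [seq agg_cmd tau t i | i <- rev (iota 1 m)]) s in
  env s' /\ exists A', [/\ supported A', tables 1 A' s' & total A' 1 = total A m.+1].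
Proof.
elim: m A s => [|m IH] A s mt es supp hA; first by split=> //; exists A.
rewrite -[m.+1]addn1 iotaD rev_cat /= exec_cseq.
have hi : (0 < m.+1 < size t)%N by [].
rewrite add1n; have [es1 h1] := aggP hi es supp hA.
have [es2 [A' [supp' hA' tot]]] := IH _ _ (ltnW mt) es1 (@absorb_supported R n tau y t A m.+1 supp) h1.
split=> //; exists A'; split=> //; rewrite tot addn1.
by symmetry; apply: total_step => //; exists k.
Qed.

Lemma initsP m s : env s -> let s' := exec (cseq [seq init_cmd tau t i | i <- iota 0 m]) s in
  env s' /\ tables m (base_table R tau y t) s'.
Proof.
move=> es; elim: m => [|m [es1 h1]]; first by split.
rewrite -[m.+1]addn1 iotaD map_cat exec_cat /= exec_cseq exec_nil add0n.
have [es2 h2] := initP room R tau t m es1; split=> // j; rewrite addn1 ltnS leq_eqVlt.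
case/orP=> [/eqP->|jm] p q pn qn; first exact: h2.
rewrite exec_stores; first exact: h1.
by apply: init_stores; rewrite /bag_table; lia.
Qed.

(** Equality holds in [R] only, that is up to multiples of [2 ^ w]; exactness is recovered when the
    counts are output. *)
Definition known s (p : seq nat) :=
  (areg s (count_reg p))%:R = (pattern_count_seq k pi p)%:R :> R.

Lemma subsP l s : env s -> bounded w s -> (forall p, p \in l -> known s p) ->
  let s' := exec (cseq [seq CBin OpSub 19 19 (count_reg p) | p <- l]) s in
  [/\ env s', bounded w s', forall r, r != 19%N -> areg s' r = areg s r &
      (areg s' 19)%:R = (areg s 19)%:R - (\sum_(p <- l) pattern_count_seq k pi p)%N%:R :> R].
Proof.
elim: l s => [|p l IH] s es bs kn; first by split=> //; rewrite big_nil subr0.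
rewrite /= exec_cseq; set c := CBin _ _ _ _.
have es1 : env (exec c s).
  by apply: (env_same (c := c) _ (exec_same _ _ _ _) _ es) => //; case: es.
have bs1 := exec_bounded D c bs.
have fr r : r != 19%N -> areg (exec c s) r = areg s r.
  by move=> hr; rewrite exec_frame //= eq_sym.
have c19 : (areg (exec c s) 19)%:R = (areg s 19)%:R - (pattern_count_seq k pi p)%:R :> R.
  rewrite /exec /= /upd /= natr_sub // ?kn ?mem_head //.
  by case: bs => h _; apply: ltnW.
have [|es2 bs2 fr2 h2] := IH _ es1 bs1.
  by move=> q ql; rewrite /known fr ?kn // inE ql orbT.
split=> //; first by move=> r hr; rewrite fr2 // fr.
by rewrite h2 c19 big_cons natrD; ring.
Qed.

Lemma count_reg_inj : injective count_reg.
Proof. by move=> p q /addnI/(pcan_inj pickleK). Qed.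

Lemma entryP s : (0 < k)%N -> separated k tau t -> tau \in patterns k tau t ->
  env s -> bounded w s -> (forall p, p \in rem tau (patterns k tau t) -> known s p) ->
  let s' := exec (entry_cmd k (tau, t)) s in
  [/\ env s', bounded w s', known s' tau & forall p, p != tau -> areg s' (count_reg p) = areg s (count_reg p)].
Proof.
move=> k0 sep tin es bs kn.
have res p : reserved (count_reg p) by rewrite /reserved /count_reg; lia.
have t0 : (0 < size t)%N.
  by case/and3P: tok; case: (t) => //= pl; move: (perm_size pl) k0; rewrite size_iota /= => <-.
rewrite /entry_cmd exec_cat.
have [es1 h1] := initsP (size t) es.
have F1 p : areg (exec (cseq [seq init_cmd tau t i | i <- iota 0 (size t)]) s) (count_reg p) = areg s (count_reg p).
  by rewrite exec_frame // writes_cseq has_map; apply: hasN => i; exact: init_writes.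
have bs1 := exec_bounded D (cseq [seq init_cmd tau t i | i <- iota 0 (size t)]) bs.
move: (exec (cseq _) s) es1 h1 F1 bs1 => s1 es1 h1 F1 bs1.
rewrite exec_cat.
have lt : ((size t).-1 < size t)%N by rewrite prednK.
rewrite -{1}(prednK t0) in h1.
have [es2 [A' [suppA h2 tot]]] := elimP lt es1 (@base_supported R tau y t) h1.
have F2 p : areg (exec (cseq [seq agg_cmd tau t i | i <- rev (iota 1 (size t).-1)]) s1) (count_reg p) = areg s1 (count_reg p).
  by rewrite exec_frame // writes_cseq has_map; apply: hasN => i; exact: agg_writes.
have bs2 := exec_bounded D (cseq [seq agg_cmd tau t i | i <- rev (iota 1 (size t).-1)]) bs1.
move: (exec (cseq _) s1) es2 h2 F2 bs2 => s2 es2 h2 F2 bs2.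
rewrite exec_cseq.
have [es3 h3] := totalP word_zero es2.
have F3 p : areg (exec total_cmd s2) (count_reg p) = areg s2 (count_reg p).
  by rewrite exec_frame // total_writes.
have bs3 := exec_bounded D total_cmd bs2.
move: (exec total_cmd s2) es3 h3 F3 bs3 => s3 es3 h3 F3 bs3.
have {h3}h3 : (areg s3 19)%:R = (\sum_(p <- patterns k tau t) pattern_count_seq k pi p)%N%:R :> R.
  (* Elimination preserves the total, so the root sum is the total of the base tables, which is the
     relaxed count. *)
  rewrite h3 -respects_count // -total_base // -[in RHS](prednK t0) -tot total_root //.
  by apply: eq_bigr => p _; apply: eq_bigr => q _; apply: (h2 0%N).
rewrite exec_cat.
have [|es4 bs4 F4 h4] := subsP (l := rem tau (patterns k tau t)) es3 bs3.
  by move=> p hp; rewrite /known F3 F2 F1; apply: kn.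
move: (exec (cseq _) s3) es4 bs4 F4 h4 => s4 es4 bs4 F4 h4.
rewrite exec_cseq exec_nil; set c := CMove _ _; split.
- by apply: (env_same (c := c) _ (exec_same _ _ _ _) _ es4) => //; case: es4.
- exact: exec_bounded.
(* Removing one occurrence of [tau] from the list leaves precisely the counts that were
   subtracted. *)
- rewrite /known /exec /= /upd eqxx h4 h3 (perm_big _ (perm_to_rem tin)) big_cons natrD; ring.
move=> p pt; rewrite exec_frame /=; last by rewrite (inj_eq count_reg_inj) eq_sym.
by rewrite F4 ?F3 ?F2 ?F1 // /count_reg; lia.
Qed.
End Entry.

(** * The whole algorithm *)

(** Keys may collide: it is enough that a retrieved permutation was either just inserted or already
    stored, since [solved] compares the permutation itself. *)
Lemma tget_tset p q s t u : tget p (tset q s t) = Some u -> u = s \/ tget p t = Some u.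
Proof.
have leaf r : tget r Leaf = None by case: r.
elim: q p t => [q IH|q IH|] [p|p|] [|o l r] /= H;
  first [by right | by left; case: H | by rewrite leaf in H
        | by case: (IH _ _ H) => [|h]; [left | right; rewrite // leaf in h]].
Qed.

Definition main_cmd k es := cseq [seq entry_cmd k e | e <- es].

Section Main.
Variables (w n L k : nat) (pi : 'S_n).
Hypothesis room : ntables * n.+1 * n.+1 <= 2 ^ w.
Hypothesis n_lt : n < 2 ^ L.
Hypothesis k0 : 0 < k.
Local Open Scope ring_scope.
Variable R : comNzRingType.
Hypothesis word_zero : (2 ^ w)%N%:R = 0 :> R.

(** The invariant is that every permutation stored in the trie has its count in its register; the
    final test of [triangular] then covers all permutations. *)
Lemma mainP st es s : triangular k st es -> env n L (pvalue pi) s -> bounded w s ->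
  (forall q p, tget q st = Some p -> known k pi R s p) ->
  let s' := exec w n.+1 (main_cmd k es) s in
  [/\ ok s', bounded w s' & forall p, perm_eq p (iota 0 k) -> known k pi R s' p].
Proof.
elim: es st s => [|[tau t] es IH] st s.
  move=> /= /allP h e b kn; split=> //; first by case: e.
  move=> p pp; have := h p; rewrite mem_lext ?iota_uniq //= => /(_ isT).
  by rewrite /solved; case E : (tget _ _) => [q|] // /eqP qp; rewrite -qp; apply: kn E.
rewrite [triangular _ _ _]/= => /andP[/and5P[tp tok sep tin /allP hs] hc] e b kn.
rewrite /main_cmd [map _ _]/= exec_cseq.
have [|e1 b1 k1 F1] := entryP room n_lt word_zero tp tok k0 sep tin e b.
  move=> p /hs; rewrite /solved; case E : (tget _ _) => [q|] // /eqP qp.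
  by rewrite -qp; apply: kn E.
apply: (IH _ _ hc e1 b1) => q p /tget_tset[->|h]; first exact: k1.
have [->|pt] := eqVneq p tau; first exact: k1.
by rewrite /known F1 //; apply: kn h.
Qed.
End Main.

(** * Bit length of the input size and initialisation *)

Definition bit_count n := \sum_(j < n) (0 < n %/ 2 ^ j).

Lemma sum_le_nat m T : \sum_(j < m) (j <= T) = minn m T.+1.
Proof. by elim: m => [|m IH]; [rewrite big_ord0 | rewrite big_ord_recr IH /=; lia]. Qed.

(** For positive [n], [trunc_log 2 n < 2 ^ trunc_log 2 n <= n], so the shifts by [j < n] already
    reach every bit of [n]. *)
Lemma bit_countE n : bit_count n = (0 < n) * (trunc_log 2 n).+1.
Proof.
rewrite /bit_count; case: (posnP n) => [->|n0]; first by rewrite big_ord0.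
have [lo hi] := andP (trunc_log_bounds (isT : 1 < 2) n0).
transitivity (\sum_(j < n) (j <= trunc_log 2 n)).
  apply: eq_bigr => j _; congr nat_of_bool; rewrite divn_gt0 ?expn_gt0 //.
  by apply/idP/idP => h; [rewrite -ltnS -(ltn_exp2l _ _ (isT : 1 < 2)) (leq_ltn_trans h)
                         | rewrite (leq_trans _ lo) // leq_exp2l].
rewrite sum_le_nat mul1n; apply/minn_idPr; apply: leq_trans lo; exact: ltn_expl.
Qed.

Lemma bit_count_lt n : n < 2 ^ bit_count n.
Proof.
rewrite bit_countE; case: (posnP n) => [->//|n0]; rewrite mul1n.
by case/andP: (trunc_log_bounds (isT : 1 < 2) n0).
Qed.

(** The input is row 0 of table 0, because [addr D 0 0 r = r], and is shifted there in place. The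
    bit length is found by counting the nonzero shifts of [n]. *)
Definition prelude_cmd := cseq [:: CConst 21 2;
  CFor 9 0 (cseq [:: CBin OpShr 11 0 9; CBin OpLt 11 18 11; CBin OpAdd 4 4 11]);
  CFor 9 0 (cseq [:: CLoad 11 0 18 9; CBin OpSub 11 11 3; CStore 0 18 9 11])].

Lemma preludeP w n (y : nat -> nat) s : ntables * n.+1 * n.+1 <= 2 ^ w ->
  ok s -> areg s 0 = n -> areg s 2 = n.+1 -> areg s 3 = 1 -> areg s 4 = 0 -> areg s 18 = 0 ->
  (forall r, r < n -> tab s 0 0 r = (y r).+1 /\ y r < n) ->
  env n (bit_count n) y (exec w n.+1 prelude_cmd s).
Proof.
move=> room oks r0 r2 r3 r4 r18 hy.
have sm x : x <= n.+1 -> x %% 2 ^ w = x by apply: small.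
have w1 : 1 < 2 ^ w by apply: leq_ltn_trans (D_lt room).
rewrite /prelude_cmd 3!exec_cseq exec_nil.
set s1 := exec _ _ (CConst 21 2) s.
have f1 r : r != 21 -> areg s1 r = areg s r by move=> h; rewrite exec_frame //= eq_sym.
have t1 t x z : tab s1 t x z = tab s t x z by [].
have r21 : areg s1 21 = 2.
  by rewrite /s1 /exec /= /upd /= modn_small //; apply: leq_trans room; rewrite /ntables; nia.
have ok1 : ok s1 by [].
clearbody s1.
pose P k s' := ok s' /\ areg s' 4 = \sum_(j < k) (0 < n %/ 2 ^ j).
have : P (areg s1 0) (exec w n.+1 (CFor 9 0 (cseq [:: CBin OpShr 11 0 9; CBin OpLt 11 18 11; CBin OpAdd 4 4 11])) s1).
  apply: for_ind => //; first by split; rewrite ?f1 // big_ord0.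
  move=> k s'; rewrite f1 // r0 => kn k9 [fr _] [ok' h].
  have e0 : areg s' 0 = n by rewrite fr // f1.
  have e18 : areg s' 18 = 0 by rewrite fr // f1.
  rewrite 3!exec_cseq exec_nil (@exec_bin _ _ _ 11 0 9 _ n k (n %/ 2 ^ k)) //; last first.
    by apply: sm; apply: leqW; apply: leq_div.
  rewrite (@exec_bin _ _ _ 11 18 11 _ 0 (n %/ 2 ^ k) (0 < n %/ 2 ^ k)) //; last first.
    by rewrite /eval_binop modn_small //; case: (0 < n %/ _) => //; apply: ltnW.
  rewrite (@exec_bin _ _ _ 4 4 11 _ (areg s' 4) (0 < n %/ 2 ^ k) (areg s' 4 + (0 < n %/ 2 ^ k))) //; last first.
    apply: sm; have -> : areg s' 4 + (0 < n %/ 2 ^ k) = \sum_(j < k.+1) (0 < n %/ 2 ^ j).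
      by rewrite big_ord_recr h.
    rewrite (leq_trans (_ : _ <= \sum_(j < k.+1) 1)) //; last by rewrite sum1_card card_ord; lia.
    by apply: leq_sum => j _; case: (0 < _).
  by split=> //=; rewrite /upd /= big_ord_recr h.
rewrite f1 // r0 => -[ok2 h4].
set c := CFor _ _ _ in ok2 h4 *; set s2 := exec _ _ c s1 in ok2 h4 *.
have f2 r : ~~ writes c r -> areg s2 r = areg s1 r by apply: exec_frame.
have t2 t x z : tab s2 t x z = tab s t x z by rewrite exec_stores // t1.
have g r : r \in [:: 0; 2; 3; 18] -> areg s2 r = areg s r.
  by rewrite !inE => /or4P[] /eqP->; rewrite f2 ?f1.
have g21 : areg s2 21 = 2 by rewrite f2.
clearbody s2.
pose Q k s' := ok s' /\ forall r, r < n -> tab s' 0 0 r = if r < k then y r else (y r).+1.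
set c2 := CFor _ _ _.
have : Q (areg s2 0) (exec w n.+1 c2 s2).
  apply: for_ind => //.
    by split=> // r rn; rewrite t2 ltn0; case: (hy r rn).
  move=> k s'; rewrite g // r0 => kn k9 [fr _] [ok' h].
  have e18 : areg s' 18 = 0 by rewrite fr // g.
  have e3 : areg s' 3 = 1 by rewrite fr // g.
  have [_ yk] := hy k kn.
  have kD : k < n.+1 by apply: ltnW.
  rewrite 3!exec_cseq exec_nil (@exec_load _ _ 11 0 18 9 _ 0 k (y k).+1) //; last by rewrite h // ltnn.
  rewrite (@exec_bin _ _ _ 11 11 3 _ (y k).+1 1 (y k)) //; last first.
    (* Wraparound subtraction of 1 from [(y k).+1], before reduction. *)
    rewrite /eval_binop (_ : _ + _ = y k + 2 ^ w); last by lia.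
    by rewrite modnDr sm //; lia.
  rewrite (@exec_store _ _ 0 18 9 11 _ 0 k (y k)) //; split=> // r rn /=.
  rewrite /upd3 /= ltnS leq_eqVlt; case: (eqVneq r k) => [->|_] //=; exact: h.
rewrite g // r0 => -[ok3 h3].
have f3 r : ~~ writes c2 r -> areg (exec w n.+1 c2 s2) r = areg s2 r by apply: exec_frame.
by split=> //; rewrite ?f3 //; try (by rewrite g); move=> r rn; rewrite h3 // rn.
Qed.

(** * Running time and well-formedness from the syntax *)

Fixpoint nest d l (c : cmd) : bool :=
  match c with
  | CSeq c1 c2 => nest d l c1 && nest d l c2
  | CFor _ b c1 =>
      if b == 4 then if l is l'.+1 then nest d l' c1 else false
      else ((b == 0) || (b == 2)) && if d is d'.+1 then nest d' l c1 else false
  | _ => true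
  end.

Fixpoint csize (c : cmd) : nat :=
  match c with
  | CSeq c1 c2 => csize c1 + csize c2
  | CFor _ _ c1 => csize c1 + 8
  | _ => 6
  end.

(** [N] bounds registers 0 and 2, and [K] bounds register 4, the bit length. The 8 per loop in
    [csize] absorbs the overhead of 5 per iteration and 3 per loop, as [N ^ d * K ^ l] is
    positive. *)
Lemma cost_nest v N K d l c : 0 < N -> 0 < K -> v 0 <= N -> v 2 <= N -> v 4 <= K ->
  nest d l c -> cost v c <= csize c * (N ^ d * K ^ l).
Proof.
move=> N0 K0 v0 v2 v4; elim: c d l => [r a|r r1|o r r1 r2|r t x z|t x z r||c1 IH1 c2 IH2|i b c IH] d l /=;
  try by (move=> _; have : 0 < N ^ d * K ^ l by rewrite muln_gt0 !expn_gt0 N0 K0); try lia.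
- by case/andP=> n1 n2; rewrite mulnDl leq_add ?IH1 ?IH2.
case: eqP => [->|_].
  case: l => // l /IH; rewrite expnS; have : 0 < N ^ d * K ^ l by rewrite muln_gt0 !expn_gt0 N0 K0.
  by move: (cost v c) (csize c) => C S; nia.
case/andP=> hb; case: d => // d /IH; rewrite expnS.
have : 0 < N ^ d * K ^ l by rewrite muln_gt0 !expn_gt0 N0 K0.
have : v b <= N by case/orP: hb => /eqP->.
by move: (cost v c) (csize c) => C S; nia.
Qed.

Lemma nest_bounds d l c b : nest d l c -> b \in bounds c -> b \in [:: 0; 2; 4].
Proof.
elim: c d l => //= [c1 IH1 c2 IH2|i b' c IH] d l.
  by case/andP=> n1 n2; rewrite mem_cat => /orP[]; [apply: IH1 n1 | apply: IH2 n2].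
rewrite inE; case: (b' =P 4) => [->|_].
  by case: l => // l /IH h /orP[/eqP->|].
by case/andP=> hb; case: d => // d /IH h /orP[/eqP->|//]; case/orP: hb => /eqP->.
Qed.

Lemma nest_cseq d l s : nest d l (cseq s) = all (nest d l) s.
Proof. by elim: s => //= c s <-. Qed.

Lemma wf_cseq s : wf (cseq s) = all wf s.
Proof. by elim: s => //= c s <-. Qed.

Lemma all_map_true (S T : Type) (f : S -> T) (P : pred T) s : (forall x, P (f x)) -> all P (map f s).
Proof. by move=> h; elim: s => //= x s ->; rewrite h. Qed.

Lemma init_nest tau t i : nest 2 4 (init_cmd tau t i).
Proof. by rewrite /init_cmd /less_cmd; case: ifP => // _; case: ifP => // _; case: ifP. Qed.

Lemma agg_nest tau t i : nest 2 4 (agg_cmd tau t i).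
Proof.
rewrite /agg_cmd; move: (corners _ _ _) => ks.
by rewrite nest_cseq /= all_cat /= andbT all_map_true.
Qed.

Lemma entry_nest k e : nest 2 4 (entry_cmd k e).
Proof.
case: e => tau t; rewrite /entry_cmd nest_cseq all_cat; apply/andP; split.
  by apply: all_map_true => i; apply: init_nest.
rewrite all_cat; apply/andP; split; first by apply: all_map_true => i; apply: agg_nest.
by rewrite -cat1s !all_cat /= andbT; apply: all_map_true.
Qed.

Lemma main_nest k es : nest 2 4 (main_cmd k es).
Proof. by rewrite /main_cmd nest_cseq all_map_true //; apply: entry_nest. Qed.

Lemma init_wf tau t i : i < 11 -> wf (init_cmd tau t i).
Proof.
have h : i < 11 -> bag_table i < ntables by rewrite /bag_table /ntables; lia.
by move/h=> {}h; rewrite /init_cmd /less_cmd; case: ifP => _;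
  [|case: ifP => _; case: ifP => _]; rewrite /= h.
Qed.

Lemma quad_wf src k : src < ntables -> wf (quad_cmd src k).
Proof.
move=> h; rewrite /= h /= /usable /thr_base /thr_off.
by case: k => -[[? []] [? []]] [[? []] [? []]] /=.
Qed.

Lemma agg_wf tau t i : i < 11 -> parent t i < 11 -> wf (agg_cmd tau t i).
Proof.
have h j : j < 11 -> bag_table j < ntables by rewrite /bag_table /ntables; lia.
move=> hi hp; rewrite /agg_cmd; move: (corners _ _ _) => ks.
rewrite wf_cseq /= all_cat /= !(h _ hp) /= !andbT.
by apply: all_map_true => k; apply: quad_wf; apply: h.
Qed.

Lemma entry_wf k e : k <= 7 -> tree_ok k e.2 -> wf (entry_cmd k e).
Proof.
case: e => tau t /= k7 tok; have szt : size t <= 7.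
  (* Every bag owns at least one label, so there are at most seven bags and the available tables
     suffice. *)
  case/and3P: tok => /perm_size + _ _; rewrite size_iota => sz; apply: leq_trans k7; rewrite -sz.
  rewrite /tree_labels size_flatten /shape -map_comp sumnE big_map.
  rewrite -sum1_size; apply: leq_sum => b _ /=; by rewrite /bag_labels; case: ifP.
have par i : 0 < i < size t -> parent t i < i.
  case/andP=> i0 it; case/and3P: tok => _ _ /allP/(_ i).
  by rewrite mem_iota it => /(_ isT); rewrite (gtn_eqF i0).
rewrite wf_cseq all_cat; apply/andP; split.
  by rewrite all_map; apply/allP => i; rewrite mem_iota => hi /=; apply: init_wf; lia.
rewrite all_cat; apply/andP; split.
  rewrite all_map; apply/allP => i; rewrite mem_rev mem_iota => hi; apply: agg_wf; first by lia.
  have := par i; lia.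
by rewrite -cat1s !all_cat; apply/and3P; split=> //; apply: all_map_true.
Qed.

Lemma entry_writes k e r : r \in [:: 0; 2; 4] -> ~~ writes (entry_cmd k e) r.
Proof.
case: e => tau t hr; have res : reserved r by move: hr; rewrite !inE => /or3P[] /eqP->.
rewrite /entry_cmd writes_cseq has_cat negb_or; apply/andP; split.
  by rewrite has_map; apply: hasN => i; apply: init_writes.
rewrite has_cat negb_or; apply/andP; split.
  by rewrite has_map; apply: hasN => i; apply: agg_writes.
rewrite -cat1s has_cat has_seq1; apply/norP; split; first exact: total_writes.
rewrite has_cat has_seq1; apply/norP; split.
  by rewrite has_map; apply: hasN => p /=; move: hr; rewrite !inE; lia.
by move: hr; rewrite !inE => /or3P[] /eqP->.
Qed.

Lemma main_writes k es r : r \in [:: 0; 2; 4] -> ~~ writes (main_cmd k es) r.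
Proof. by move=> hr; rewrite writes_cseq has_map; apply: hasN => e; apply: entry_writes. Qed.

Lemma main_wf k st es : k <= 7 -> triangular k st es -> wf (main_cmd k es).
Proof.
move=> k7; elim: es st => // e es IH st; rewrite [triangular _ _ _]/=.
case: e => tau t /andP[/and5P[_ tok _ _ _] /IH h].
rewrite -[wf _]/(wf (entry_cmd k (tau, t)) && wf (main_cmd k es)) h andbT.
exact: (@entry_wf k (tau, t)).
Qed.

(** * Writing the answer to memory *)

Fixpoint output_code j (l : seq nat) : program :=
  if l is r :: l' then [:: Const 1 j, StoreM 1 r & output_code j.+1 l'] else [::].

Lemma size_output_code j l : size (output_code j l) = (size l).*2.
Proof. by elim: l j => //= r l IH j; rewrite IH. Qed.

(** The output overwrites the input and the tables, which is harmless because the counts sit in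
    registers and only the scratch register changes. *)
Lemma output_runs w p sp l j base R M : code_at p base (output_code j l) ->
  j + size l <= sp -> sp <= 2 ^ w -> all usable l ->
  exists R' M', [/\ runs w p sp (State base R M) (size l).*2 (State (base + (size l).*2) R' M'),
    forall i, i < size l -> M' (j + i) = R (nth 0 l i) & forall a, a < j -> M' a = M a].
Proof.
elim: l j base R M => [|r l IH] j base R M /=.
  by move=> _ _ _ _; exists R, M; split=> //; rewrite addn0; apply: runs0.
move=> /code_at_cons[e0 /code_at_cons[e1 cd]] hj hw /andP[ur ul].
have jw : j %% 2 ^ w = j by rewrite modn_small //; lia.
have [|R' [M' [hr hM hM']]] := IH j.+1 base.+2 (upd R 1 j) (upd M j (R r)) cd _ hw ul.
  by rewrite addSnnS.
exists R', M'; split.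
- rewrite doubleS; apply: runs_step; first by rewrite /touched /fetch /= e0.
  rewrite /step /fetch /= e0 jw; apply: runs_step.
    by rewrite /touched /fetch /= e1 /upd /=; lia.
  have Er : upd R 1 j r = R r by rewrite /upd (negPf ur).
  by rewrite /step /fetch /= e1 Er -[upd R 1 j 1]/j !addnS -!addSn.
- case=> [|i] hi; first by rewrite addn0 hM' // /upd eqxx.
  rewrite -addSnnS hM //= /upd; case: eqP => // e; move: (all_nthP 0 ul i hi).
  by rewrite /usable e.
- by move=> a aj; rewrite hM' 1?ltnW // /upd; case: eqP => // e; rewrite e ltnn in aj.
Qed.

(** Raw instructions, since well-formed commands may not write register 2. *)
Definition startup : program := [:: Const 3 1; Binop OpAdd 2 0 3].
Definition count_regs k := [seq count_reg (one_line tau) | tau <- enum {: 'S_k}].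

Definition profile_program k es : program :=
  startup ++ compile 2 prelude_cmd ++ compile (2 + len prelude_cmd) (main_cmd k es) ++
  output_code 0 (count_regs k).

Definition loop_bound n b := if b == 4 then bit_count n else n.+1.
Definition profile_time k es n :=
  2 + (cost (loop_bound n) prelude_cmd + (cost (loop_bound n) (main_cmd k es) + #|{: 'S_k}|.*2)).
Definition profile_space k n := ntables * n.+1 * n.+1 + #|{: 'S_k}|.

(** * Word size and correctness of the complete program *)

Lemma word_room n (u := 2 ^ (trunc_log 2 n).+1) :
  [/\ 2 ^ word_size 16 n = u ^ 16, n < u & 1 < u].
Proof.
split; last by rewrite -[1]/(2 ^ 0) ltn_exp2l.
  by rewrite /word_size mulnC expnM.
exact: trunc_log_ltn.
Qed.

(** For [n <= 1] a word has just 16 bits and 7! alone takes 13 of them, so small inputs are the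
    critical case for the factor 16. *)
Lemma space_fits k n : k <= 7 -> profile_space k n <= 2 ^ word_size 16 n.
Proof.
move=> k7; rewrite /profile_space /ntables card_Sn; have := leq_fact k7.
have [-> nu u1] := word_room n; move: (2 ^ _) nu u1 => u nu u1.
have u4 : 16 <= u ^ 4 by rewrite -[16]/(2 ^ 4) leq_exp2r.
have -> : u ^ 16 = u ^ 4 * u ^ 4 * u ^ 4 * (u ^ 2 * (u * u)) by rewrite (mulnn u) -!expnD.
have u2 : 4 <= u ^ 2 by rewrite -[4]/(2 ^ 2) leq_exp2r.
have -> : 7`! = 72 * 70 by [].
have V : 4096 <= u ^ 4 * u ^ 4 * u ^ 4 by nia.
have nn : n.+1 * n.+1 <= u * u by apply: leq_mul.
have uu : 4 <= u * u by rewrite -[4]/(2 * 2); apply: leq_mul.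
have := leq_mul V (leq_mul u2 (leqnn (u * u))).
rewrite -(mulnA 16); move: (u ^ 4 * _ * _ * _) => Z; move: (n.+1 * n.+1) (u * u) (k`!) nn uu => N U K nn uu h1 h2; lia.
Qed.

Lemma count_fits k n (pi : 'S_n) p : k <= 7 -> pattern_count_seq k pi p < 2 ^ word_size 16 n.
Proof.
move=> k7; apply: leq_ltn_trans (max_card _) _; rewrite card_ffun !card_ord.
have [-> nu u1] := word_room n; move: (2 ^ _) nu u1 => u nu u1.
apply: leq_ltn_trans (_ : u ^ k < _); last by rewrite ltn_exp2l //; lia.
by case: k {k7} => // k; rewrite leq_exp2r // ltnW.
Qed.

Lemma prelude_nest : nest 2 4 prelude_cmd. Proof. by []. Qed.

Lemma perm_vector_size n (pi : 'S_n) : size (perm_vector pi) = n.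
Proof. by rewrite size_map -cardE card_ord. Qed.

Lemma nth_perm_vector n (pi : 'S_n) r : r < n -> nth 0 (perm_vector pi) r = (pvalue pi r).+1.
Proof.
move=> rn; rewrite (nth_map (Ordinal rn)) ?size_enum_ord // -[r in nth _ _ r]/(val (Ordinal rn)).
by rewrite nth_ord_enum -[r in pvalue pi r]/(val (Ordinal rn)) pvalueE.
Qed.

Lemma perm_vector_le n (pi : 'S_n) r : nth 0 (perm_vector pi) r <= n.
Proof.
case: (ltnP r n) => rn; last by rewrite nth_default ?perm_vector_size.
by rewrite nth_perm_vector //; apply: y_lt.
Qed.

Theorem profile_computes k es n (pi : 'S_n) : 0 < k <= 7 -> triangular k Leaf es ->
  computes (word_size 16 n) (profile_program k es) (perm_vector pi) (profile k pi)
    (profile_time k es n) (profile_space k n).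
Proof.
case/andP=> k0 k7 chk; set w := word_size 16 n; set p := profile_program k es.
have fits := space_fits n k7; rewrite -/w in fits.
have room : ntables * n.+1 * n.+1 <= 2 ^ w by apply: leq_trans fits; rewrite /profile_space leq_addr.
have Dw := D_lt room.
set sp := profile_space k n in fits *.
have hsp : ntables * n.+1 * n.+1 <= sp by rewrite /sp /profile_space leq_addr.
have /code_at_cat[cd0 /code_at_cat[]] : code_at p 0 p by [].
rewrite size_compile -/startup => cd1 /code_at_cat[]; rewrite size_compile => cd2 cd3.
rewrite add0n in cd1 cd2 cd3.
have szp : size p = 2 + len prelude_cmd + len (main_cmd k es) + (size (count_regs k)).*2.
  by rewrite !size_cat !size_compile size_output_code !addnA.
clearbody p.
pose M0 := nth 0 (perm_vector pi).
pose R0 := upd (upd (upd (fun=> 0) 0 n) 3 1) 2 n.+1.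
(* The abstract tables are read off memory through [addr], so the memory clause of [sim] holds by
   definition. *)
pose s0 := AState R0 (fun t x z => M0 (addr n.+1 t x z)) true.
have run0 : runs w p sp (init_state (perm_vector pi)) 2 (State 2 R0 M0).
  have /code_at_cons[e0 /code_at_cons[e1 _]] := cd0.
  apply: runs_step; first by rewrite /touched /fetch /= e0.
  rewrite /step /fetch /= e0 perm_vector_size; apply: runs_step; first by rewrite /touched /fetch /= e1.
  rewrite /step /fetch /= e1 /eval_binop modn_small; last by apply: leq_ltn_trans Dw.
  have -> : upd (upd (fun=> 0) 0 n) 3 1 0 + upd (upd (fun=> 0) 0 n) 3 1 3 = n.+1 by rewrite /upd /= addn1.
  by rewrite modn_small //; apply: runs0.
have M0w a : M0 a < 2 ^ w by apply: leq_ltn_trans (perm_vector_le pi a) _; apply: ltnW.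
have R0w r : R0 r < 2 ^ w.
  rewrite /R0 /upd; case: eqP => // _; case: eqP => // _; first by apply: leq_ltn_trans Dw.
  by case: eqP => _; [apply: ltnW | apply: leq_ltn_trans Dw].
have sim0 : sim w n.+1 s0 R0 M0 by split=> *; rewrite ?R0w ?M0w.
have bd0 : bounded w s0 by split=> *; [apply: R0w | apply: M0w].
have envP : env n (bit_count n) (pvalue pi) (exec w n.+1 prelude_cmd s0).
  apply: preludeP => // r rn; split; last exact: y_lt.
  by rewrite /s0 [tab _ _ _ _]/= /M0 /addr !mul0n !add0n nth_perm_vector.
have bd1 : bounded w (exec w n.+1 prelude_cmd s0) by apply: exec_bounded.
have [|n1 [R1 [M1 [t1 run1 sim1]]]] :=
  @compile_ok w n.+1 p room (loop_bound n) sp prelude_cmd s0 2 R0 M0 hsp isT _ cd1 sim0 (env_ok envP).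
  by move=> b; rewrite !inE => /orP[] /eqP->.
set s1 := exec w n.+1 prelude_cmd s0 in envP bd1 sim1.
have w1 : 1 < 2 ^ w by apply: leq_ltn_trans Dw.
(* The type ['Z_(2 ^ w)] is the ring of integers modulo [2 ^ w] only because [2 ^ w > 1]. *)
have wz : ((2 ^ w)%N%:R = 0 :> 'Z_(2 ^ w))%R by apply: val_inj; rewrite /= val_Zp_nat // modnn.
have [|ok2 bd2 known2] := @mainP w n (bit_count n) k pi room (bit_count_lt n) k0 _ wz Leaf es s1 chk envP bd1.
  by case.
have [|n2 [R2 [M2 [t2 run2 sim2]]]] :=
  @compile_ok w n.+1 p room (loop_bound n) sp (main_cmd k es) s1 _ R1 M1 hsp (main_wf k7 chk) _ cd2 sim1 ok2.
  move=> b /(nest_bounds (main_nest k es)) hb; split; first exact: main_writes.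
  by move: hb; rewrite !inE => /or3P[] /eqP->; rewrite ?(env_n envP) ?(env_D envP) ?(env_L envP).
set s2 := exec w n.+1 (main_cmd k es) s1 in sim2 bd2 known2.
have szc : size (count_regs k) = #|{: 'S_k}| by rewrite size_map -cardE.
have [|||R3 [M3 [run3 out _]]] := @output_runs w p sp (count_regs k) 0 _ R2 M2 cd3.
- by rewrite add0n szc /sp /profile_space leq_addl.
- by [].
- by rewrite all_map; apply/allP.
exists (2 + (n1 + (n2 + (size (count_regs k)).*2))).
have [fin touch] := runs_trans run0 (runs_trans run1 (runs_trans run2 run3)).
split.
- by rewrite /profile_time szc !leq_add2l leq_add // leq_add2r.
- by rewrite fin /halted /fetch /= nth_default // szp.
- by apply/bigmax_leqP => i _; apply: touch.
rewrite fin /=; apply: (@eq_from_nth _ 0); rewrite size_mkseq // => i.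
have szo : size (profile k pi) = #|{: 'S_k}| by rewrite size_map -cardE.
rewrite szo => hi; rewrite nth_mkseq //.
rewrite -[i]add0n out ?szc //.
pose tau := nth (1%g : 'S_k) (enum {: 'S_k}) i.
have -> : nth 0 (count_regs k) i = count_reg (one_line tau).
  by rewrite (nth_map (1%g : 'S_k)) // -cardE.
have -> : nth 0 (profile k pi) i = pattern_count tau pi.
  by rewrite (nth_map (1%g : 'S_k)) // -cardE.
case: sim2 => -> // _ _ _ _.
(* Register and count agree modulo [2 ^ w] and are both below it, hence they are equal. *)
have := known2 _ (one_line_perm tau); rewrite /known pattern_count_one_line => /(congr1 val).
by rewrite /= !val_Zp_nat // (modn_small (proj1 bd2 _)) modn_small //; apply: count_fits.
Qed.

(** * Asymptotic bounds *)

Lemma log_bounds n : 1 < n ->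
  let T := trunc_log 2 n in [/\ 0 < T, n.+1 <= 2 * n & (bit_count n).+1 <= 3 * T].
Proof.
move=> n1 T; have T0 : 0 < T by rewrite trunc_log_gt0 n1.
split=> //; first by lia.
by rewrite bit_countE (ltnW n1) mul1n -/T; lia.
Qed.

Lemma profile_time_softO k es : soft_O (profile_time k es) (fun n => n ^ 2).
Proof.
set S := 2 + (csize prelude_cmd + (csize (main_cmd k es) + #|{: 'S_k}|.*2)).
(* The 4 is the square of the factor in [n.+1 <= 2 * n], and [3 ^ 4] comes from the bound on
   [bit_count]; starting at 2 keeps the logarithm positive. *)
exists (S * (4 * 3 ^ 4)), 4, 2 => n n1; have [T0 hn hT] := log_bounds n1.
set T := trunc_log 2 n in T0 hT *; set V := n.+1 ^ 2 * (bit_count n).+1 ^ 4.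
have cb c : nest 2 4 c -> cost (loop_bound n) c <= csize c * V.
  by apply: cost_nest => //; rewrite /loop_bound.
have c1 := cb _ prelude_nest; have c2 := cb _ (main_nest k es).
have V0 : 0 < V by rewrite muln_gt0 !expn_gt0.
have hV : V <= 4 * n ^ 2 * (3 ^ 4 * T ^ 4).
  by rewrite -[4 * n ^ 2]/(2 ^ 2 * n ^ 2) -!expnMn leq_mul // leq_exp2r.
apply: (@leq_trans (S * V)).
  have le x : x <= x * V by rewrite leq_pmulr.
  rewrite /profile_time /S; apply: leq_trans (leq_add (le _) (leq_add c1 (leq_add c2 (le _)))) _.
  by rewrite -!mulnDl.
apply: leq_trans (leq_mul (leqnn S) hV) _; apply: eq_leq; ring.
Qed.

Lemma profile_space_softO k : soft_O (profile_space k) (fun n => n ^ 2).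
Proof.
(* The space carries no logarithm, and [n.+1 <= 2 * n] from [n = 1] on gives the factor 4. *)
exists (ntables * 4 + #|{: 'S_k}|), 0, 1 => n n1; rewrite expn0 muln1 /profile_space mulnDl.
apply: leq_add; last by rewrite leq_pmulr // expn_gt0 n1.
by rewrite -!mulnA leq_mul2l /= -mulnn mulnn; nia.
Qed.

(** * Certificate data *)

(** Within each list the order is essential: an entry may subtract only patterns solved before
    it. *)
Definition cert1 : seq N := [::
  0x1000]%num.

Definition cert2 : seq N := [::
  0x10101]%num.

Definition cert3 : seq N := [::
  0x10121200; 0x10211200]%num.

Definition cert4 : seq N := [::
  0x101232301; 0x101322301; 0x102132301; 0x102312301; 0x103212301;
  0x110322301; 0x113022301]%num.

Definition cert5 : seq N := [::
  0x101234132400; 0x101243132400; 0x101324132400; 0x101342132400;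
  0x101432132400; 0x102143243301; 0x102314132400; 0x102341243301;
  0x102413132400; 0x102431142300; 0x103214132400; 0x103241142300;
  0x103412132400; 0x103421142300; 0x104231142300; 0x104321243301;
  0x110243243301; 0x110342243301; 0x110432243301; 0x112403132400;
  0x113402132204; 0x113042243301; 0x114203023314]%num.

Definition cert6 : seq N := [::
  0x1012345243501; 0x1012354243501; 0x1012435243501; 0x1012453243501;
  0x1012543243501; 0x1013245234501; 0x1013254234501; 0x1013425243501;
  0x1013452253401; 0x1013524243501; 0x1013542253401; 0x1014325243501;
  0x1014352253401; 0x1014523243501; 0x1014532253401; 0x1015342253401;
  0x1015432253401; 0x1021354234501; 0x1021435243501; 0x1021453253401;
  0x1021543253401; 0x1023154234501; 0x1023415243501; 0x1023451253401;
  0x1023514243501; 0x1023541253401; 0x1024351142305; 0x1024531142305;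
  0x1025341142305; 0x1025431142305; 0x1032154134502; 0x1034512142305;
  0x1034521142305; 0x1035412142305; 0x1035421142305; 0x1042315142305;
  0x1043215142305; 0x1043521142305; 0x1045312034512; 0x1045321034512;
  0x1053421142305; 0x1054321253401; 0x1102354243501; 0x1102453243501;
  0x1102543243501; 0x1103254234501; 0x1103452253401; 0x1103524243501;
  0x1103542253401; 0x1104352253401; 0x1104523243501; 0x1104532253401;
  0x1105342253401; 0x1105432253401; 0x1120453253401; 0x1120534243501;
  0x1120543253401; 0x1123504243501; 0x1134502142305; 0x1135402142305;
  0x1140253134502; 0x1145302034512; 0x1210543253401; 0x1215043142305;
  0x1240513142305; 0x1024135142503; 0x1024153142503; 0x1024315132504;
  0x1024513243501; 0x1025134142503; 0x1025143142503; 0x1025314132504;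
  0x1025413132504; 0x1032451234501; 0x1034251253401; 0x1043251132405;
  0x1043512142503; 0x1052341042315; 0x1052431352401; 0x1124053142503;
  0x1124503132504; 0x1125034142503; 0x1125043142503; 0x1125304132504;
  0x1125403034512; 0x1130524052314; 0x1130542351402; 0x1132504142305;
  0x1143502142503; 0x1145023142305; 0x1032514253401; 0x1032541142305;
  0x1034125234501; 0x1034152234501; 0x1034215243501; 0x1035142234501;
  0x1035214243501; 0x1042351253401; 0x1042513142503; 0x1045231132405;
  0x1053241253401; 0x1134052234501; 0x1135024142503; 0x1135042152403;
  0x1135204142503; 0x1140352034512; 0x1140523143502; 0x1140532241305;
  0x1142503034512; 0x1145032243501; 0x1145203134502; 0x1152304341502;
  0x1035241132405; 0x1042531241305; 0x1143052023514]%num.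

(** Seven labels need at least four bags; here paths occur besides the stars that serve for the
    shorter lengths. *)
Definition cert7 : seq N := [::
  0x2012345645361200; 0x2012346545361200; 0x2012354645361200;
  0x2012356445361200; 0x2012365445361200; 0x1012435625663401;
  0x2012436566352401; 0x2012453666452301; 0x2012456345361200;
  0x2012463546350211; 0x2012465345361200; 0x2012543666352401;
  0x2012546345361200; 0x2012563466352401; 0x2012564345361200;
  0x2012645345361200; 0x2012654345361200; 0x2013246556341200;
  0x2013254666452301; 0x2013256445361200; 0x2013265445361200;
  0x2013425666352401; 0x2013426566352401; 0x2013452646351200;
  0x2013456245361200; 0x2013462546351200; 0x2013465245361200;
  0x2013524666352401; 0x2013546234251600; 0x2013564234251600;
  0x2013624566352401; 0x2013645234251600; 0x2013654234251600;
  0x2014325666352401; 0x1014326524563301; 0x2014365244352601;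
  0x2014523666352401; 0x1014562325663401; 0x2014563234251600;
  0x1014652325663401; 0x2014653234251600; 0x1015342625663401;
  0x1015432625663401; 0x2015463234251600; 0x1015642314562300;
  0x2015643234251600; 0x2016345244352601; 0x2016453234251600;
  0x2016543245361200; 0x2021346545361200; 0x2021354645361200;
  0x2021356445361200; 0x2021365445361200; 0x2021436566352401;
  0x2021453646351200; 0x2021456345361200; 0x2021463546351200;
  0x2021465345361200; 0x2021543646351200; 0x2021546345361200;
  0x2021563446351200; 0x2021564345361200; 0x2021645345361200;
  0x2021654345361200; 0x2023146566452301; 0x2023156456241300;
  0x2023164566452301; 0x2023165456241300; 0x2023416566352401;
  0x2023456134251600; 0x2023465134251600; 0x2023514666352401;
  0x2023546134251600; 0x2023564134251600; 0x2023614566352401;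
  0x2023645134251600; 0x2023654134251600; 0x2024136556241300;
  0x2024563134251600; 0x2024653134251600; 0x2025136456241300;
  0x2025436133241506; 0x2025463134251600; 0x2025634133241506;
  0x2025643134251600; 0x2026134556241300; 0x2026135456241300;
  0x2026453134251600; 0x2026543134251600; 0x2032146555461302;
  0x2032156455461302; 0x2032165455461302; 0x2032564134251600;
  0x2032654134251600; 0x2034126556241300; 0x2034561233241506;
  0x2034562134251600; 0x2034651233241506; 0x2034652134251600;
  0x2035462166051423; 0x2035641233241506; 0x2035642133241506;
  0x2036452166051423; 0x2036541233241506; 0x2036542133241506;
  0x1042316514562300; 0x1043216514562300; 0x2043652133241506;
  0x1045612314562300; 0x1045613214562300; 0x2045631256041322;
  0x2045632156041322; 0x1046513214562300; 0x2046531256041322;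
  0x2046532156041322; 0x2052341633241506; 0x2054321633241506;
  0x2054632166051423; 0x2056431256041322; 0x2056432156041322;
  0x2062345134251600; 0x2062435134251600; 0x2063452133241506;
  0x2064532166051423; 0x2065342134251600; 0x2065432134251600;
  0x2102346545361200; 0x2102356445361200; 0x2102365445361200;
  0x2102436566352401; 0x2102456345361200; 0x2102463546350211;
  0x2102465345361200; 0x2102546345361200; 0x2102563466352401;
  0x2102564345361200; 0x2102645345361200; 0x2102654345361200;
  0x2103256456241300; 0x2103265456241300; 0x2103426566352401;
  0x2103456234251600; 0x2103462546350211; 0x2103465234251600;
  0x2103546234251600; 0x2103564234251600; 0x2103624566352401;
  0x2103645234251600; 0x2103654234251600; 0x1104326524563301;
  0x2104365244352601; 0x1104562325663401; 0x2104563234251600;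
  0x1104652325663401; 0x2104653234251600; 0x2105463234251600;
  0x2105643234251600; 0x2106345244352601; 0x2106453234251600;
  0x2106543234251600; 0x2120356445361200; 0x2120364545361200;
  0x2120365445361200; 0x2120456345361200; 0x2120463546351200;
  0x2120465345361200; 0x2120536456341200; 0x2120546345361200;
  0x2120563446351200; 0x2120564345361200; 0x2120634566352401;
  0x2120635456341200; 0x2120643546351200; 0x2120645345361200;
  0x2120653446351200; 0x2120654345361200; 0x2123065456241300;
  0x2123460546350211; 0x2123604566352401; 0x2125036456241300;
  0x2126035456241300; 0x2130265455461302; 0x2132065455461302;
  0x2134560233241506; 0x2134650233241506; 0x2135640233241506;
  0x2136540233241506; 0x2145603266051423; 0x2145630256041322;
  0x2146503266051423; 0x2146530256041322; 0x2156042356041322;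
  0x2156043256041322; 0x2156430256041322; 0x2210365455461302;
  0x2210465344352601; 0x2210563446350211; 0x2210564334251600;
  0x2210645345360211; 0x2210654334251600; 0x2215604333241506;
  0x2216054366051423; 0x2240651333241506; 0x2013526436251400;
  0x2013542666342501; 0x2013562436241500; 0x2013625436251400;
  0x2013642566342501; 0x2013652436241500; 0x1014352614562300;
  0x1014356214562300; 0x2014362544362501; 0x2014526335241600;
  0x2014536245361200; 0x2014625355362401; 0x2014635235261400;
  0x2015436235241600; 0x1015462325443601; 0x2015634233241506;
  0x1016354215362400; 0x2023451666342501; 0x2023461566342501;
  0x2023516436251400; 0x2023541666342501; 0x2023561436241500;
  0x2023615436251400; 0x2023641566342501; 0x2023651436241500;
  0x1024153614562203; 0x1024156314562203; 0x1024356114562300;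
  0x1024561325663401; 0x1024651325663401; 0x2025143666251403;
  0x2025163466251403; 0x1025314615332604; 0x1025364115332406;
  0x2025431636241500; 0x2025631436241500; 0x1025641314662305;
  0x1026153414562203; 0x1026154314562203; 0x1026314515332604;
  0x1026345115342206; 0x1026541314662305; 0x2032416556341200;
  0x2032456145361200; 0x2032614536251400; 0x2043256155461302;
  0x2045362134251600; 0x2045621333241506; 0x1045623114562300;
  0x1046352115332406; 0x1046523114562300; 0x1053426114562300;
  0x1054326114552306; 0x1054362115442306; 0x2103526436251400;
  0x2103562436241500; 0x2103625436251400; 0x2103642566342501;
  0x2103652436241500; 0x2104362544362501; 0x1104526324663501;
  0x2104536245360211; 0x1104635226443501; 0x2105436235241600;
  0x2123506436251400; 0x2123560436241500; 0x2123605436251400;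
  0x2123640566342501; 0x2123650436241500; 0x1124056314562203;
  0x2124065333041526; 0x1124560325663401; 0x1124650325663401;
  0x2125063466251403; 0x2125630436241500; 0x1125640314662305;
  0x2126045333041526; 0x1126053414562203; 0x1126054314562203;
  0x1126304515332604; 0x1126540314662305; 0x1130564225663401;
  0x1130654225663401; 0x2145602333241506; 0x1145620314662305;
  0x1146520314662305; 0x2150236455461302; 0x2150623456140322;
  0x2150624356140322; 0x1150643204562213; 0x1156023414562300;
  0x1156024314562300; 0x1156403203564412; 0x1215064315332406;
  0x1216504315442306; 0x1014532625443601; 0x1014632525443601;
  0x2015346244352601; 0x1015362425663401; 0x2015364244352601;
  0x2016435245361200; 0x2024163566451302; 0x2024165344352601;
  0x1024316524561300; 0x1024351614662305; 0x2024513636251400;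
  0x2024516335261400; 0x1025146314662503; 0x2025413636251400;
  0x2025613436251400; 0x1026143514562203; 0x2026145333241506;
  0x1026315415362204; 0x2026341546231500; 0x2026354156341200;
  0x1026451314362205; 0x2026513436251400; 0x1026514313562204;
  0x2034156255462301; 0x2034216556241300; 0x1035621425663401;
  0x2036214566251403; 0x1043562115342206; 0x1046521314662305;
  0x1053421614662305; 0x2056342134251600; 0x2056423134251600;
  0x2063542124351600; 0x2064325135241600; 0x2064352134251600;
  0x1104356226453301; 0x1104625324663501; 0x1104632525443601;
  0x2105634245360211; 0x2105642346350211; 0x2106354234251600;
  0x2106435235241600; 0x2124063566451302; 0x2124506335261400;
  0x2124605335261400; 0x2125046355461302; 0x2125064355461302;
  0x2125603436251400; 0x1126043514552603; 0x1126305415362204;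
  0x2126340546231500; 0x1126350414362205; 0x1126450314362205;
  0x2126503436251400; 0x1126504313562204; 0x2130465245361200;
  0x2130652466143502; 0x2134065246350211; 0x2140653214352600;
  0x2150263466153402; 0x1162340524331605; 0x2214065325460311;
  0x2251064314352600; 0x2024365146351200; 0x2024536156341200;
  0x2024613536251400; 0x2024615335261400; 0x2025164334251600;
  0x2025316455460312; 0x2025341666450312; 0x2025346166452301;
  0x2026351446231500; 0x2026413536251400; 0x2026415335261400;
  0x2026534156341200; 0x2032465145361200; 0x2034162545360211;
  0x2034165244352601; 0x2034256155462301; 0x2034512666352401;
  0x2034516235261400; 0x1035612424563301; 0x2035624166041325;
  0x2036512466352401; 0x2036514266450312; 0x2042356111342506;
  0x2042653133241506; 0x1052346124563301; 0x2053462133241506;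
  0x2053642133241506; 0x2056243156041322; 0x2062543125460311;
  0x2105346244352601; 0x2105364244352601; 0x1105462325443601;
  0x2124360546231500; 0x2124603536251400; 0x2125306455460312;
  0x2125360466231405; 0x2125406333261504; 0x2125604335261400;
  0x2126403536251400; 0x2126405335261400; 0x2126530436241500;
  0x2130462546351200; 0x2130625466153402; 0x1130645205662314;
  0x1132460503554612; 0x2134062566241305; 0x2134506233251604;
  0x2134605233251604; 0x1135602424563301; 0x1135620424563301;
  0x1136504203564412; 0x2140563255460312; 0x2140652366150423;
  0x2146053236051422; 0x1150642304562213; 0x1213605424563301;
  0x2214605333251604; 0x2024361545361200; 0x2024531636241500;
  0x2024635133241506; 0x2025361446231500; 0x2025416344352601;
  0x2025614333241506; 0x2026435133241506; 0x2026531436241500;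
  0x2032461546351200; 0x1032651414662305; 0x2034265144352601;
  0x2034526156341200; 0x2034612536251400; 0x2034615235261400;
  0x2035162446251300; 0x2035164255462301; 0x2035264144251603;
  0x2036154244251603; 0x2036451266051423; 0x2036524134251600;
  0x2042365134251600; 0x2042563166051423; 0x2046253136051422;
  0x2052643134251600; 0x1105362425663401; 0x2124630536241500;
  0x2125460334261500; 0x2126430536241500; 0x2130526456140322;
  0x1130546204562311; 0x2130642536241500; 0x2134260566241305;
  0x2134602566231405; 0x2135064266251403; 0x1135604224563301;
  0x2136025466152403; 0x2136054244251603; 0x2136450266051423;
  0x1140265313664502; 0x2140625322034516; 0x2145063244251603;
  0x2146052312463500; 0x2154603266452301; 0x2156402355460312;
  0x2215063466051423; 0x2216045344352601; 0x2216503446350211;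
  0x1230651424563301; 0x2250641356241300; 0x2024631536241500;
  0x2025461334261500; 0x2026431536241500; 0x2032516445361200;
  0x2032615435261400; 0x1032645115442306; 0x2034261545361200;
  0x2034521666352401; 0x2034625134251600; 0x1035614224563301;
  0x2036254134251600; 0x2036521455041326; 0x2042361544361205;
  0x2042651336241500; 0x2045263134251600; 0x2052641336241500;
  0x1054623115342206; 0x2056324166451302; 0x1130562435441602;
  0x2132560444361205; 0x1132605425331604; 0x2132650445361200;
  0x2134620566231405; 0x2135026466152403; 0x2135460266051423;
  0x1136052404563312; 0x2136502455461302; 0x2136520455041326;
  0x2140365234251600; 0x2142065315462300; 0x1146025314662503;
  0x1146502315662304; 0x2150264355461302; 0x2152063466152403;
  0x1152064325663401; 0x2154602345361200; 0x2156320455041326;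
  0x1156420303554612; 0x2215603433241506; 0x2216053466450312;
  0x2240615355360214; 0x2032546133241506; 0x2032561444352601;
  0x2032641536241500; 0x2034621536241500; 0x1035461214562300;
  0x1036251414662305; 0x2042615336251400; 0x2042635134251600;
  0x2043651233241506; 0x1046251315362400; 0x2054361211243506;
  0x2054631256042311; 0x2064523134251600; 0x2132640536241500;
  0x2135062444261305; 0x1135260415662403; 0x2140362514362500;
  0x1140562335441602; 0x2140635234251600; 0x2142360545361200;
  0x1142650324563301; 0x1145026324563301; 0x1145360225443601;
  0x1150246313554602; 0x2150346214352600; 0x2150634234251600;
  0x1152604325663401; 0x1152640324563301; 0x1154620314332605;
  0x2216305455461302; 0x2230561444352601; 0x2236051444261305;
  0x1241605325663401; 0x1246015324563301; 0x2032541666352401;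
  0x2035261434251600; 0x2036215455261304; 0x2042631555041236;
  0x2043615256340211; 0x2045361255462301; 0x1046235116342500;
  0x1046351215362400; 0x2052634166051423; 0x1053624114562300;
  0x1053641225663401; 0x2054621345361200; 0x2135206455261304;
  0x1136250414662305; 0x2140632555041236; 0x2142605334251600;
  0x2143065234051622; 0x1143560215342600; 0x1143650224563301;
  0x1145062315662403; 0x1145260325663401; 0x2146035233041625;
  0x2146250333061524; 0x2150364244352601; 0x2152046315462300;
  0x2153604266051423; 0x1153620414662305; 0x1154026324661503;
  0x1154062325663401; 0x2154360211243506; 0x2154630256042311;
  0x1156032425341600; 0x2156204336051422; 0x1156240304553612;
  0x2216405344352601; 0x2235061434251600; 0x2245061355043612;
  0x1035216414562300; 0x2036415211364502; 0x2042516336251400;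
  0x2042536166051423; 0x2043265134251600; 0x2043561245361200;
  0x2043625166452301; 0x2045261333241506; 0x1046231515342600;
  0x2052364166051324; 0x2053264133260514; 0x1053621414662305;
  0x2056341266350412; 0x2062453135241600; 0x2063254133241506;
  0x2063524134251600; 0x2136042522164503; 0x2136205455261304;
  0x2142560334150622; 0x2142630555041236; 0x2143602511263504;
  0x2143605233251604; 0x2143620566231405; 0x2145036256241300;
  0x2146205344352601; 0x2146350256341200; 0x1150426314553602;
  0x1150462335661402; 0x2150463244352601; 0x2150632446350211;
  0x2152406345361200; 0x2153062446350211; 0x2153064244352601;
  0x2153640256241300; 0x2156034246351200; 0x2156302411263504;
  0x2156304266051423; 0x2156340256041322; 0x1254061325663401;
  0x2035241656231400; 0x2035246166352401; 0x1035416214562300;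
  0x2035426156241300; 0x2036145233061524; 0x2036412566231405;
  0x2042561345361200; 0x1043261513462205; 0x1043516214562300;
  0x2043526156341200; 0x2043612544352601; 0x2043621555461302;
  0x2045236166352401; 0x1046315216332504; 0x2046325146351200;
  0x2052361446350211; 0x2052436134251600; 0x1052461335442601;
  0x2052463134251600; 0x2053261422361504; 0x2053461222361504;
  0x2054263144352601; 0x2056234166451302; 0x2062354134251600;
  0x2063425166051423; 0x2135046255241306; 0x2136045255241306;
  0x2136240556041322; 0x2136402533162504; 0x2136405246351200;
  0x2143260533241506; 0x2146230555041326; 0x1146302515332604;
  0x2146305244031625; 0x2146320555041326; 0x2150326455460312;
  0x2150362411463502; 0x2152603466352401; 0x2153406244051623;
  0x2153460255041623; 0x1153602415342600; 0x2154063233061524;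
  0x2154260356241300; 0x2156203416253400; 0x1156230414662305;
  0x1250461335661402; 0x2035142656241300; 0x2035146255461302;
  0x1035412614562300; 0x2035421611342506; 0x2036241556341200;
  0x2036245144352601; 0x2036425156041322; 0x1045231625663401;
  0x1045316214562300; 0x2045326166452301; 0x1046321515342600;
  0x2052431644231506; 0x2053246122341605; 0x2054236155012634;
  0x2135406255231406; 0x2136420566231405; 0x2145306255460312;
  0x2150436255460312; 0x2152360455461302; 0x2152460345361200;
  0x2152630445361200; 0x2153260455041326; 0x2154036266340215;
  0x2162430555012634; 0x2250361455461302; 0x2036421566231405;
  0x2045312645361200; 0x1045321625663401; 0x2063245134251600;
  0x2154306246351200]%num.

Definition representatives k :=
  nth [::] [:: [::]; cert1; cert2; cert3; cert4; cert5; cert6; cert7] k.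

(** Besides checking each entry, the computation confirms that the orbits exhaust all permutations
    of each length. *)
Lemma certificates_triangular :
  all (fun k => triangular k Leaf (certificate k (representatives k))) (iota 1 7).
Proof. by vm_compute. Qed.

Theorem theorem3p1 (k : nat) (hk : 1 <= k <= 7) :
  exists (p : program) (b : nat) (time space : nat -> nat),
    [/\ 0 < b,
        soft_O time (fun n => n ^ 2),
        soft_O space (fun n => n ^ 2)
      & forall (n : nat) (pi : 'S_n),
          computes (word_size b n) p (perm_vector pi) (profile k pi)
            (time n) (space n)].
Proof.
have /(allP certificates_triangular) chk : k \in iota 1 7 by rewrite mem_iota.
(* From here on only triangularity matters; generalising keeps the large list from being
   unfolded. *)
move: (certificate _ _) chk => es chk.
exists (profile_program k es), 16, (profile_time k es), (profile_space k).
split=> // [||n pi]; first exact: profile_time_softO.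
  exact: profile_space_softO.
exact: profile_computes.
Qed.
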